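(* Let $q\ge3$ be an integer and let $\chi$ be a primitive Dirichlet character modulo $q$. Let $\psi(u)=u-[u]-\tfrac12$ for real $u$. Let $r\ge1$ be an integer and let $X>0$ be arbitrary. I) (a) $$(-1)^rL^{(r)}(1,\chi)=\sum_{n\le X}\frac{\chi(n)\log^rn}{n}+\sum_{a=1}^q\chi(a)\Big\{\psi\Big(\frac{X-a}q\Big)\frac{\log^rX}{X}+\frac1q\int_{X/q}^\infty\frac{\psi(u-\frac aq)}{u^2}\log^{r-1}(qu)\,\big(r-\log(qu)\big)\,du\Big\}.$$ (b) With absolute implied constants, $$L^{(r)}(1,\chi)=(-1)^r\sum_{n\le qe^{r/2}}\frac{\chi(n)\log^rn}{n}+O\Big(q^{-1/2}e^{-r/2}\log q\cdot\big(\log q+\tfrac r2\big)^r\Big)\ll\big(\log q+\tfrac r2\big)^{r+1}.$$ II) (a) $$(-1)^rL^{(r)}(0,\chi)=\sum_{n\le X}\chi(n)\log^rn+\log^rX\cdot\sum_{a=1}^q\chi(a)\Big(\frac{X-a}q-\Big[\frac{X-a}q\Big]-\frac12\Big)+r\sum_{a=1}^q\chi(a)\int_{X/q}^\infty\frac{\psi(u-\frac aq)}{u}\log^{r-1}(qu)\,du.$$ (b) With an absolute implied constant, $$L^{(r)}(0,\chi)=(-1)^r\sum_{n\le qe^{r-1}}\chi(n)\log^rn+O\Big(q^{1/2}\log q\cdot(\log q+r)^r\Big).$$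
   Context: $[u]$ denotes the integral part (floor) of $u$; $\log^r y=(\log y)^r$, with $\log^0y=1$. $L(s,\chi)$ is the Dirichlet $L$-function, $L(s,\chi)=\sum_{n\ge1}\chi(n)n^{-s}$ for $\mathrm{Re}\,s>1$, together with its analytic continuation, and $L^{(r)}$ denotes its $r$-th derivative with respect to $s$. Sums over $n\le Y$ run over positive integers; empty sums are zero. Integrals over $[X/q,\infty)$ are improper integrals, $\int_{c}^\infty=\lim_{N\to\infty}\int_c^N$. The constants in $O(\cdot)$ and $\ll$ are absolute, i.e. independent of $q$, $\chi$ and $r$. *)

(* Defs.v *)
From HB Require Import structures.
From mathcomp Require Import all_boot all_order all_algebra.
From mathcomp Require Import all_classical all_reals all_analysis.
From mathcomp Require Import complex.

(* The complex numbers are R[i], for R : realType. *)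

Set Implicit Arguments.
Unset Strict Implicit.
Unset Printing Implicit Defensive.

Import Order.TTheory GRing.Theory Num.Theory.
Import numFieldNormedType.Exports.

Local Open Scope ring_scope.
Local Open Scope complex_scope.
Local Open Scope classical_set_scope.

(* R[i] as a one-dimensional normed module over itself, so that f^`(n) is the
   n-th complex derivative of f : R[i] -> R[i]. *)
HB.instance Definition _ (R : rcfType) := GRing.ComAlgebra.copy R[i] R[i]^o.
HB.instance Definition _ (R : rcfType) := Vector.copy R[i] R[i]^o.
HB.instance Definition _ (R : rcfType) := NormedModule.copy R[i] R[i]^o.

(* A character modulo q is given by its values on the natural numbers, which
   determine it by periodicity. *)
Definition dirichlet_character (R : realType) (q : nat) (chi : nat -> R[i]) :=
  [/\ chi 1%N = 1,
      forall m n : nat, chi (m * n)%N = chi m * chi n,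
      forall n : nat, chi (n + q)%N = chi n
    & forall n : nat, (chi n != 0) = coprime n q].

(* Primitive: not induced by a character of a smaller modulus. *)
Definition primitive_character (R : realType) (q : nat) (chi : nat -> R[i]) :=
  dirichlet_character q chi /\
  ~ (exists d : nat, exists chi' : nat -> R[i],
      [/\ (d < q)%N, (d %| q)%N, dirichlet_character d chi' &
          forall n : nat, coprime n q -> chi n = chi' n]).

Definition cexp (R : realType) (z : R[i]) : R[i] :=
  (expR (complex.Re z))%:C *
  ((cos (complex.Im z))%:C + 'i%C * (sin (complex.Im z))%:C).

(* Analytic at z0: the sum of a convergent power series near z0. *)
Definition analytic_at (R : realType) (f : R[i] -> R[i]) (z0 : R[i]) :=
  exists a : nat -> R[i],
    \forall z \near z0, [series a k * (z - z0) ^+ k]_k @ \oo --> f z.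

(* L is the Dirichlet L-function of chi: the analytic function on the whole
   plane (unique, by the identity theorem) extending the sum of
   chi(n) n^-s = chi(n) exp(-s log n), n >= 1, from the half-plane Re s > 1. *)
Definition is_dirichlet_L (R : realType) (chi : nat -> R[i])
    (L : R[i] -> R[i]) :=
  (forall s : R[i], analytic_at L s) /\
  (forall s : R[i], 1 < complex.Re s ->
     [series chi k.+1 * cexp (- s * (ln k.+1%:R)%:C)]_k @ \oo --> L s).

Definition psi (R : realType) (u : R) : R := u - (Num.floor u)%:~R - 2^-1.

(* The integral of f over [c, N]; its limit as N tends to +oo, when it exists,
   is the improper (possibly only conditionally convergent) integral. *)
Definition int_upto (R : realType) (f : R -> R) (c N : R) : R :=
  \int[lebesgue_measure]_(u in `[c, N]) f u.

Definition improper_cvg (R : realType) (f : R -> R) (c : R) : Prop :=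
  cvg (int_upto f c N @[N --> +oo]).

Definition improper_int (R : realType) (f : R -> R) (c : R) : R :=
  lim (int_upto f c N @[N --> +oo]).

(* Main.v *)
Require Import Defs.
From mathcomp Require Import all_boot all_order all_algebra.
From mathcomp Require Import all_classical all_reals all_analysis.
From mathcomp Require Import measurable_realfun complex ring lra zify.
From mathcomp Require cyclic.

(* Let S(t) be the sum of chi(n) over n <= t.  The sawtooth sum
   Psi(t) = sum_a chi(a) psi((t - a)/q) equals kappa - S(t), a step function of
   period q and mean zero.  Partial summation turns
     sum_(n <= N) chi(n) g(n) + Psi(N) g(N)
   into the same expression at X plus the integral of Psi g' over [X, N], so
   each formula amounts to showing that these truncations tend to
   (-1)^r L^(r)(s) for g(t) = t^-s log^r t.  A second summation by parts, against
   the periodic partial sums of Psi, expresses the limit through second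
   differences of g.  It therefore exists for 0 <= s <= 2, and for r = 0 it is a
   power series around every such s with the limits for r >= 1 as Taylor
   coefficients.  It agrees with L for s > 1, hence down to s = 0 by the identity
   theorem on the real line.
   For the error terms, the Polya-Vinogradov inequality gives
   |Psi| << sqrt q log q, and since Psi has mean zero its integral over any
   interval is << q^(3/2) log q.  The second mean value theorem then applies
   because log^k t / t^p decreases once log t >= k/p, which is what dictates the
   cut-offs q e^(r/2) and q e^(r-1). *)

Import Order.TTheory GRing.Theory Num.Theory.
Import numFieldNormedType.Exports.

Local Open Scope ring_scope.
Local Open Scope complex_scope.
Local Open Scope classical_set_scope.

Local Notation Re := (@complex.Re _).
Local Notation Im := (@complex.Im _).

Set Implicit Arguments.
Unset Strict Implicit.
Unset Printing Implicit Defensive.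

(** * Limits and power series over R[i] *)

(** At s = 0 one summation by parts is not enough: the increments of log^r n have order log^(r-1) n
    / n and are not absolutely summable, whereas for fixed r the second differences of n^-s log^r n
    are O(n^(-3/2)) uniformly for 0 <= s <= 2. The integrals are real, so chi is replaced by the
    real weights Re chi and Im chi, and two real formulas are recombined at the end; this turns the
    factor 2 of the remainder into 4. The hypothesis on L only gives, at each point, a power series
    of unspecified radius. Derivatives are therefore read off as Taylor coefficients, and the
    comparison with the limits of truncations moves left along the real axis by an infimum argument,
    which at each stage knows agreement on one side of a point only. The variable of integration is
    u = t/q, which makes the sawtooth sum 1-periodic and turns log t into log(qu). *)

Section ComplexLimits.
Context {R : realType}.
Implicit Types (z w : R[i]) (u : nat -> R[i]).

Lemma real_complexD (x y : R) : (x + y)%:C = x%:C + y%:C. Proof. exact: rmorphD. Qed.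
Lemma real_complexB (x y : R) : (x - y)%:C = x%:C - y%:C. Proof. exact: rmorphB. Qed.
Lemma real_complexN (x : R) : (- x)%:C = - x%:C. Proof. exact: rmorphN. Qed.
Lemma real_complexM (x y : R) : (x * y)%:C = x%:C * y%:C. Proof. exact: rmorphM. Qed.
Lemma real_complexV (x : R) : x^-1%:C = x%:C^-1. Proof. exact: fmorphV. Qed.
Lemma real_complexX (x : R) n : (x ^+ n)%:C = x%:C ^+ n. Proof. exact: rmorphXn. Qed.
Lemma real_complex_nat n : (n%:R : R)%:C = n%:R. Proof. exact: rmorph_nat. Qed.
Lemma real_complex_sum (I : Type) (r : seq I) (P : pred I) (F : I -> R) :
  (\sum_(i <- r | P i) F i)%:C = \sum_(i <- r | P i) (F i)%:C.
Proof. exact: rmorph_sum. Qed.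

Lemma gt0_complexE z : 0 < z -> z = (Re z)%:C /\ 0 < Re z.
Proof. by case: z => a b; rewrite ltcE /= => /andP[/eqP -> ->]. Qed.

Lemma normc_is_real z : exists r : R, `|z| = r%:C /\ 0 <= r.
Proof. by rewrite normc_def; eexists; split; [by []|exact: sqrtr_ge0]. Qed.

Lemma normc_Re_le z (c : R) : `|z| <= c%:C -> `|Re z| <= c.
Proof. by move=> zc; rewrite -lecR; apply: le_trans zc; exact: normc_ge_Re. Qed.

Lemma normc_Im_le z (c : R) : `|z| <= c%:C -> `|Im z| <= c.
Proof.
move=> zc; rewrite -normrN -ReiNIm; apply: normc_Re_le.
by rewrite normrM [`|'i%C|]normc_def/= expr0n add0r expr1n sqrtr1 mulr1.
Qed.

Lemma normc_real (x : R) : `|x%:C| = `|x|%:C.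
Proof. by rewrite normc_def/= expr0n addr0 sqrtr_sqr. Qed.

Lemma normc_le_ReIm z : `|z| <= (`|Re z| + `|Im z|)%:C.
Proof.
rewrite [z in leLHS]complexE (le_trans (ler_normD _ _))// normrM !normc_real.
by rewrite [`|'i%C|]normc_def/= expr0n add0r expr1n sqrtr1 mul1r rmorphD.
Qed.

Lemma cvg_complexP u l : u @ \oo --> l <->
  forall e : R, 0 < e -> \forall n \near \oo, `|l - u n| < e%:C.
Proof.
split=> [/cvgrPdist_lt ul e e0|ul].
  by apply: ul; rewrite ltcR.
apply/cvgrPdist_lt => e /gt0_complexE[-> e0]; exact: ul.
Qed.

Lemma cvg_ReIm u (x y : R) :
  (Re \o u) @ \oo --> x -> (Im \o u) @ \oo --> y ->
  u @ \oo --> x +i* y.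
Proof.
move=> /cvgrPdist_lt ux /cvgrPdist_lt uy; apply/cvg_complexP => e e0.
near=> n.
apply: (le_lt_trans (normc_le_ReIm _)); rewrite ltcR [ltRHS]splitr ltrD//=.
  by rewrite raddfB/=; near: n; apply: ux; rewrite divr_gt0.
by rewrite raddfB/=; near: n; apply: uy; rewrite divr_gt0.
Unshelve. all: by end_near. Qed.

Lemma cvg_Re u l : u @ \oo --> l -> (Re \o u) @ \oo --> Re l.
Proof.
move=> /cvg_complexP ul; apply/cvgrPdist_lt => e /ul; apply: filterS => n.
rewrite -ltcR; apply: le_lt_trans.
by rewrite -raddfB normc_ge_Re.
Qed.

Lemma cvg_Im u l : u @ \oo --> l -> (Im \o u) @ \oo --> Im l.
Proof.
move=> /cvg_complexP ul; apply/cvgrPdist_lt => e /ul; apply: filterS => n.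
have [r [zr r0]] := normc_is_real (l - u n).
rewrite zr ltcR; apply: le_lt_trans.
by rewrite -raddfB normc_Im_le// zr.
Qed.

(** The real comparison test is applied to both coordinates; [cvg_part] treats them at once as
    additive maps bounded by the modulus. *)
Lemma cvg_series_majorant u (v : R^nat) :
  (forall n, `|u n| <= (v n)%:C) -> cvgn (series v) ->
  exists l : R[i], series u @ \oo --> l.
Proof.
move=> uv cv.
have cvg_part (f : R[i] -> R) : {morph f : x y / x + y} -> f 0 = 0 ->
    (forall z c, `|z| <= c%:C -> `|f z| <= c) -> cvgn (f \o series u).
  move=> fD f0 fc.
  have -> : f \o series u = series (f \o u).
    by apply/funext => n; rewrite /series/= (big_morph f fD f0).
  apply: normed_cvg; apply: (series_le_cvg _ _ _ cv) => n //=.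
    by apply: le_trans (normr_ge0 _) (fc _ _ (uv n)).
  exact: fc.
have /cvg_ex[x ux] := cvg_part Re (raddfD _) (raddf0 _) normc_Re_le.
have /cvg_ex[y uy] := cvg_part Im (raddfD _) (raddf0 _) normc_Im_le.
by exists (x +i* y); exact: cvg_ReIm.
Qed.

Lemma normc_cvg_le u l (c : R) : u @ \oo --> l ->
  (forall n, `|u n| <= c%:C) -> `|l| <= c%:C.
Proof.
move=> /cvg_complexP ul uc; have [r [lr r0]] := normc_is_real l.
rewrite lr lecR leNgt; apply/negP => cr.
have [|N _ /(_ N (leqnn _))/=] := ul (r - c); first by rewrite subr_gt0.
move=> lN; have : `|l| < r%:C; last by rewrite lr ltxx.
rewrite -[l in ltLHS](subrK (u N)) (le_lt_trans (ler_normD _ _))//.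
by rewrite -[r](subrK c) rmorphD/= ltr_leD.
Qed.

End ComplexLimits.

(** * Termwise differentiation of power series *)

Section PowerSeries.
Context {R : realType}.
Implicit Types (z w : R[i]) (a : nat -> R[i]).

(** The shift by one reflects that differentiation kills the constant term: n terms of the derived
    series match n + 1 terms of the original one. *)
Lemma cvg_quotient (u v d : nat -> R[i]) (x y D c : R[i]) :
  d @ \oo --> D -> u @ \oo --> x -> v @ \oo --> y ->
  (fun n => d n - c * (u n.+1 - v n.+1)) @ \oo --> D - c * (x - y).
Proof.
move=> dD; rewrite -cvg_shiftS => ux; rewrite -cvg_shiftS => vy.
exact: (cvgB dD (cvgM (cvg_cst c) (cvgB ux vy))).
Qed.

(** The remainders satisfy R_(n+1) = (w + h) R_n + n h^2 w^(n-1), and C(n+1, 2) = C(n, 2) + n closes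
    the induction. The factor K^2 stands on the left so that the exponent n - 2 never occurs. *)
Lemma expr_remainder_bound (F : numDomainType) (w h K : F) n :
  `|w| <= K -> `|w + h| <= K ->
  `|(w + h) ^+ n - w ^+ n - h * (n%:R * w ^+ n.-1)| * K ^+ 2
    <= `|h| ^+ 2 * 'C(n, 2)%:R * K ^+ n.
Proof.
move=> wK whK; have K0 : 0 <= K := le_trans (normr_ge0 _) wK.
elim: n => [|n IH].
  by rewrite !expr0 mul0r mulr0 !subrr normr0 mul0r !mulr_ge0// exprn_ge0.
have -> : (w + h) ^+ n.+1 - w ^+ n.+1 - h * (n.+1%:R * w ^+ n.+1.-1) =
   (w + h) * ((w + h) ^+ n - w ^+ n - h * (n%:R * w ^+ n.-1))
     + h ^+ 2 * (n%:R * w ^+ n.-1).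
  case: n {IH} => [|n] /=; rewrite ?exprS ?expr0 -?natr1; ring.
rewrite (le_trans (ler_wpM2r _ (ler_normD _ _))) ?exprn_ge0// mulrDl.
have -> : `|h| ^+ 2 * 'C(n.+1, 2)%:R * K ^+ n.+1 =
    K * (`|h| ^+ 2 * 'C(n, 2)%:R * K ^+ n) + `|h| ^+ 2 * (n%:R * K ^+ n.+1).
  by rewrite binS bin1 natrD (exprS K n); ring.
apply: lerD.
  by rewrite normrM -mulrA ler_pM// mulr_ge0// exprn_ge0.
rewrite normrM normrX normrM normr_nat normrX -mulrA.
apply: ler_wpM2l; first by rewrite exprn_ge0.
case: n {IH} => [|n]; first by rewrite !mul0r.
rewrite -mulrA -(addn2 n) exprD; apply: ler_wpM2l; first exact: ler0n.
by apply: ler_wpM2r; rewrite ?exprn_ge0// lerXn2r ?nnegrE.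
Qed.

(* |a_k| rho^k <= M: Cauchy's estimate, which is what convergence at a single
   point gives. *)
Definition power_series_on (f : R[i] -> R[i]) z0 a (rho M : R) :=
  [/\ 0 < rho, forall k, `|a k| <= (M / rho ^+ k)%:C &
      forall w, `|w| < rho%:C -> [series a k * w ^+ k]_k @ \oo --> f (z0 + w)].

(** The terms of a series convergent at rho/2 are bounded, which supplies M; halving the radius puts
    that point inside the given disc. *)
Lemma power_series_onE f z0 a :
  (\forall z \near z0, [series a k * (z - z0) ^+ k]_k @ \oo --> f z) ->
  exists rho M, power_series_on f z0 a rho M.
Proof.
move=> /nbhs_ballP[rho' /= /gt0_complexE[]].
move: (Re rho') => rho -> rho0 fa.
have r20 : 0 < rho / 2 by rewrite divr_gt0.
have near_z0 w : `|w| < rho%:C -> [series a k * w ^+ k]_k @ \oo --> f (z0 + w).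
  move=> wr; have := fa (z0 + w); rewrite /ball/= opprD addNKr normrN => /(_ wr).
  by rewrite addrC addKr.
have /near_z0 /cvgP/cvg_series_cvg_0 : `|(rho / 2)%:C : R[i]| < rho%:C.
  by rewrite normc_real ltcR gtr0_norm// ltr_pdivrMr// ltr_pMr// ltr1n.
move=> h; have [B [Breal aB]] := cvg_seq_bounded (cvgP _ h).
have [c [Bc c0]] := normc_is_real B.
have {}aB k : `|a k| * (rho / 2)%:C ^+ k <= (c + 1)%:C.
  have -> : `|a k| * (rho / 2)%:C ^+ k = `|a k * (rho / 2)%:C ^+ k|.
    by rewrite normrM normrX normc_real (gtr0_norm r20).
  apply: (aB (c + 1)%:C) => //; rewrite (le_lt_trans (real_ler_norm Breal))// Bc.
  by rewrite ltcR ltrDl.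
exists (rho / 2), (c + 1); split; [exact: r20|move=> k|move=> w wr].
  have rk0 : 0 < (rho / 2) ^+ k by rewrite exprn_gt0.
  have rkC : (0 : R[i]) < ((rho / 2) ^+ k)%:C by rewrite ltcR.
  rewrite -(ler_pM2r rkC).
  have -> : ((c + 1) / (rho / 2) ^+ k)%:C * ((rho / 2) ^+ k)%:C = (c + 1)%:C.
    by rewrite -real_complexM divfK// gt_eqF.
  by rewrite real_complexX; exact: aB.
apply: near_z0; apply: (lt_trans wr).
by rewrite ltcR ltr_pdivrMr// ltr_pMr// ltr1n.
Qed.

Lemma bin2_le_exp2 n : ('C(n, 2) <= 2 ^ n)%N.
Proof.
elim: n => [//|n IH]; rewrite binS bin1 expnS mul2n -addnn leq_add//.
exact/ltnW/ltn_expl.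
Qed.

Lemma sum_half_le2 n : \sum_(0 <= k < n) (2^-1 : R) ^+ k <= 2.
Proof.
suff -> : \sum_(0 <= k < n) (2^-1 : R) ^+ k = 2 - 2 * 2^-1 ^+ n.
  by rewrite gerBl mulr_ge0// exprn_ge0// invr_ge0.
elim: n => [|n IH]; first by rewrite big_nil expr0; lra.
by rewrite big_nat_recr//= IH exprS; field.
Qed.

(** Shrinking the radius by 4 makes room for crude estimates: (rho/4)^k / rho^k = 2^-k * 2^-k, where
    one factor absorbs k + 1 or C(k, 2), both at most 2^k, and the other keeps the series summable.
    The loss is harmless, since derivatives are only evaluated at the centre. *)
Lemma power_series_on_derive1 f z0 a (rho M : R) :
  power_series_on f z0 a rho M ->
  power_series_on (f^`())%classic z0 (fun k => k.+1%:R * a k.+1) (rho / 4) (M / rho).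
Proof.
move=> [rho0 aM fa].
have M0 : 0 <= M.
  by have := le_trans (normr_ge0 _) (aM 0); rewrite expr0 divr1 ler0c.
have natC n : (n%:R : R[i]) = (n%:R : R)%:C by rewrite real_complex_nat.
have K0 : 0 < rho / 4 by rewrite divr_gt0.
have bound k : k.+1%:R * `|a k.+1| <= (M / rho * 2^-1 ^+ k / (rho / 4) ^+ k)%:C.
  rewrite natC (le_trans (ler_wpM2l _ (aM _))) ?ler0c// -real_complexM lecR.
  have -> : k.+1%:R * (M / rho ^+ k.+1) = M / rho * k.+1%:R * (rho^-1) ^+ k.
    by rewrite exprS invfM exprVn; ring.
  rewrite -!mulrA; apply: ler_wpM2l => //; apply: ler_wpM2l.
    by rewrite invr_ge0 ltW.
  have -> : 2^-1 ^+ k / (rho / 4) ^+ k = 2 ^+ k * rho^-1 ^+ k.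
    rewrite -exprVn -!exprMn; congr (_ ^+ _); field; lra.
  apply: ler_wpM2r; first by rewrite exprn_ge0 // invr_ge0 ltW.
  by rewrite -natrX ler_nat ltn_expl.
split => //.
  move=> k; rewrite normrM normr_nat (le_trans (bound k))// lecR.
  rewrite -mulrA; apply: ler_wpM2l; first by rewrite divr_ge0// ltW.
  rewrite -[leRHS]mul1r; apply: ler_wpM2r.
    by rewrite invr_ge0 exprn_ge0 // ltW.
  by rewrite exprn_ile1 ?invr_ge0 ?invf_le1 ?ler1n.
move=> w wK; set d := (fun k => _ * w ^+ k).
have [D dD] : exists D : R[i], series d @ \oo --> D.
  apply: (@cvg_series_majorant _ _ (geometric (M / rho) 2^-1)); last first.
    by apply: is_cvg_geometric_series; rewrite ger0_norm// invf_lt1 // ltr1n.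
  move=> k; rewrite /d /= !normrM normr_nat normrX.
  have -> : (M / rho * 2^-1 ^+ k)%:C =
     (M / rho * 2^-1 ^+ k / (rho / 4) ^+ k)%:C * (rho / 4)%:C ^+ k.
    by rewrite -real_complexX -real_complexM/= divfK// expf_neq0// gt_eqF.
  apply: ler_pM; rewrite ?mulr_ge0 ?exprn_ge0//.
  by rewrite lerXn2r ?nnegrE//= ?ler0c ltW.
have [s [ws s0]] := normc_is_real w; have sK : s < rho / 4 by rewrite -ltcR -ws.
have wle : `|w| <= (rho / 4)%:C by rewrite ltW.
(* The remainders, which carry the factor (rho/4)^2, sum to at most M |h|^2 (1 + 1/2 + 1/4 + ...) <=
   2 M |h|^2; dividing by |h| leaves an error linear in h. *)
pose C := 2 * M / (rho / 4) ^+ 2.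
have C0 : 0 <= C by apply: divr_ge0; [exact: mulr_ge0|exact: sqr_ge0].
have K2 : 0 < (rho / 4) ^+ 2 by rewrite exprn_gt0.
have quot (h : R[i]) : h != 0 -> `|h| < (rho / 4 - s)%:C ->
    `|D - h^-1 * (f (h + (z0 + w)) - f (z0 + w))| <= C%:C * `|h|.
  move=> h0 hK; have [t [ht t0]] := normc_is_real h.
  have whlt : `|w + h| < (rho / 4)%:C.
    by rewrite (le_lt_trans (ler_normD _ _))// ws addrC -ltrBrDr -real_complexB.
  have in_disc (v : R[i]) : `|v| < (rho / 4)%:C -> `|v| < rho%:C.
    move=> /lt_trans; apply; rewrite ltcR ltr_pdivrMr// ltr_pMr//.
    by rewrite ltr1n.
  have fwh := fa _ (in_disc _ whlt); have fw := fa _ (in_disc _ wK).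
  rewrite (_ : h + (z0 + w) = z0 + (w + h)); last by rewrite addrC -addrA.
  have dU := cvg_quotient (c := h^-1) dD fwh fw.
  rewrite ht -real_complexM; refine (@normc_cvg_le _ _ _ (C * t) dU _). move=> n.
  have -> : series d n - h^-1 *
      ([series a k * (w + h) ^+ k]_k n.+1 - [series a k * w ^+ k]_k n.+1) =
      - h^-1 * \sum_(0 <= k < n.+1)
         a k * ((w + h) ^+ k - w ^+ k - h * (k%:R * w ^+ k.-1)).
    rewrite /series/= -sumrB mulNr.
    have -> : \sum_(0 <= k < n) d k = \sum_(0 <= k < n.+1) a k * (k%:R * w ^+ k.-1).
      rewrite big_nat_recl//= mul0r !mulr0 add0r.
      by apply: eq_bigr => k _; rewrite /d; ring.
    rewrite !mulr_sumr -sumrB -sumrN; apply: eq_bigr => k _.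
    by field.
  have t_gt0 : 0 < t by rewrite -ltcR -ht normr_gt0.
  have sumE : `|\sum_(0 <= k < n.+1)
      a k * ((w + h) ^+ k - w ^+ k - h * (k%:R * w ^+ k.-1))|
      * (rho / 4)%:C ^+ 2 <= (t ^+ 2 * (2 * M))%:C.
    apply: (le_trans (ler_wpM2r _ (ler_norm_sum _ _ _))).
      by rewrite exprn_ge0// ler0c ltW.
    rewrite mulr_suml.
    apply: (@le_trans _ _ (\sum_(0 <= k < n.+1) (t ^+ 2 * M * 2^-1 ^+ k)%:C)).
      apply: ler_sum => k _; rewrite normrM -mulrA.
      apply: (le_trans (ler_pM _ _ (aM k)
        (expr_remainder_bound k wle (ltW whlt)))) => //.
        by rewrite mulr_ge0// exprn_ge0// ler0c ltW.
      rewrite ht natC -!real_complexX -!real_complexM lecR.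
      have -> : M / rho ^+ k * (t ^+ 2 * 'C(k, 2)%:R * (rho / 4) ^+ k) =
          t ^+ 2 * M * ('C(k, 2)%:R * (rho^-1 * (rho / 4)) ^+ k).
        by rewrite !exprMn !exprVn; ring.
      apply: ler_wpM2l; first by rewrite mulr_ge0// exprn_ge0.
      have -> : rho^-1 * (rho / 4) = 2^-1 * 2^-1 by field; rewrite gt_eqF.
      rewrite exprMn mulrA -[leRHS]mul1r; apply: ler_wpM2r.
        by rewrite exprn_ge0 // invr_ge0.
      by rewrite exprVn ler_pdivrMr ?exprn_gt0// mul1r -natrX ler_nat bin2_le_exp2.
    rewrite -real_complex_sum -mulr_sumr lecR (mulrC 2) mulrA.
    by apply: ler_wpM2l; rewrite ?mulr_ge0 ?exprn_ge0// sum_half_le2.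
  rewrite -(ler_pM2r (_ : 0 < (rho / 4)%:C ^+ 2)) ?exprn_gt0 ?ltcR//.
  rewrite normrM normrN normfV ht -mulrA.
  apply: (le_trans (ler_wpM2l _ sumE)); first by rewrite invr_ge0 ler0c.
  rewrite -real_complexV -real_complexX -!real_complexM lecR /C.
  by rewrite le_eqVlt; apply/orP; left; apply/eqP; field; rewrite !gt_eqF.
have -> : (f^`())%classic (z0 + w) = D; last exact: dD.
apply: cvg_lim; first exact: norm_hausdorff.
apply/cvgrPdist_lt => e' /gt0_complexE[].
move: (Re e') => e -> e0.
have C1 : 0 < C + 1 by rewrite ltr_pwDr.
have d0 : 0 < (Num.min (rho / 4 - s) (e / (C + 1)))%:C.
  by rewrite ltcR lt_min subr_gt0 sK divr_gt0.
near=> h.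
have h0 : h != 0 by near: h; exact: nbhs_dnbhs_neq.
have : `|h| < (Num.min (rho / 4 - s) (e / (C + 1)))%:C.
  by near: h; apply: dnbhs0_lt.
have [t [ht t0]] := normc_is_real h.
rewrite ht ltcR lt_min => /andP[ts te].
apply: (le_lt_trans (quot h h0 _)); rewrite ht ?ltcR// -real_complexM ltcR.
move: te; rewrite ltr_pdivlMr// mulrC; apply: le_lt_trans.
by rewrite ler_wpM2r// lerDl.
Unshelve. all: by end_near. Qed.

(** The derivative again has an expansion with Cauchy estimates at the same centre, so the induction
    runs over all functions and coefficient sequences at once. *)
Lemma power_series_derive1n f z0 a r :
  (\forall z \near z0, [series a k * (z - z0) ^+ k]_k @ \oo --> f z) ->
  (f^`(r))%classic z0 = r`!%:R * a r.
Proof.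
move=> /power_series_onE[rho [M]].
elim: r f a rho M => [|r IH] f a rho M faM.
  have [rho0 _ /(_ 0)] := faM; rewrite normr0 ltcR addr0 => /(_ rho0) f0.
  rewrite fact0 mul1r.
  have a0 : [series a k * 0 ^+ k]_k @ \oo --> a 0; last first.
    exact: (cvg_unique (@norm_hausdorff _ _) f0 a0).
  apply: cvg_near_cst; exists 1%N => //= -[//|n] _.
  rewrite /series/= big_nat_recl//= expr0 mulr1 big1 ?addr0// => k _.
  by rewrite expr0n/= mulr0.
rewrite derive1Sn (IH _ _ _ _ (power_series_on_derive1 faM)).
by rewrite factS natrM; ring.
Qed.

End PowerSeries.

(** * Primitive characters and Gauss sums *)

Section Lift.

(* A representative prime to q of the class of n modulo d. *)
Definition coprime_lift (d q n : nat) : nat :=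
  ((n %% d + d) + d * q`_(\pi(n %% d + d)^'))%N.

Lemma coprime_lift_mod d q n : coprime_lift d q n = n %[mod d].
Proof. by rewrite /coprime_lift -modnDmr modnMr addn0 modnDr modn_mod. Qed.

(** A prime p dividing q divides exactly one of the two summands. If p divides n', it divides
    neither d, to which n' is prime, nor the part of q prime to n'; otherwise it divides that part.
    The added d keeps n' positive. *)
Lemma coprime_liftP d q n : (0 < d)%N -> (0 < q)%N -> coprime n d ->
  coprime (coprime_lift d q n) q.
Proof.
move=> d0 q0 nd; rewrite /coprime_lift; set n' := (n %% d + d)%N.
have n'0 : (0 < n')%N by rewrite addn_gt0 d0 orbT.
have n'd : coprime n' d by rewrite -coprime_modl modnDr modn_mod coprime_modl.
case: (boolP (coprime _ q)) => // ncop.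
have [p p_pr] : exists2 p, prime p & (p %| gcdn (n' + d * q`_(\pi(n')^')) q)%N.
  exists (pdiv (gcdn (n' + d * q`_(\pi(n')^')) q))%N; last exact: pdiv_dvd.
  apply: pdiv_prime; rewrite ltn_neqAle eq_sym [X in X && _]ncop.
  by rewrite gcdn_gt0 q0 orbT.
rewrite dvdn_gcd => /andP[pn pq].
have [pn'|pn'] := boolP (p %| n')%N.
  move: pn; rewrite dvdn_addr// Euclid_dvdM// => /orP[pd|pk].
    by move: (coprime_dvdl pn' n'd); rewrite prime_coprime// pd.
  have : p \in primes (q`_(\pi(n')^'))%N by rewrite mem_primes p_pr pk part_gt0.
  by rewrite primes_part mem_filter !inE /= mem_primes p_pr n'0 pn'.
have : (p %| q`_(\pi(n')^'))%N.
  have : p \in primes (q`_(\pi(n')^'))%N.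
    rewrite primes_part mem_filter !inE /= !mem_primes p_pr q0 pq.
    by rewrite (negbTE pn') !andbF.
  by rewrite mem_primes => /and3P[].
by move=> pk; move: pn; rewrite dvdn_addl ?dvdn_mull// (negbTE pn').
Qed.

End Lift.

Section Characters.
Context {R : realType} (q : nat) (chi : nat -> R[i]).
Hypothesis q0 : (0 < q)%N.
Hypothesis chiD : dirichlet_character q chi.

Lemma dchar1 : chi 1 = 1. Proof. by case: chiD. Qed.
Lemma dcharM m n : chi (m * n)%N = chi m * chi n. Proof. by case: chiD. Qed.
Lemma dchar_neq0 n : (chi n != 0) = coprime n q. Proof. by case: chiD. Qed.

Lemma dchar_eq0 n : ~~ coprime n q -> chi n = 0.
Proof. by rewrite -dchar_neq0 negbK => /eqP. Qed.

Lemma dchar_addM n k : chi (n + k * q) = chi n.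
Proof.
case: chiD => _ _ chiq _; elim: k => [|k IH]; first by rewrite addn0.
by rewrite mulSn addnCA addnC chiq.
Qed.

Lemma dchar_mod n : chi (n %% q) = chi n.
Proof. by rewrite [in RHS](divn_eq n q) addnC dchar_addM. Qed.

Lemma dcharX n k : chi (n ^ k) = chi n ^+ k.
Proof.
elim: k => [|k IH]; first by rewrite expn0 dchar1 expr0.
by rewrite expnS dcharM IH exprS.
Qed.

Lemma dchar_inv n : coprime n q -> exists u, (n * u = 1 %[mod q])%N.
Proof.
move=> nq; exists (n ^ (totient q).-1)%N.
by rewrite -expnS prednK ?totient_gt0// cyclic.Euler_exp_totient.
Qed.

Lemma norm_dchar n : coprime n q -> `|chi n| = 1.
Proof.
move=> nq; have := congr1 (fun z => `|chi z|) (cyclic.Euler_exp_totient nq).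
rewrite !dchar_mod dcharX dchar1 normrX normr1 => /eqP.
by rewrite pexpr_eq1 ?totient_gt0// => /eqP.
Qed.

Lemma norm_dchar_le1 n : `|chi n| <= 1.
Proof.
have [/norm_dchar->//|/dchar_eq0->] := boolP (coprime n q).
by rewrite normr0.
Qed.

(** With u an inverse of m modulo q, n u is congruent to m u = 1 modulo d, because d divides q; so
    chi(m) and chi(n) are both inverse to chi(u). *)
Lemma dchar_eq_mod (d : nat) : (d %| q)%N ->
  (forall c, coprime c q -> c = 1 %[mod d] -> chi c = 1) ->
  forall m n, coprime m q -> coprime n q -> m = n %[mod d] -> chi m = chi n.
Proof.
move=> dq H m n mq nq mn; have [u mu] := dchar_inv mq.
have mu1 : chi m * chi u = 1 by rewrite -dcharM -dchar_mod mu dchar_mod dchar1.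
have u0 : chi u != 0.
  by apply/eqP => u0; move/eqP: mu1; rewrite u0 mulr0 eq_sym oner_eq0.
have nu1 : chi n * chi u = 1.
  rewrite -dcharM; apply: H.
    by rewrite coprimeMl nq -dchar_neq0.
  by rewrite -modnMml -mn modnMml -(modn_dvdm _ dq) mu modn_dvdm.
by apply: (mulIf u0); rewrite mu1 nu1.
Qed.

(** If chi were 1 on all units congruent to 1 modulo d, it would only depend on classes modulo d,
    and its composition with [coprime_lift] would be a character modulo d inducing it. The unit c is
    what makes Gauss sums vanish. *)
Lemma primitive_witness d : primitive_character q chi ->
  (d < q)%N -> (d %| q)%N ->
  exists c, [/\ coprime c q, c = 1 %[mod d] & chi c != 1].
Proof.
move=> [_ prim] dq ddq; apply: contrapT => nex; apply: prim.
have H c : coprime c q -> c = 1 %[mod d] -> chi c = 1.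
  move=> cq c1; apply/eqP; apply: contrapT => /negP chic1; apply: nex.
  by exists c.
have d0 := dvdn_gt0 q0 ddq.
have K := dchar_eq_mod ddq H; pose g := coprime_lift d q.
have gm n : g n = n %[mod d] by exact: coprime_lift_mod.
have gc n : coprime n d -> coprime (g n) q by exact: coprime_liftP.
exists d, (fun n => if coprime n d then chi (g n) else 0).
split=> //; last first.
  by move=> n nq; rewrite (coprime_dvdr ddq nq) (K _ (g n))// gc// (coprime_dvdr ddq nq).
split=> [|m n|n|n].
- by rewrite coprime1n (K _ 1%N) ?dchar1// ?gc// coprime1n.
- rewrite coprimeMl; have [md|] := boolP (coprime m d); last by rewrite mul0r.
  have [nd|] := boolP (coprime n d); last by rewrite mulr0.
  rewrite -dcharM; apply: K; rewrite ?gc ?coprimeMl ?md ?nd ?gc//.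
  by rewrite gm -[RHS]modnMml gm modnMml -[RHS]modnMmr gm modnMmr.
- by rewrite -coprime_modl modnDr coprime_modl /g /coprime_lift modnDr.
- have [nd|] := boolP (coprime n d); last by rewrite eqxx.
  by rewrite dchar_neq0 gc.
Qed.

End Characters.

(** * Elementary inequalities for the sine and the logarithm *)

Section Trig.
Context {R : realType}.
Implicit Types (s t x : R).

Definition cis t : R[i] := cos t +i* sin t.

Lemma cisD s t : cis (s + t) = cis s * cis t.
Proof. by rewrite /cis cosD sinD; simpc; congr (_ +i* _); rewrite addrC. Qed.

Lemma cis0 : cis 0 = 1. Proof. by rewrite /cis cos0 sin0. Qed.

Lemma cisX t n : cis t ^+ n = cis (n%:R * t).
Proof.
elim: n => [|n IH]; first by rewrite mul0r cis0.
by rewrite exprS IH -cisD -[n.+1%:R]nat1r mulrDl mul1r.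
Qed.

Lemma cis_neq0 t : cis t != 0.
Proof.
apply/eqP => t0; have := cisD t (- t); rewrite subrr cis0 t0 mul0r.
by move/eqP; rewrite oner_eq0.
Qed.

Lemma norm_cis t : `|cis t| = 1.
Proof. by rewrite normc_def/= cos2Dsin2 sqrtr1. Qed.

Lemma conj_cis t : conjc (cis t) = (cis t)^-1.
Proof.
apply: (mulfI (cis_neq0 t)); rewrite mulfV ?cis_neq0// -sqr_normc norm_cis.
by rewrite expr1n.
Qed.

Lemma conjcM (a b : R[i]) : conjc (a * b) = conjc a * conjc b.
Proof. exact: rmorphM. Qed.

Lemma norm_1subcis x : `|1 - cis (x *+ 2)| = (2 * `|sin x|)%:C.
Proof.
rewrite normc_def/=; congr (_%:C).
have -> : (1 - cos (x *+ 2)) ^+ 2 + (0 - sin (x *+ 2)) ^+ 2 = (2 * sin x) ^+ 2.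
  rewrite cos_mulr2n sin_mulr2n (mulr2n (cos x ^+ 2)) (mulr2n (cos x * sin x)).
  move: (cos x) (sin x) (cos2sin2 x) => c s h.
  have -> : (1 - (c ^+ 2 + c ^+ 2 - 1)) ^+ 2 + (0 - (c * s + c * s)) ^+ 2 =
    (2 - 2 * c ^+ 2) ^+ 2 + 4 * c ^+ 2 * s ^+ 2 by ring.
  rewrite h; ring.
by rewrite sqrtr_sqr normrM ger0_norm.
Qed.

(** With y = x/2 <= pi/4 and c = cos(pi/4), sin x = 2 sin y cos y >= 2 c^2 y = y, since cos y >= c
    and, by the mean value theorem, sin y >= c y. *)
Lemma sin_ge_half x : 0 <= x <= pi / 2 -> x / 2 <= sin x.
Proof.
move=> /andP[x0 xpi]; set y := x / 2.
have -> : x = y *+ 2 by rewrite /y; field.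
have y0 : 0 <= y by rewrite divr_ge0.
have ypi : y <= pi / 4 by rewrite /y; lra.
have pi0 := pi_gt0 R.
pose c : R := cos (pi / 4).
have c0 : 0 <= c by rewrite cos_ge0_pihalf//; lra.
have c2 : c ^+ 2 = 2^-1.
  have := cos_mulr2n (pi / 4 : R); have -> : pi / 4 *+ 2 = pi / 2 :> R by field.
  by rewrite cos_pihalf -/c => h; lra.
have cle z : 0 <= z <= pi / 4 -> c <= cos z.
  by move=> /andP[z0 z4]; rewrite /c leNgt ltr_cos ?in_itv/= -?leNgt//; lra.
have siny : y * c <= sin y.
  have [z + ] := @MVT_segment R sin cos 0 y y0
    (fun z _ => is_derive_sin z) (continuous_subspaceT (@continuous_sin R)).
  rewrite in_itv/= sin0 !subr0 mulrC => /andP[z0 zy] ->.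
  by rewrite ler_wpM2l// cle// z0 (le_trans zy).
rewrite sin_mulr2n.
have cy : c <= cos y by rewrite cle// y0.
suff : y <= 2 * (c * (y * c)).
  move=> /le_trans; apply.
  rewrite -(mulr_natl (cos y * sin y)); apply: ler_wpM2l => //.
  by apply: ler_pM => //; rewrite mulr_ge0.
have -> : 2 * (c * (y * c)) = 2 * c ^+ 2 * y by ring.
by rewrite c2; lra.
Qed.

(** The induction step is 1/(n+2) <= -ln(1 - 1/(n+2)). *)
Lemma harmonic_le n : \sum_(0 <= k < n.+1) (k.+1%:R)^-1 <= 1 + ln (n.+1%:R : R).
Proof.
elim: n => [|n IH].
  by rewrite big_nat1 ln1 invr1 addr0.
rewrite big_nat_recr//= (le_trans (lerD IH (lexx _)))// -addrA lerD2l.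
have n1 : (0 : R) < n.+1%:R by rewrite ltr0n.
have n2 : (0 : R) < n.+2%:R by rewrite ltr0n.
have -> : ln (n.+1%:R : R) = ln (n.+2%:R) + ln (1 + (- n.+2%:R^-1)).
  rewrite -lnM ?posrE//; last first.
    by rewrite subr_gt0 invf_lt1// ltr1n.
  congr ln; rewrite mulrBr mulr1 mulfV ?gt_eqF// -[n.+2%:R]nat1r; ring.
rewrite -addrA -lerBrDl subrr.
rewrite -lerBrDr sub0r.
by apply: le_ln1Dx; rewrite ltrN2 invf_lt1// ltr1n.
Qed.

End Trig.

(** In essence e <= 3: ln(7/8) <= -1/8, while (7/8)^8 >= (7/12)^2 >= 1/3. For q >= 3 it allows 1 +
    ln q to be absorbed into 2 ln q. *)
Lemma ln_ge1 (R : realType) (x : R) : 3 <= x -> 1 <= ln x.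
Proof.
move=> x3; have x0 : 0 < x by rewrite (lt_le_trans _ x3).
have l78 : ln (7 / 8 : R) <= - 8^-1.
  have -> : 7 / 8 = 1 + - 8^-1 :> R by field.
  by apply: le_ln1Dx; lra.
have : ln (x^-1) <= ln ((7 / 8) ^+ 8).
  rewrite ler_ln ?posrE ?invr_gt0 ?exprn_gt0 ?divr_gt0//.
  apply: (@le_trans _ _ 3^-1); first by rewrite lef_pV2 ?posrE.
  have p4 : (7 / 12 : R) <= (7 / 8) ^+ 4 by rewrite !exprS expr0; lra.
  by rewrite (exprD _ 4 4); apply: (le_trans _ (ler_pM _ _ p4 p4)); lra.
by rewrite lnV ?posrE// lnXn ?divr_gt0//; lra.
Qed.

(** * Gauss sums and the Polya-Vinogradov inequality *)

Section Gauss.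
Context {R : realType} (q : nat) (chi : nat -> R[i]).
Hypothesis q1 : (1 < q)%N.
Hypothesis prim : primitive_character q chi.

Let q0 : (0 < q)%N. Proof. exact: ltnW. Qed.
Let chiD : dirichlet_character q chi. Proof. by case: prim. Qed.

Lemma sum_mod_reindex (V : nmodType) (f : nat -> V) c : coprime c q ->
  (forall n, f (n %% q)%N = f n) ->
  \sum_(a < q) f (a * c)%N = \sum_(a < q) f a.
Proof.
move=> cq fq; pose h (a : 'I_q) : 'I_q := Ordinal (ltn_pmod (a * c) q0).
have h_inj : injective h.
  move=> a b /(congr1 val)/= abc; have [u cu] := dchar_inv q0 cq.
  apply/val_inj; rewrite /= -(modn_small (ltn_ord a)) -(modn_small (ltn_ord b)).
  have {abc} := congr1 (fun m => (m * u) %% q)%N abc.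
  rewrite !modnMml -!mulnA -[in LHS]modnMmr cu -[in RHS]modnMmr cu !modnMmr.
  by rewrite !muln1.
by rewrite [RHS](reindex_inj h_inj); apply: eq_bigr => a _; rewrite fq.
Qed.

Let z : R[i] := cis (2 * pi / q%:R).

Lemma zetaq : z ^+ q = 1.
Proof.
rewrite /z cisX mulrC divfK ?pnatr_eq0 -?lt0n//.
by rewrite /cis mulr_natl cos2pi sin2pi.
Qed.

Lemma zeta_mod n : z ^+ (n %% q) = z ^+ n.
Proof. by rewrite [in RHS](divn_eq n q) exprD mulnC exprM zetaq expr1n mul1r. Qed.

(** The modulus is 2 |sin(pi a/q)|, at least a/q in the first half of the range and, by reflection,
    at least (q - a)/q in the second. Adding the two reciprocals removes the case split and later
    leaves two harmonic sums. *)
Lemma norm_1sub_zetaX a : (0 < a < q)%N ->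
  (1 : R[i]) <= (q%:R * (a%:R^-1 + (q - a)%:R^-1))%:C * `|1 - z ^+ a|.
Proof.
move=> /andP[a0 aq]; have pi0 := pi_gt0 R; have pi2 := pi_ge2 R.
have qR : (0 : R) < q%:R by rewrite ltr0n.
have aR : (0 : R) < a%:R by rewrite ltr0n.
have qaR : (0 : R) < (q - a)%:R by rewrite ltr0n subn_gt0.
pose x : R := pi * a%:R / q%:R.
have x0 : 0 <= x by rewrite divr_ge0// mulr_ge0// ltW.
have xpi : pi - x = pi * (q - a)%:R / q%:R.
  by rewrite natrB 1?ltnW// /x; field; rewrite gt_eqF.
rewrite /z cisX.
have -> : a%:R * (2 * pi / q%:R) = x *+ 2 by rewrite mulr2n /x; field; rewrite gt_eqF.
rewrite norm_1subcis -real_complexM lecR.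
have sin_norm y : y <= sin x -> y <= `|sin x| by move/le_trans; apply; exact: ler_norm.
have key m : 0 < m :> R -> m / q%:R <= 2 * `|sin x| -> 1 <= q%:R * m^-1 * (2 * `|sin x|).
  move=> m0 h; rewrite -[leLHS](_ : q%:R * m^-1 * (m / q%:R) = 1); last first.
    by field; rewrite !gt_eqF.
  by apply: ler_wpM2l => //; rewrite divr_ge0// ltW.
have posr m : 0 < m :> R -> 0 <= q%:R * m^-1 * (2 * `|sin x|).
  by move=> m0; rewrite !mulr_ge0// invr_ge0 ltW.
rewrite mulrDr mulrDl.
have [xle|xgt] := leP x (pi / 2).
  rewrite -[leLHS]addr0 lerD ?posr// key//.
  have : x / 2 <= `|sin x| by rewrite sin_norm// sin_ge_half// x0.
  suff : a%:R / q%:R <= x by lra.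
  by rewrite /x -mulrA ler_peMl// ?divr_ge0 ?ltW//; lra.
rewrite -[leLHS]add0r lerD ?posr// key//.
have : (pi - x) / 2 <= `|sin x|.
  have -> : sin x = sin (pi - x) by rewrite sinB sinpi cospi; ring.
  rewrite (le_trans _ (ler_norm _))// sin_ge_half//.
  by rewrite xpi divr_ge0 ?mulr_ge0// 1?ltW// -xpi; lra.
suff : (q - a)%:R / q%:R <= pi - x by lra.
by rewrite xpi -mulrA ler_peMl// ?divr_ge0 ?ltW//; lra.
Qed.

Lemma zetaX_neq1 a : (0 < a < q)%N -> z ^+ a != 1.
Proof.
move=> aq; apply/eqP => za; have := norm_1sub_zetaX aq.
by rewrite za subrr normr0 mulr0 ler10.
Qed.

(** Gauss sum of the conjugate character, so that [T n] is proportional to chi(n) itself. *)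
Let T n := \sum_(a < q) conjc (chi a) * z ^+ (a * n).

Lemma gauss_shift c n : coprime c q ->
  T n = conjc (chi c) * T (c * n).
Proof.
move=> cq; rewrite /T -(sum_mod_reindex (f := fun a => conjc (chi a) * z ^+ (a * n)) cq).
  by rewrite mulr_sumr; apply: eq_bigr => a _; rewrite (dcharM chiD) conjcM mulrCA !mulrA mulnA.
by move=> m; rewrite (dchar_mod chiD) -zeta_mod modnMml zeta_mod.
Qed.

Lemma T_mod n : T (n %% q) = T n.
Proof. by apply: eq_bigr => a _; rewrite -zeta_mod modnMmr zeta_mod. Qed.

(** For n prime to q this is the substitution a -> a n. Otherwise let g = gcd(n, q) > 1; primitivity
    gives a unit c congruent to 1 modulo q/g with chi(c) != 1. Then c n = n modulo q, so T(n) =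
    conj(chi(c)) T(n), which forces T(n) = 0. *)
Lemma gauss_separable n : T n = chi n * T 1.
Proof.
have [nq|nq] := boolP (coprime n q).
  by rewrite (gauss_shift 1 nq) muln1 mulrA -sqr_normc (norm_dchar q0 chiD nq) expr1n mul1r.
rewrite (dchar_eq0 chiD nq) mul0r.
set g := gcdn n q.
have g0 : (0 < g)%N by rewrite gcdn_gt0 q0 orbT.
have [c [cq c1 chic]] : exists c, [/\ coprime c q, c = 1 %[mod q %/ g] & chi c != 1].
  apply: primitive_witness => //.
    rewrite ltn_Pdiv// ltn_neqAle eq_sym g0 andbT.
    by move: nq; rewrite /coprime.
  by apply/dvdnP; exists g; rewrite mulnC divnK// dvdn_gcdr.
have cn : (c * n = n %[mod q])%N.
  have -> : q = (q %/ g * g)%N by rewrite divnK// dvdn_gcdr.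
  have -> : n = (n %/ g * g)%N by rewrite divnK// dvdn_gcdl.
  by rewrite mulnA -!muln_modl -[in LHS]modnMml c1 modnMml mul1n.
have := gauss_shift n cq; rewrite -[T (c * n)]T_mod cn T_mod => Tn.
have : (1 - conjc (chi c)) * T n = 0 by rewrite mulrBl mul1r -Tn subrr.
move/eqP; rewrite mulf_eq0 subr_eq0 => /orP[/eqP h|/eqP//].
move: chic; have := congr1 conjc h; rewrite [RHS]conjcK => <-.
by rewrite conjc1 eqxx.
Qed.

(** Conjugate of separability at n = 0, where chi(0) = 0 because q > 1. *)
Lemma chi_sum0 : \sum_(a < q) chi a = 0.
Proof.
have := gauss_separable 0; rewrite (dchar_eq0 chiD) ?mul0r; last first.
  by rewrite /coprime gcd0n gtn_eqF.
rewrite /T; under eq_bigr do rewrite muln0 expr0 mulr1.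
by move=> /(congr1 conjc); rewrite rmorph0 rmorph_sum; under eq_bigr do rewrite /= conjcK.
Qed.

Lemma geom_zeta a : (0 < a < q)%N -> \sum_(n < q) (z ^+ a) ^+ n = 0.
Proof.
move=> aq; have := subrXX 1 (z ^+ a) q.
rewrite expr1n -exprM mulnC exprM zetaq expr1n subrr => /esym/eqP.
rewrite mulf_eq0 subr_eq0 eq_sym (negbTE (zetaX_neq1 aq))/= => /eqP h.
rewrite -[RHS]h; apply: eq_bigr => n _.
by rewrite expr1n mul1r.
Qed.

Lemma orth_zeta (a b : 'I_q) :
  \sum_(n < q) z ^+ (a * n) * conjc (z ^+ (b * n)) = if a == b then q%:R else 0.
Proof.
have conjz m : conjc (z ^+ m) = (z ^+ m)^-1 by rewrite /z cisX conj_cis.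
have z0 m : z ^+ m != 0 by rewrite /z cisX cis_neq0.
have [->|ab] := eqVneq a b.
  under eq_bigr do rewrite conjz mulfV//.
  by rewrite sumr_const card_ord.
wlog ltab : a b ab / (b < a)%N.
  move=> H; move: (ab); rewrite -val_eqE neq_ltn => /orP[ltab|]; last exact: H.
  have := congr1 conjc (H b a _ ltab); rewrite eq_sym conjc0 => /(_ ab).
  rewrite rmorph_sum => h; rewrite -[RHS]h; apply: eq_bigr => n _.
  by rewrite /= conjcM conjcK mulrC.
rewrite -[RHS](geom_zeta (a := (a - b)%N)); last first.
  by rewrite subn_gt0 ltab/= (leq_ltn_trans (leq_subr _ _)).
apply: eq_bigr => n _; rewrite conjz -exprM -[in LHS](subnK (ltnW ltab)).
by rewrite mulnDl exprD mulfK.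
Qed.

Let phi : R[i] := \sum_(a < q) `|chi a| ^+ 2.

(** Parseval: the sum of |T(n)|^2 over n is phi |T(1)|^2 by separability and phi q by orthogonality;
    phi is nonzero because of its term a = 1. *)
Lemma norm_gauss : `|T 1| ^+ 2 = q%:R.
Proof.
have phi0 : phi != 0.
  have -> : phi = 1 + \sum_(a < q | a != Ordinal q1) `|chi a| ^+ 2.
    by rewrite /phi (bigD1 (Ordinal q1))//= (dchar1 chiD) normr1 expr1n.
  rewrite gt_eqF// ltr_pwDl//; apply: sumr_ge0 => a _.
  exact: exprn_ge0.
apply: (mulfI phi0).
have -> : phi * `|T 1| ^+ 2 = \sum_(n < q) T n * conjc (T n).
  rewrite /phi mulr_suml; apply: eq_bigr => n _.
  by rewrite [in RHS]gauss_separable -sqr_normc normrM exprMn.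
have -> : phi * q%:R =
    \sum_(a < q) \sum_(b < q) conjc (chi a) * chi b * (if a == b then q%:R else 0).
  rewrite /phi mulr_suml; apply: eq_bigr => a _.
  rewrite (bigD1 a)//= eqxx big1 ?addr0; last first.
    by move=> b ba; rewrite eq_sym (negbTE ba) mulr0.
  by rewrite sqr_normc [chi a * _]mulrC.
under [RHS]eq_bigr do under eq_bigr do rewrite -orth_zeta mulr_sumr.
under [RHS]eq_bigr do rewrite exchange_big/=.
rewrite [RHS]exchange_big/=; apply: eq_bigr => n _.
rewrite /T rmorph_sum mulr_suml; apply: eq_bigr => a _.
rewrite mulr_sumr; apply: eq_bigr => b _.
by rewrite /= conjcM conjcK; ring.
Qed.

Lemma norm_geom_zeta_le a N : (0 < a < q)%N ->
  `|\sum_(1 <= n < N.+1) z ^+ (a * n)| <=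
  (2 * (q%:R * (a%:R^-1 + (q - a)%:R^-1)))%:C.
Proof.
move=> aq; set K := q%:R * _; set S := \sum_(1 <= n < N.+1) _.
have telescope : (1 - z ^+ a) * S = z ^+ a - z ^+ (a * N.+1).
  rewrite /S; elim: N {S} => [|N IH]; first by rewrite big_geq// mulr0 muln1 subrr.
  by rewrite big_nat_recr//= mulrDr IH !mulnS !exprD; ring.
have le2 : `|1 - z ^+ a| * `|S| <= 2.
  rewrite -normrM telescope (le_trans (ler_normB _ _))//.
  by rewrite /z !cisX !norm_cis.
have := ler_wpM2r (normr_ge0 S) (norm_1sub_zetaX aq).
rewrite mul1r -/K -mulrA => /le_trans; apply.
have K0 : 0 <= K by rewrite mulr_ge0// addr_ge0// invr_ge0.
have -> : (2 * K)%:C = K%:C * 2 by rewrite mulrC real_complexM real_complex_nat.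
by apply: ler_wpM2l; rewrite ?ler0c.
Qed.

(** Separability turns S T(1) into a combination of geometric sums, bounded in all by 4 q times the
    harmonic sum up to q - 1, hence by 8 q ln q; division by |T(1)| = sqrt q gives the constant
    8. *)
Lemma polya_vinogradov N : (3 <= q)%N ->
  `|\sum_(1 <= n < N.+1) chi n| <= (8 * (Num.sqrt q%:R * ln q%:R))%:C.
Proof.
move=> q3; set S := \sum_(1 <= n < N.+1) _.
have sqrt_gt0 : 0 < Num.sqrt q%:R :> R by rewrite sqrtr_gt0 ltr0n.
have normT : `|T 1| = (Num.sqrt q%:R)%:C.
  apply/eqP; rewrite -(@eqrXn2 _ 2)// ?ler0c ?ltW//.
  by rewrite norm_gauss -real_complexX sqr_sqrtr// real_complex_nat.
have ST : S * T 1 = \sum_(a < q) conjc (chi a) * \sum_(1 <= n < N.+1) z ^+ (a * n).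
  rewrite mulr_suml; under eq_bigr do rewrite -gauss_separable.
  by rewrite exchange_big/=; apply: eq_bigr => a _; rewrite mulr_sumr.
have bound : `|S| * (Num.sqrt q%:R)%:C <=
   (\sum_(1 <= a < q) 2 * (q%:R * (a%:R^-1 + (q - a)%:R^-1)))%:C.
  rewrite -normT -normrM ST -(big_mkord xpredT
    (fun a => conjc (chi a) * \sum_(1 <= n < N.+1) z ^+ (a * n))) big_ltn//.
  rewrite (dchar_eq0 chiD (n := 0)) ?conjc0 ?mul0r ?add0r; last first.
    by rewrite /coprime gcd0n gtn_eqF.
  rewrite (le_trans (ler_norm_sum _ _ _))// real_complex_sum.
  apply: ler_sum_nat => a aq; rewrite normrM normcJ.
  by rewrite -[leRHS]mul1r ler_pM// ?(norm_dchar_le1 q0 chiD)// norm_geom_zeta_le.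
have sumE : \sum_(1 <= a < q) 2 * (q%:R * (a%:R^-1 + (q - a)%:R^-1)) =
    4 * q%:R * \sum_(0 <= a < q.-1) (a.+1)%:R^-1 :> R.
  rewrite -mulr_sumr -mulr_sumr big_split/=.
  have -> : \sum_(1 <= a < q) (q - a)%:R^-1 = \sum_(1 <= a < q) a%:R^-1 :> R.
    rewrite big_nat_rev/= add1n; apply: eq_big_nat => a /andP[_ aq].
    by congr (_%:R^-1); lia.
  rewrite big_add1; ring.
rewrite sumE in bound.
have lnq : 1 <= ln (q%:R : R) by apply: ln_ge1; rewrite ler_nat.
have harm : \sum_(0 <= a < q.-1) (a.+1)%:R^-1 <= 2 * ln (q%:R : R).
  rewrite [X in \sum_(0 <= a < X) _](_ : _ = q.-1.-1.+1); last by lia.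
  rewrite (le_trans (harmonic_le _))//.
  have : ln (q.-1.-1.+1%:R) <= ln (q%:R : R).
    by rewrite ler_ln ?posrE ?ltr0n// ler_nat; lia.
  lra.
rewrite -(ler_pM2r (_ : 0 < (Num.sqrt q%:R)%:C)) ?ltcR//.
rewrite (le_trans bound)// -real_complexM lecR.
have -> : 8 * (Num.sqrt q%:R * ln q%:R) * Num.sqrt q%:R =
    4 * q%:R * (2 * ln (q%:R : R)).
  transitivity (8 * ln q%:R * (Num.sqrt q%:R * Num.sqrt q%:R) : R); first ring.
  by rewrite -expr2 sqr_sqrtr//; ring.
by apply: ler_wpM2l harm; rewrite mulr_ge0.
Qed.

End Gauss.

(** * Integrals of sawtooth and step functions *)

Section PointwiseDerivatives.
Context {R : realType}.
Implicit Types (f g : R -> R) (x a b c : R).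

Lemma isd_cst c x : is_derive x (1 : R) (fun=> c) 0.
Proof. exact: is_derive_cst. Qed.

Lemma isd_id x : is_derive x (1 : R) (fun u => u) 1.
Proof. exact: is_derive_id. Qed.

Lemma isd_ext f a b x : is_derive x (1 : R) f a -> a = b -> is_derive x (1 : R) f b.
Proof. by move=> df <-. Qed.

Lemma isdD f g a b x : is_derive x (1 : R) f a -> is_derive x (1 : R) g b ->
  is_derive x (1 : R) (fun u => f u + g u) (a + b).
Proof. exact: is_deriveD. Qed.

Lemma isdB f g a b x : is_derive x (1 : R) f a -> is_derive x (1 : R) g b ->
  is_derive x (1 : R) (fun u => f u - g u) (a - b).
Proof. exact: is_deriveB. Qed.

Lemma isdM f g a b x : is_derive x (1 : R) f a -> is_derive x (1 : R) g b ->
  is_derive x (1 : R) (fun u => f u * g u) (f x * b + g x * a).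
Proof. exact: is_deriveM. Qed.

Lemma isdZ f a c x : is_derive x (1 : R) f a ->
  is_derive x (1 : R) (fun u => c * f u) (c * a).
Proof. exact: is_deriveZ. Qed.

Lemma isdX f a x n : is_derive x (1 : R) f a ->
  is_derive x (1 : R) (fun u => f u ^+ n) (n%:R * f x ^+ n.-1 * a).
Proof.
move=> df; have := is_deriveX n df.
have -> // : (f ^+ n) = (fun u => f u ^+ n).
by apply/funext => u; elim: n => [|n IH]; rewrite ?expr0// !exprS -IH.
Qed.

Lemma isd_comp f g a b x : is_derive x (1 : R) g b -> is_derive (g x) (1 : R) f a ->
  is_derive x (1 : R) (fun u => f (g u)) (a * b).
Proof. by move=> dg df; exact: (@is_derive1_comp _ f g x a b df dg). Qed.

Lemma isd_ln f a x : 0 < f x -> is_derive x (1 : R) f a ->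
  is_derive x (1 : R) (fun u => ln (f u)) ((f x)^-1 * a).
Proof. by move=> fx df; apply: isd_comp df _; exact: is_derive1_ln. Qed.

Lemma isd_expR f a x : is_derive x (1 : R) f a ->
  is_derive x (1 : R) (fun u => expR (f u)) (expR (f x) * a).
Proof. by move=> df; apply: isd_comp df _; exact: is_derive_expR. Qed.

Lemma isdV f a x : f x != 0 -> is_derive x (1 : R) f a ->
  is_derive x (1 : R) (fun u => (f u)^-1) (- (f x) ^- 2 * a).
Proof.
by move=> fx df; exact: is_deriveV.
Qed.

End PointwiseDerivatives.

(** * Integrals of bounded measurable functions *)

Section Integrals.
Context {R : realType}.
Implicit Types (f g h F : R -> R) (x y z c M : R).
Local Notation mu := (@lebesgue_measure R).

(** The integrands are products of a discontinuous sawtooth with a smooth function. Unlike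
    integrability, this condition is stable under products, and it implies integrability on a
    segment. *)
Definition bmeas f x y := measurable_fun `[x, y] f /\
  exists M, forall u, x <= u <= y -> `|f u| <= M.

Lemma bmeasW f x y x' y' : x <= x' -> y' <= y -> bmeas f x y -> bmeas f x' y'.
Proof.
move=> xx yy [mf [M fM]]; split.
  apply: measurable_funS mf => //; apply: subset_itv; rewrite ?bnd_simp//.
exists M => u /andP[xu uy]; apply: fM.
by rewrite (le_trans xx xu) (le_trans uy yy).
Qed.

Lemma bmeasM f g x y : bmeas f x y -> bmeas g x y -> bmeas (fun u => f u * g u) x y.
Proof.
move=> [mf [M fM]] [mg [N gN]]; split; first exact: measurable_funM.
exists (M * N) => u xuy; rewrite normrM ler_pM// ?fM ?gN//.
Qed.

Lemma bmeasD f g x y : bmeas f x y -> bmeas g x y -> bmeas (fun u => f u + g u) x y.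
Proof.
move=> [mf [M fM]] [mg [N gN]]; split; first exact: measurable_funD.
exists (M + N) => u xuy; rewrite (le_trans (ler_normD _ _))// lerD// ?fM ?gN//.
Qed.

Lemma bmeas_cst c x y : bmeas (fun=> c) x y.
Proof. by split; [exact: measurable_cst|exists `|c|]. Qed.

Lemma bmeas_sum (I : Type) (r : seq I) (P : pred I) (f : I -> R -> R) x y :
  (forall i, P i -> bmeas (f i) x y) -> bmeas (fun u => \sum_(i <- r | P i) f i u) x y.
Proof.
move=> bf; elim: r => [|i r IH].
  by under eq_fun do rewrite big_nil; exact: bmeas_cst.
under eq_fun do rewrite big_cons.
case: (boolP (P i)) => [Pi|_//].
exact: bmeasD (bf _ Pi) IH.
Qed.

Lemma bmeas_continuous f x y : {within `[x, y], continuous f} -> bmeas f x y.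
Proof.
move=> cf; split; first exact: subspace_continuous_measurable_fun.
have [M [Mreal fM]] := compact_bounded (continuous_compact cf (@segment_compact _ _ _)).
exists (`|M| + 1) => u uxy; apply: fM; last by exists u.
by rewrite ltr_pwDr// ler_norm.
Qed.

Lemma bmeas_integrable f x y : bmeas f x y -> mu.-integrable `[x, y] (EFin \o f).
Proof.
move=> [mf [M fM]]; apply: measurable_bounded_integrable => //.
  by apply: compact_finite_measure; exact: segment_compact.
exists M; split; first exact: num_real.
by move=> M' MM' u /=; rewrite in_itv/= => /fM/le_trans; apply; exact: ltW.
Qed.

Lemma int_norm_le f x y M : x <= y -> bmeas f x y ->
  (forall u, x <= u <= y -> `|f u| <= M) -> `|int_upto f x y| <= M * (y - x).
Proof.
move=> xy bf fM; rewrite /int_upto.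
rewrite (le_trans (le_normr_Rintegral _ (bmeas_integrable bf)))//.
apply: (@le_trans _ _ (\int[mu]_(u in `[x, y]) M)); last first.
  rewrite Rintegral_cst//.
  rewrite [X in _ * X](_ : _ = y - x)//.
  apply: etrans (congr1 fine (lebesgue_measure_itv `[x, y]%R)) _.
  rewrite /= lte_fin; case: ltP => //= yx.
  by apply/esym/eqP; rewrite subr_eq0; apply/eqP/le_anti; rewrite xy yx.
apply: le_Rintegral; first by [].
- exact: (integrable_norm (bmeas_integrable bf)).
- exact: bmeas_integrable (bmeas_cst _ _ _).
- by move=> u /=; rewrite in_itv/=; exact: fM.
Qed.

Lemma int_split f x y z : x <= y -> y <= z -> bmeas f x z ->
  int_upto f x z = int_upto f x y + int_upto f y z.
Proof.
move=> xy yz bf; rewrite /int_upto.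
have bf' := bmeas_integrable (bmeasW xy (lexx _) bf).
have := Rintegral_itvB (x := y) (bmeas_integrable bf).
rewrite !bnd_simp => /(_ xy yz) /eqP; rewrite subr_eq addrC => /eqP ->.
congr (_ + _); rewrite Rintegral_itv_obnd_cbnd//.
apply: integrableS bf' => //. 
by apply: subset_itv; rewrite ?bnd_simp.
Qed.

Lemma int_FTC f F x y : x <= y ->
  (forall u, x <= u <= y -> is_derive u 1 F (f u)) ->
  (forall u, x <= u <= y -> {for u, continuous f}) ->
  int_upto f x y = F y - F x.
Proof.
rewrite le_eqVlt => /predU1P[<- _ _|xy dF cf].
  by rewrite /int_upto subrr set_itv1 Rintegral_set1.
have inW u : u \in `]x, y[%R -> x <= u <= y.
  by rewrite in_itv/= => /andP[xu uy]; rewrite !ltW.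
rewrite /int_upto /Rintegral (@continuous_FTC2 _ f F)//.
- by apply: continuous_in_subspaceT => u; rewrite inE/= in_itv/=; exact: cf.
- split.
  + by move=> u /inW/dF [].
  + apply: cvg_at_right_filter.
    apply: differentiable_continuous. apply/derivable1_diffP.
    by have [] := dF x; rewrite ?lexx ?ltW.
  + apply: cvg_at_left_filter.
    apply: differentiable_continuous. apply/derivable1_diffP.
    by have [] := dF y; rewrite ?lexx ?ltW.
- by move=> u /inW/dF [_ <-]; rewrite derive1E.
Qed.

(** The right endpoint is left out because the sawtooth jumps there. *)
Lemma int_eq_oo f g x y : bmeas f x y -> bmeas g x y ->
  (forall u, x <= u < y -> f u = g u) -> int_upto f x y = int_upto g x y.
Proof.
move=> bf bg fg; rewrite /int_upto.
rewrite -!Rintegral_itv_bndo_bndc; last 2 first.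
  apply: integrableS (bmeas_integrable bg) => //; apply: subset_itv; by rewrite ?bnd_simp.
  apply: integrableS (bmeas_integrable bf) => //; apply: subset_itv; by rewrite ?bnd_simp.
by apply: eq_Rintegral => u; rewrite inE/= in_itv/=; exact: fg.
Qed.

Lemma intD f g x y : bmeas f x y -> bmeas g x y ->
  int_upto (fun u => f u + g u) x y = int_upto f x y + int_upto g x y.
Proof. by move=> bf bg; rewrite /int_upto RintegralD//; exact: bmeas_integrable. Qed.

Lemma intZ c f x y : bmeas f x y ->
  int_upto (fun u => c * f u) x y = c * int_upto f x y.
Proof. by move=> bf; rewrite /int_upto RintegralZl//; exact: bmeas_integrable. Qed.

Lemma int_sum (I : Type) (r : seq I) (P : pred I) (f : I -> R -> R) x y :
  (forall i, P i -> bmeas (f i) x y) ->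
  int_upto (fun u => \sum_(i <- r | P i) f i u) x y =
  \sum_(i <- r | P i) int_upto (f i) x y.
Proof.
move=> bf; elim: r => [|i r IH].
  rewrite big_nil; under eq_fun do rewrite big_nil.
  by rewrite /int_upto Rintegral_cst// mul0r.
rewrite big_cons; under eq_fun do rewrite big_cons.
case: (boolP (P i)) => [Pi|_//].
by rewrite intD ?IH//; [exact: bf|exact: bmeas_sum].
Qed.

End Integrals.

(** * A second mean value inequality *)

Section SecondMeanValue.
Context {R : realType}.
Implicit Types (D h : R -> R) (x y B M : R).

(* Abel summation over a uniform partition: the step n -> n+1 costs
   (B + M d) (h x_n - h x_(n+1)), which telescopes. *)
Lemma second_mean_partition D h x y B M d n : 0 <= d ->
  x + n%:R * d <= y -> bmeas D x y -> bmeas h x y ->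
  (forall u, x <= u <= y -> `|D u| <= M) ->
  (forall v, x <= v <= y -> `|int_upto D x v| <= B) ->
  (forall u v, x <= u -> u <= v -> v <= y -> h v <= h u) ->
  `|int_upto (fun u => D u * h u) x (x + n%:R * d)
    - h (x + n%:R * d) * int_upto D x (x + n%:R * d)|
  <= (B + M * d) * (h x - h (x + n%:R * d)).
Proof.
move=> d0 + bD bh DM DB hni; elim: n => [|n IH] xny.
  by rewrite !mul0r !addr0 /int_upto set_itv1 !Rintegral_set1 mulr0 !subrr mulr0 normr0.
set xn := x + n%:R * d in IH; set xn1 := x + n.+1%:R * d in xny *.
have xn1E : xn1 = xn + d by rewrite /xn1 /xn -natr1; ring.
have x_xn : x <= xn by rewrite lerDl mulr_ge0.
have xn_xn1 : xn <= xn1 by rewrite xn1E lerDl.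
have xn_y := le_trans xn_xn1 xny.
have {}IH := IH xn_y.
have bDh := bmeasM bD bh.
have x_xn1 := le_trans x_xn xn_xn1.
rewrite (int_split x_xn xn_xn1 (bmeasW (lexx _) xny bDh)).
rewrite (int_split x_xn xn_xn1 (bmeasW (lexx _) xny bD)).
have bD' := bmeasW x_xn xny bD; have bDh' := bmeasW x_xn xny bDh.
have M0 : 0 <= M by apply: le_trans (normr_ge0 (D x)) (DM _ _); rewrite lexx (le_trans x_xn).
have piece : `|int_upto (fun u => D u * h u) xn xn1 - h xn1 * int_upto D xn xn1|
    <= M * d * (h xn - h xn1).
  rewrite -intZ// -[X in `|X|]opprB opprB -mulN1r -intZ; last first.
    exact: bmeasM (bmeas_cst _ _ _) bD'.
  rewrite -intD//; last first.
    by apply: bmeasM (bmeas_cst _ _ _) _; apply: bmeasM (bmeas_cst _ _ _) bD'.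
  rewrite mulrAC -[d in leRHS](_ : xn1 - xn = d); last by rewrite xn1E; ring.
  apply: int_norm_le => //.
    apply: bmeasD => //; apply: bmeasM (bmeas_cst _ _ _) _.
    exact: bmeasM (bmeas_cst _ _ _) bD'.
  move=> u /andP[xnu uxn1].
  have -> : D u * h u + -1 * (h xn1 * D u) = D u * (h u - h xn1) by ring.
  rewrite normrM ler_pM//.
    by rewrite DM// (le_trans x_xn xnu) (le_trans uxn1 xny).
  rewrite ger0_norm ?subr_ge0; first by rewrite lerD2r hni// (le_trans uxn1).
  by rewrite hni// (le_trans x_xn).
have -> : int_upto (fun u => D u * h u) x xn + int_upto (fun u => D u * h u) xn xn1
    - h xn1 * (int_upto D x xn + int_upto D xn xn1) =
    (int_upto (fun u => D u * h u) x xn - h xn * int_upto D x xn)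
    + (int_upto D x xn * (h xn - h xn1)
      + (int_upto (fun u => D u * h u) xn xn1 - h xn1 * int_upto D xn xn1)) by ring.
have -> : (B + M * d) * (h x - h xn1) = (B + M * d) * (h x - h xn) +
   (B * (h xn - h xn1) + M * d * (h xn - h xn1)) by ring.
rewrite (le_trans (ler_normD _ _))// lerD// (le_trans (ler_normD _ _))// lerD//.
have hxn : 0 <= h xn - h xn1 by rewrite subr_ge0 hni.
by rewrite normrM (ger0_norm hxn) ler_wpM2r// DB// x_xn.
Qed.

(** A partition into n + 1 steps gives B h(x) with an error M (y - x) h(x)/(n + 1), and n is
    arbitrary. Neither continuity nor a derivative of h enters. *)
Lemma second_mean_value D h x y B M : x <= y -> bmeas D x y -> bmeas h x y ->
  (forall u, x <= u <= y -> `|D u| <= M) ->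
  (forall v, x <= v <= y -> `|int_upto D x v| <= B) ->
  (forall u v, x <= u -> u <= v -> v <= y -> h v <= h u) ->
  0 <= h y ->
  `|int_upto (fun u => D u * h u) x y| <= B * h x.
Proof.
move=> xy bD bh DM DB hni hy.
have hx : 0 <= h x by apply: le_trans hy (hni _ _ _ _ _).
have B0 : 0 <= B by apply: le_trans (normr_ge0 _) (DB x _); rewrite lexx.
have M0 : 0 <= M by apply: le_trans (normr_ge0 (D x)) (DM _ _); rewrite lexx.
have approx n : `|int_upto (fun u => D u * h u) x y| <=
    B * h x + M * (y - x) * h x * n.+1%:R^-1.
  pose d := (y - x) / n.+1%:R.
  have d0 : 0 <= d by rewrite divr_ge0// subr_ge0.
  have yE : x + n.+1%:R * d = y by rewrite /d mulrC divfK ?pnatr_eq0//; ring.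
  have := @second_mean_partition D h x y B M d n.+1 d0.
  rewrite yE => /(_ (lexx _) bD bh DM DB hni) h1.
  rewrite -[X in `|X|](subrK (h y * int_upto D x y)).
  rewrite (le_trans (ler_normD _ _))// (le_trans (lerD h1 (lexx _)))//.
  rewrite normrM (ger0_norm hy).
  have h2 : h y * `|int_upto D x y| <= h y * B by rewrite ler_wpM2l// DB// xy lexx.
  have h3 : 0 <= M * d * h y by apply: mulr_ge0 hy; exact: mulr_ge0.
  have -> : M * (y - x) * h x / n.+1%:R = M * d * h x by rewrite /d; ring.
  move: h2 h3; lra.
apply/ler_addgt0Pr => e e0.
set K := M * (y - x) * h x in approx.
have := approx (Num.truncn (K / e)) => /le_trans; apply; rewrite lerD2l.
by rewrite ler_pdivrMr ?ltr0n// mulrC -ler_pdivrMr// ltW// truncnS_gt.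
Qed.

End SecondMeanValue.

(** * Dirichlet's test for improper integrals *)

Section Improper.
Context {R : realType}.
Implicit Types (D h f g : R -> R) (x y c B M : R).

Lemma int_upto_tail f c x y : c <= x -> x <= y -> (forall z, bmeas f c z) ->
  int_upto f c y - int_upto f c x = int_upto f x y.
Proof. by move=> cx xy bf; rewrite (int_split cx xy)// addrAC subrr add0r. Qed.

Lemma improper_dirichlet D h c c0 B M : c <= c0 ->
  (forall y, bmeas D c y) -> (forall y, bmeas h c y) ->
  (forall u, c <= u -> `|D u| <= M) ->
  (forall x v, c <= x -> x <= v -> `|int_upto D x v| <= B) ->
  (forall u v, c0 <= u -> u <= v -> h v <= h u) ->
  (forall u, c0 <= u -> 0 <= h u) ->
  (forall e, 0 < e -> exists2 y, c0 <= y & h y <= e) ->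
  improper_cvg (fun u => D u * h u) c /\
  `|improper_int (fun u => D u * h u) c - int_upto (fun u => D u * h u) c c0|
    <= B * h c0.
Proof.
move=> cc0 bD bh DM DB hni h0 hlim; set f := fun u => D u * h u.
have bf z : bmeas f c z by exact: bmeasM.
have B0 : 0 <= B by apply: le_trans (normr_ge0 _) (DB c c _ _); rewrite lexx.
have tail y z : c0 <= y -> y <= z -> `|int_upto f c z - int_upto f c y| <= B * h y.
  move=> c0y yz; have cy := le_trans cc0 c0y.
  rewrite int_upto_tail//; apply: (@second_mean_value _ D h y z B M) => //.
  - exact: bmeasW cy (lexx _) (bD z).
  - exact: bmeasW cy (lexx _) (bh z).
  - by move=> u /andP[yu _]; apply: DM; exact: le_trans yu.
  - by move=> v /andP[yv _]; exact: DB.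
  - by move=> u v yu uv _; apply: hni => //; exact: le_trans yu.
  - by apply: h0; exact: le_trans yz.
have cvgf : cvg (int_upto f c N @[N --> +oo]).
  apply/cauchy_cvgP/cauchy_exP => e e0.
  (* B + 1 guards against B = 0, and the extra 1/2 makes the final inequality strict. *)
  have [|y c0y hy] := hlim (e / (B + 1) / 2); first by rewrite !divr_gt0// ltr_pwDr.
  exists (int_upto f c y).
  suff : \forall N \near +oo, ball (int_upto f c y) e (int_upto f c N) by [].
  near=> N.
  have yN : y <= N by near: N; apply: nbhs_pinfty_ge; exact: num_real.
  rewrite /ball/= distrC (le_lt_trans (tail _ _ c0y yN))//.
  apply: (@le_lt_trans _ _ ((B + 1) * (e / (B + 1) / 2))).
    by apply: ler_pM => //; [exact: h0|rewrite lerDl].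
  have -> : (B + 1) * (e / (B + 1) / 2) = e / 2.
    by field; rewrite gt_eqF// ltr_pwDr.
  by rewrite ltr_pdivrMr// ltr_pMr// ltr1n.
split => //; rewrite /improper_int ler_norml lerBrDl [X in _ && X]lerBlDl; apply/andP; split.
  apply: limr_ge => //; near=> N.
  have c0N : c0 <= N by near: N; apply: nbhs_pinfty_ge; exact: num_real.
  by have := tail _ _ (lexx _) c0N; rewrite ler_norml => /andP[]; lra.
apply: limr_le => //; near=> N.
have c0N : c0 <= N by near: N; apply: nbhs_pinfty_ge; exact: num_real.
by have := tail _ _ (lexx _) c0N; rewrite ler_norml => /andP[]; lra.
Unshelve. all: by end_near. Qed.

Lemma improper_lincomb f g a b c : (forall z, bmeas f c z) -> (forall z, bmeas g c z) ->
  improper_cvg f c -> improper_cvg g c ->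
  improper_cvg (fun u => a * f u + b * g u) c /\
  improper_int (fun u => a * f u + b * g u) c = a * improper_int f c + b * improper_int g c.
Proof.
move=> bf bg cf cg.
have cl : (int_upto (fun u => a * f u + b * g u) c N @[N --> +oo]) -->
    a * improper_int f c + b * improper_int g c.
  have -> : int_upto (fun u => a * f u + b * g u) c =
      fun N => a * int_upto f c N + b * int_upto g c N.
    apply/funext => N; rewrite intD ?intZ//; exact: bmeasM (bmeas_cst _ _ _) _.
  by apply: cvgD; apply: cvgM => //; exact: cvg_cst.
split; first by apply/cvg_ex; exists (a * improper_int f c + b * improper_int g c).
exact: cvg_lim cl.
Qed.

Lemma improper_sum (I : Type) (r : seq I) (w : I -> R) (f : I -> R -> R) c :
  (forall i z, bmeas (f i) c z) -> (forall i, improper_cvg (f i) c) ->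
  improper_cvg (fun u => \sum_(i <- r) w i * f i u) c /\
  improper_int (fun u => \sum_(i <- r) w i * f i u) c = \sum_(i <- r) w i * improper_int (f i) c.
Proof.
move=> bf cf; have bwf i z : bmeas (fun u => w i * f i u) c z.
  exact: bmeasM (bmeas_cst _ _ _) (bf i z).
elim: r => [|i r [cr ir]].
  rewrite big_nil; under eq_fun do rewrite big_nil.
  have I0 : int_upto (fun=> 0 : R) c = fun=> 0.
    by apply/funext => N; rewrite /int_upto Rintegral_cst// mul0r.
  by split; rewrite /improper_cvg /improper_int I0; [exact: is_cvg_cst|exact: lim_cst].
under eq_fun do rewrite big_cons.
have bs z : bmeas (fun u => \sum_(i <- r) w i * f i u) c z by apply: bmeas_sum.
have [c1 i1] := improper_lincomb (w i) 1 (bf i) bs (cf i) cr.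
under eq_fun do rewrite -[\sum_(_ <- _) _]mul1r.
by split => //; rewrite i1 big_cons ir mul1r.
Qed.

End Improper.

(** * The antiderivative of the sawtooth *)

Section Psi.
Context {R : realType}.
Implicit Types (x y b : R).

(** Half the periodic Bernoulli function B_2, up to an additive constant: continuous, 1-periodic and
    zero at the integers. *)
Definition sawQ x : R := ((x - (Num.floor x)%:~R) ^+ 2 - (x - (Num.floor x)%:~R)) / 2.

Lemma psi_bound x : `|psi x| <= 2^-1.
Proof.
rewrite /psi; have := floor_itv x; rewrite intrD => /andP[h1 h2].
rewrite ler_norml; apply/andP; split; lra.
Qed.

Lemma bmeas_psi b x y : bmeas (fun u => psi (u - b)) x y.
Proof.
split; last by exists 2^-1 => u _; exact: psi_bound.
have -> : (fun u : R => psi (u - b)) =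
    (fun u => u + - b) \- (fun u => (Num.floor (u - b))%:~R + 2^-1).
  by apply/funext => u /=; rewrite /psi; ring.
apply: measurable_funB.
  by apply: measurable_funD => //; exact: measurable_cst.
apply: measurable_funD; last exact: measurable_cst.
apply: nondecreasing_measurable => // u v uv.
by rewrite ler_int le_floor// lerD2r.
Qed.

(** A fixed n in place of the floor allows y to be the next jump itself. *)
Lemma int_psi_piece (n : int) b x y : x <= y -> n%:~R + b <= x -> y <= (n + 1)%:~R + b ->
  int_upto (fun u => psi (u - b)) x y =
  ((y - b - n%:~R) ^+ 2 - (y - b - n%:~R)) / 2 - ((x - b - n%:~R) ^+ 2 - (x - b - n%:~R)) / 2.
Proof.
move=> xy nx yn.
pose g u : R := u - b - n%:~R - 2^-1.
have cg : continuous g.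
  move=> u; rewrite /g; apply: cvgB; last exact: cvg_cst.
  by apply: cvgB; [apply: cvgB; [exact: cvg_id|exact: cvg_cst]|exact: cvg_cst].
have dF u : is_derive u (1 : R) (fun u => ((u - b - n%:~R) ^+ 2 - (u - b - n%:~R)) / 2) (g u).
  have dt : is_derive u (1 : R) (fun u => u - b - n%:~R) (1 - 0 - 0).
    exact: isdB (isdB (isd_id _) (isd_cst _ _)) (isd_cst _ _).
  apply: isd_ext (isdM (isdB (isdX 2 dt) dt) (isd_cst 2^-1 _)) _.
  by rewrite /g /= expr1; field.
rewrite (@int_eq_oo _ _ g); [|exact: bmeas_psi| |].
- exact: (int_FTC xy (fun u _ => dF u) (fun u _ => cg u)).
- by apply: bmeas_continuous; exact: continuous_subspaceT.
- move=> u /andP[xu uy]; rewrite /psi /g (@floor_def _ _ n)//.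
  by rewrite lerBrDr (le_trans nx xu) ltrBlDr (lt_le_trans uy yn).
Qed.

(** Induction on the number of jumps crossed: the interval is cut at the first jump after x, where
    the expressions on both sides vanish. *)
Lemma int_psi b x y : x <= y ->
  int_upto (fun u => psi (u - b)) x y = sawQ (y - b) - sawQ (x - b).
Proof.
move=> xy; have [m mE] : exists m : nat, Num.floor (y - b) = Num.floor (x - b) + m%:Z.
  exists `|Num.floor (y - b) - Num.floor (x - b)|%N.
  have : Num.floor (x - b) <= Num.floor (y - b) by rewrite le_floor// lerD2r.
  lia.
elim: m x xy mE => [|m IH] x xy mE.
  have := floor_itv (x - b); have := floor_itv (y - b).
  rewrite /sawQ mE addr0 => /andP[h1 h2] /andP[h3 h4].
  by apply: int_psi_piece => //; lra.
set n := Num.floor (x - b) in mE *.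
have := floor_itv (x - b); have := floor_itv (y - b).
rewrite -/n mE !intrD => /andP[h1 h2] /andP[h3 h4].
have m0 : (0 : R) <= m%:~R by rewrite ler0z.
pose x1 := (n + 1)%:~R + b.
have x1E : x1 - b = (n + 1)%:~R by rewrite /x1; ring.
have xx1 : x <= x1 by rewrite /x1 intrD; lra.
have x1y : x1 <= y by rewrite /x1 intrD; move: h1; rewrite -addn1 PoszD intrD; lra.
rewrite (int_split xx1 x1y (bmeas_psi _ _ _)) IH//; last first.
  by rewrite mE x1E intrKfloor; lia.
rewrite (@int_psi_piece n)//; last by lra.
rewrite x1E /sawQ -/n intrKfloor subrr intrD; ring.
Qed.

Lemma sawQ_int x (m : int) : sawQ (x + m%:~R) = sawQ x.
Proof. by rewrite /sawQ floorDrz ?intr_int// intrKfloor intrD; congr (_ / _); ring. Qed.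

End Psi.

(** * Periodic weights and summation against their sawtooth sum *)

Section Weights.
Context {R : realType} (q : nat) (w : nat -> R).
Implicit Types (x y u M : R) (n a : nat).

(* The weights [w] stand for the real or the imaginary part of chi; [wpsi] is
   u |-> Psi(q u), equal to [wmean - wsum n] for n <= q u < n + 1. *)
Definition wsum n : R := \sum_(1 <= j < n.+1) w j.
Definition wpsi u : R := \sum_(1 <= a < q.+1) w a * psi (u - a%:R / q%:R).
Definition wmean : R := - \sum_(1 <= a < q.+1) w a * (a%:R / q%:R).

Hypothesis q0 : (0 < q)%N.
Hypothesis w_period : forall n, w (n + q)%N = w n.
Hypothesis w_sum0 : wsum q = 0.

Let qR : (0 : R) < q%:R. Proof. by rewrite ltr0n. Qed.

Lemma wsumS n : wsum n.+1 = wsum n + w n.+1.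
Proof. by rewrite /wsum big_nat_recr. Qed.

Lemma wsum0 : wsum 0 = 0. Proof. by rewrite /wsum big_geq. Qed.

Lemma wsum_mod n : wsum (n %% q) = wsum n.
Proof.
have wsumDq m : wsum (m + q) = wsum m.
  elim: m => [|m IH]; first by rewrite add0n w_sum0 wsum0.
  by rewrite addSn !wsumS IH -addSn w_period.
rewrite [in RHS](divn_eq n q) addnC.
elim: (n %/ q)%N => [|k IH]; first by rewrite mul0n addn0.
by rewrite mulSn addnCA addnC wsumDq.
Qed.

(** Write n = k q + r. The floor of u - a/q is k - [r < a]; the contribution of u - k - 1/2 vanishes
    because the weights sum to 0 over a period, and the weights with a > r sum to the opposite of
    [wsum r]. *)
Lemma wpsiE n u : n%:R <= q%:R * u -> q%:R * u < n.+1%:R -> wpsi u = wmean - wsum n.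
Proof.
move=> nu un; set k := (n %/ q)%N; set r := (n %% q)%N.
have nE : n%:R = k%:R * q%:R + r%:R :> R by rewrite -natrM -natrD -divn_eq.
have rq : r.+1%:R <= q%:R :> R by rewrite ler_nat ltn_pmod.
have uE : u = (q%:R * u) / q%:R by field; rewrite gt_eqF.
have term a : (1 <= a < q.+1)%N -> w a * psi (u - a%:R / q%:R) =
    w a * (u - k%:R - 2^-1) - w a * (a%:R / q%:R) + (if (r < a)%N then w a else 0).
  move=> /andP[a1 aq].
  have r0 : 0 <= r%:R :> R by [].
  have a1R : 1 <= a%:R :> R by rewrite ler1n.
  have aqR : a%:R <= q%:R :> R by rewrite ler_nat.
  have -> : psi (u - a%:R / q%:R) =
      u - a%:R / q%:R - (k%:R - (r < a)%:R) - 2^-1.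
    rewrite /psi (@floor_def _ _ (k%:Z - (r < a)%:Z)); first by rewrite intrB -!pmulrn.
    have -> : u - a%:R / q%:R = (q%:R * u - a%:R) / q%:R by field; rewrite gt_eqF.
    rewrite !intrD !mulrNz -!pmulrn ler_pdivlMr// ltr_pdivrMr//.
    move: nu un rq; rewrite -!natr1 nE.
    case: (ltnP r a) => [ra|ar] /=.
      have : r.+1%:R <= a%:R :> R by rewrite ler_nat.
      rewrite -natr1 => ? ? ? ?; apply/andP; split; lra.
    have : a%:R <= r%:R :> R by rewrite ler_nat.
    move=> ? ? ? ?; apply/andP; split; lra.
  by case: ifP => _ /=; ring.
rewrite /wpsi (eq_big_nat _ _ term) !big_split/= -mulr_suml -/(wsum q) w_sum0 mul0r add0r.
rewrite sumrN; congr (_ + _); rewrite -(wsum_mod n) -/r.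
have rq1 : (r.+1 <= q.+1)%N by rewrite ltnS ltnW// ltn_pmod.
have split_sum (P : pred nat) : \sum_(1 <= a < q.+1 | P a) w a =
    \sum_(1 <= a < r.+1 | P a) w a + \sum_(r.+1 <= a < q.+1 | P a) w a.
  by rewrite (@big_cat_nat _ _ _ r.+1 1 q.+1).
apply/eqP; rewrite -addr_eq0 -big_mkcond/=; apply/eqP.
rewrite -[RHS]w_sum0 /wsum !split_sum addrC; congr (_ + _).
rewrite big_nat_cond big_pred0 ?add0r; last by move=> i; lia.
by rewrite big_nat_cond [RHS]big_nat_cond; apply: eq_bigl => i; lia.
Qed.

Lemma sum_wsum m : \sum_(0 <= n < m) wsum n = \sum_(1 <= j < m.+1) w j * (m%:R - j%:R).
Proof.
elim: m => [|m IH]; first by rewrite !big_geq.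
rewrite big_nat_recr//= IH [RHS]big_nat_recr//= subrr mulr0 addr0 -big_split/=.
by apply: eq_bigr => j _; rewrite -natr1; ring.
Qed.

(** Being the average of the partial sums over a period, [wmean] gives the sawtooth sum mean zero
    and obeys every uniform bound on [wsum]. *)
Lemma wmeanE : wmean = q%:R^-1 * \sum_(0 <= n < q) wsum n.
Proof.
rewrite sum_wsum /wmean.
under [in RHS]eq_bigr do rewrite mulrBr.
rewrite sumrB -mulr_suml -/(wsum q) w_sum0 mul0r sub0r mulrN mulr_sumr.
by congr (- _); apply: eq_bigr => a _; ring.
Qed.

Lemma wmean_bound M : (forall n, `|wsum n| <= M) -> `|wmean| <= M.
Proof.
move=> SM; rewrite wmeanE.
rewrite normrM ger0_norm ?invr_ge0// mulrC ler_pdivrMr//.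
rewrite (le_trans (ler_norm_sum _ _ _))//.
rewrite (le_trans (ler_sum_nat (G := fun=> M) _))//.
by rewrite sumr_const_nat subn0 mulr_natr.
Qed.

Lemma wsum_bounded : exists B : R, forall n, `|wsum n| <= B.
Proof.
exists (\sum_(r < q) `|wsum r|) => n; rewrite -wsum_mod.
by rewrite (bigD1 (Ordinal (ltn_pmod n q0)))//= lerDl sumr_ge0.
Qed.

Lemma nat_floor u : 0 <= u -> exists n : nat, n%:R <= q%:R * u /\ q%:R * u < n.+1%:R.
Proof.
move=> u0; exists (Num.truncn (q%:R * u)).
by have /andP[] := truncn_itv (mulr_ge0 (ltW qR) u0).
Qed.

Lemma wpsi_bound M u : (forall n, `|wsum n| <= M) -> 0 <= u -> `|wpsi u| <= 2 * M.
Proof.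
move=> SM u0; have [n [nu un]] := nat_floor u0; rewrite (wpsiE nu un).
rewrite (le_trans (ler_normB _ _))//.
by have := wmean_bound SM; have := SM n; lra.
Qed.

Lemma bmeas_wpsi x y : bmeas wpsi x y.
Proof. by apply: bmeas_sum => a _; exact: bmeasM (bmeas_cst _ _ _) (bmeas_psi _ _ _). Qed.

Lemma int_wpsi x y : x <= y -> int_upto wpsi x y =
  \sum_(1 <= a < q.+1) w a * (sawQ (y - a%:R / q%:R) - sawQ (x - a%:R / q%:R)).
Proof.
move=> xy; rewrite int_sum; last first.
  by move=> a _; exact: bmeasM (bmeas_cst _ _ _) (bmeas_psi _ _ _).
by apply: eq_bigr => a _; rewrite intZ ?int_psi//; exact: bmeas_psi.
Qed.

(** Removing whole periods does not change the integral, because [sawQ] is 1-periodic; the rest has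
    length at most 1 and an integrand bounded by 2 M. *)
Lemma int_wpsi_bound M x y : (forall n, `|wsum n| <= M) -> 0 <= x -> x <= y ->
  `|int_upto wpsi x y| <= 2 * M.
Proof.
move=> SM x0 xy; pose m := Num.truncn (y - x); pose y' := y - m%:R.
have /andP[m1 m2] : m%:R <= y - x < m.+1%:R by rewrite truncn_itv// subr_ge0.
have xy' : x <= y' by rewrite /y'; lra.
have y'x : y' - x <= 1 by rewrite /y'; move: m2; rewrite -natr1; lra.
have M0 : 0 <= M := le_trans (normr_ge0 _) (SM 0).
have -> : int_upto wpsi x y = int_upto wpsi x y'.
  rewrite !int_wpsi//; apply: eq_bigr => a _; congr (_ * (_ - _)).
  by rewrite -(sawQ_int (y' - _) m%:Z); congr sawQ; rewrite /y' -pmulrn; ring.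
apply: (le_trans (int_norm_le (M := 2 * M) xy' (bmeas_wpsi _ _) _)).
  by move=> u /andP[xu _]; apply: wpsi_bound => //; exact: le_trans xu.
by rewrite -[leRHS]mulr1; apply: ler_wpM2l => //; rewrite mulr_ge0.
Qed.

(** The truncation at N = n for g(t) = G(t/q): [wmean - wsum n] is the value of the sawtooth sum at
    n/q. *)
Definition wpartial (G : R -> R) n : R :=
  \sum_(1 <= j < n.+1) w j * G (j%:R / q%:R) + (wmean - wsum n) * G (n%:R / q%:R).

Lemma wpartialS (G : R -> R) n : wpartial G n.+1 =
  wpartial G n + (wmean - wsum n) * (G (n.+1%:R / q%:R) - G (n%:R / q%:R)).
Proof. by rewrite /wpartial big_nat_recr//= wsumS; ring. Qed.

Section Step.
Variables G k : R -> R.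
Hypothesis dG : forall u, 0 < u -> is_derive u (1 : R) G (k u).
Hypothesis ck : forall u, 0 < u -> {for u, continuous k}.

Lemma bmeas_pos x y : 0 < x -> bmeas k x y.
Proof.
move=> x0; apply/bmeas_continuous/continuous_in_subspaceT => u.
by rewrite inE/= in_itv/= => /andP[xu _]; apply: ck; exact: lt_le_trans xu.
Qed.

Lemma int_step_piece n x y : 0 < x -> x <= y -> n%:R / q%:R <= x -> y <= n.+1%:R / q%:R ->
  int_upto (fun u => wpsi u * k u) x y = (wmean - wsum n) * (G y - G x).
Proof.
move=> x0 xy nx yn; have bk : bmeas k x y by exact: bmeas_pos.
rewrite (@int_eq_oo _ _ (fun u => (wmean - wsum n) * k u)).
- have dG' u : x <= u <= y -> is_derive u (1 : R) G (k u).
    by move=> /andP[xu _]; apply: dG; exact: lt_le_trans xu.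
  have ck' u : x <= u <= y -> {for u, continuous k}.
    by move=> /andP[xu _]; apply: ck; exact: lt_le_trans xu.
  by rewrite intZ//; congr (_ * _); exact: int_FTC xy dG' ck'.
- exact: bmeasM (bmeas_wpsi _ _) bk.
- exact: bmeasM (bmeas_cst _ _ _) bk.
move=> u /andP[xu uy]; rewrite (@wpsiE n)//.
  by rewrite -ler_pdivrMl// mulrC (le_trans nx).
by rewrite -ltr_pdivlMl// mulrC (lt_le_trans uy).
Qed.

(** A first piece leads from X to the next integer, strictly beyond X; unit steps follow, on each of
    which the sawtooth sum is constant. *)
Lemma int_step X m : 0 < X -> let n0 := Num.truncn X in
  int_upto (fun u => wpsi u * k u) (X / q%:R) ((n0 + m).+1%:R / q%:R) =
  wpartial G (n0 + m).+1 -
   (\sum_(1 <= j < n0.+1) w j * G (j%:R / q%:R) + wpsi (X / q%:R) * G (X / q%:R)).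
Proof.
move=> X0 n0; have /andP[n0X Xn0] := truncn_itv (ltW X0).
have Xq0 : 0 < X / q%:R by rewrite divr_gt0.
have le_div (a b : R) : a <= b -> a / q%:R <= b / q%:R :> R.
  by move=> ab; rewrite ler_pM2r ?invr_gt0.
elim: m => [|m IH].
  rewrite addn0 (@int_step_piece n0) ?le_div//; last exact: ltW.
  rewrite (@wpsiE n0) ?mulrA ?[q%:R * X]mulrC ?mulfK ?gt_eqF//.
  by rewrite /wpartial big_nat_recr//= wsumS; ring.
have h1 : X / q%:R <= (n0 + m).+1%:R / q%:R.
  apply: le_div; rewrite (le_trans (ltW Xn0))// ler_nat ltnS leq_addr//.
have h2 : (n0 + m).+1%:R / q%:R <= (n0 + m.+1).+1%:R / q%:R :> R.
  by apply: le_div; rewrite ler_nat; lia.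
rewrite (int_split h1 h2); last exact: bmeasM (bmeas_wpsi _ _) (bmeas_pos _ Xq0).
rewrite IH (@int_step_piece (n0 + m).+1)//; [|exact: lt_le_trans h1|by rewrite addnS].
by rewrite addnS (wpartialS G (n0 + m).+1); ring.
Qed.

(** The truncations do not involve X, yet their limit is expressed through it: this is the freedom
    of X in the final formulas. *)
Lemma wpartial_cvg X : 0 < X -> improper_cvg (fun u => wpsi u * k u) (X / q%:R) ->
  wpartial G @ \oo -->
  \sum_(1 <= j < (Num.truncn X).+1) w j * G (j%:R / q%:R)
   + wpsi (X / q%:R) * G (X / q%:R)
   + improper_int (fun u => wpsi u * k u) (X / q%:R).
Proof.
move=> X0 cf; set EX := \sum_(1 <= j < _) _ + _; set n0 := Num.truncn X.
rewrite -(cvg_shiftn n0.+1).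
have -> : (fun n => wpartial G (n + n0.+1)) =
    fun n => EX + int_upto (fun u => wpsi u * k u) (X / q%:R) ((n0 + n).+1%:R / q%:R).
  by apply/funext => n; rewrite int_step// -/n0 -/EX addnS [(n + n0)%N]addnC; ring.
apply: cvgD; first exact: cvg_cst.
have lim_inf : (fun n : nat => (n0 + n).+1%:R / q%:R : R) @ \oo --> +oo.
  apply/cvgryPge => A; near=> n.
  rewrite ler_pdivlMr// (@le_trans _ _ n%:R)// ?ler_nat; last by lia.
  by near: n; exact: nbhs_infty_ger.
exact: cvg_comp lim_inf cf.
Unshelve. all: by end_near. Qed.

End Step.
End Weights.

(** * Analytic continuation along the real axis *)

Section Series.
Context {R : realType}.
Implicit Types (A r c : R ^nat) (b : nat -> R ^nat).

Lemma series_tail_le A r n : (forall m, `|r m| <= A m) -> cvgn (series A) ->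
  `|limn (series r) - series r n| <= limn (series A) - series A n.
Proof.
move=> rA cA.
have cr : cvgn (series r).
  apply: normed_cvg; apply: series_le_cvg cA => m //=.
  exact: le_trans (normr_ge0 _) (rA m).
have key N : (n <= N)%N -> `|series r N - series r n| <= limn (series A) - series A n.
  move=> nN; rewrite /series/= !sub_series_geq ?nN//.
  rewrite (le_trans (ler_norm_sum _ _ _))//.
  apply: (@le_trans _ _ (\sum_(n <= m < N) A m)).
    by apply: ler_sum_nat => m _; exact: rA.
  rewrite -sub_series_geq// lerD2r.
  apply: nondecreasing_cvgn_le => //.
  apply: nondecreasing_series => m _ _; exact: le_trans (normr_ge0 _) (rA m).
rewrite ler_norml lerBrDl [X in _ && X]lerBlDl; apply/andP; split.
  apply: limr_ge => //; near=> N.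
  have nN : (n <= N)%N by near: N; exact: nbhs_infty_ge.
  by have := key N nN; rewrite ler_norml => /andP[]; lra.
apply: limr_le => //; near=> N.
have nN : (n <= N)%N by near: N; exact: nbhs_infty_ge.
by have := key N nN; rewrite ler_norml => /andP[]; lra.
Unshelve. all: by end_near. Qed.

Lemma is_cvg_majorant A r : (forall m, `|r m| <= A m) -> cvgn (series A) ->
  cvgn (series r).
Proof.
move=> rA cA; apply: normed_cvg; apply: series_le_cvg cA => m //=.
exact: le_trans (normr_ge0 _) (rA m).
Qed.

(** Cut where the tail of the majorant is below e/4; the two tails and the convergent finite part
    then cost less than e/4 each. *)
Lemma tannery A b r : (forall K m, `|b K m| <= A m) -> cvgn (series A) ->
  (forall m, b ^~ m @ \oo --> r m) ->
  (fun K => limn (series (b K))) @ \oo --> limn (series r).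
Proof.
move=> bA cA br.
have rA m : `|r m| <= A m.
  have h : (fun K => `|b K m|) @ \oo --> `|r m| by exact: cvg_norm (br m).
  rewrite -(cvg_lim _ h)//; apply: limr_le; first by apply/cvg_ex; exists `|r m|.
  by apply: nearW => K; exact: bA.
apply/cvgrPdist_lt => e e0.
have e4 : 0 < e / 4 by rewrite divr_gt0.
have [n nP] : exists n, limn (series A) - series A n < e / 4.
  have /cvgrPdist_lt/(_ _ e4)[n _ /(_ n (leqnn n))/=] := cA.
  by move=> h; exists n; exact: le_lt_trans (ler_norm _) h.
have fin : (fun K => series (b K) n) @ \oo --> series r n.
  rewrite /series/=; elim: {nP} n => [|n IH].
    by under eq_fun do rewrite big_geq//; rewrite big_geq//; exact: cvg_cst.
  under eq_fun do rewrite big_nat_recr//=; rewrite big_nat_recr//=.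
  by apply: cvgD.
have /cvgrPdist_lt/(_ _ e4) := fin; apply: filterS => K hK.
have h1 := series_tail_le n rA cA.
have h2 := series_tail_le n (bA K) cA.
have -> : limn (series r) - limn (series (b K)) =
  (limn (series r) - series r n) + (series r n - series (b K) n)
  - (limn (series (b K)) - series (b K) n) by ring.
rewrite (le_lt_trans (ler_normB _ _))// (le_lt_trans (lerD (ler_normD _ _) (lexx _)))//.
lra.
Qed.

(** If c_m is the first nonzero coefficient, Cauchy's estimate on the tail gives |c_m| y^m <= 2 M
    (y/r)^(m+1), so |c_m| = O(y) as y tends to 0. Vanishing is assumed only to the right of 0, which
    is all that the continuation can offer. *)
Lemma power_series_eq0 c (rho : R) : 0 < rho ->
  (forall y : R, 0 < y < rho -> [series c k * y ^+ k]_k @ \oo --> (0 : R)) ->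
  forall k, c k = 0.
Proof.
move=> rho0 c0; have [r [r0 rr]] : exists r : R, 0 < r /\ r < rho.
  by exists (rho / 2); rewrite divr_gt0// ltr_pdivrMr// ltr_pMr// ltr1n.
have [M [M0 cM]] : exists M, 0 < M /\ forall k, `|c k| <= M / r ^+ k.
  have h : cvgn [series c k * r ^+ k]_k by apply/cvg_ex; exists 0; apply: c0; rewrite r0.
  have [B [_ aB]] := cvg_series_bounded h.
  exists (`|B| + 1); split; first by rewrite ltr_pwDr.
  move=> k; rewrite ler_pdivlMr ?exprn_gt0//.
  have := aB (`|B| + 1) _ k I; rewrite /= normrM normrX (gtr0_norm r0); apply.
  by rewrite (le_lt_trans (ler_norm _))// ltrDl.
move=> k; apply: contrapT => /eqP ck.
have ex_k : exists k, c k != 0 by exists k.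
have [m cm mmin] := ex_minnP ex_k.
have cm0 : 0 < `|c m| by rewrite normr_gt0.
have bound y : 0 < y -> y <= r / 2 -> `|c m| <= 2 * M / r ^+ m.+1 * y.
  move=> y0 yr; have yrho : y < rho by lra.
  have yr2 : y / r <= 2^-1 by rewrite ler_pdivrMr// mulrC.
  have yr0 : 0 <= y / r by rewrite divr_ge0// ltW.
  have tail n : `|[series c k * y ^+ k]_k (m.+1 + n)%N - c m * y ^+ m| <=
      2 * M * (y / r) ^+ m.+1.
    rewrite /series/= (@big_cat_nat _ _ _ m.+1)//=; last exact: leq_addr.
    rewrite big_nat_recr//= big1_seq ?add0r; last first.
      move=> i /andP[_]; rewrite mem_index_iota => /andP[_ im].
      have [/eqP->|/mmin] := boolP (c i == 0); first by rewrite mul0r.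
      by rewrite leqNgt im.
    rewrite addrAC subrr add0r (le_trans (ler_norm_sum _ _ _))//.
    rewrite -{1}[m.+1]add0n big_addn addKn.
    apply: (@le_trans _ _ (\sum_(0 <= i < n) M * (y / r) ^+ m.+1 * 2^-1 ^+ i)).
      apply: ler_sum_nat => i _; rewrite normrM normrX (gtr0_norm y0).
      apply: (le_trans (ler_wpM2r _ (cM _))); first by rewrite exprn_ge0// ltW.
      have -> : M / r ^+ (i + m.+1) * y ^+ (i + m.+1) = M * (y / r) ^+ m.+1 * (y / r) ^+ i.
        by rewrite !exprMn !exprVn !exprD invfM; ring.
      apply: ler_wpM2l; first by rewrite mulr_ge0// ?exprn_ge0// ltW.
      by apply: lerXn2r; rewrite ?nnegrE.
    rewrite -mulr_sumr -(mulrA 2) mulrC; apply: ler_wpM2r; last exact: sum_half_le2.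
    by rewrite mulr_ge0// ?exprn_ge0// ltW.
  have shifted : (fun n => [series c k * y ^+ k]_k (m.+1 + n)%N - c m * y ^+ m) @ \oo
      --> 0 - c m * y ^+ m.
    apply: cvgB; last exact: cvg_cst.
    have -> : (fun n => [series c k * y ^+ k]_k (m.+1 + n)%N) =
        [sequence [series c k * y ^+ k]_k (n + m.+1)%N]_n.
      by apply/funext => n; rewrite addnC.
    by rewrite cvg_shiftn; apply: c0; rewrite y0.
  have : `|0 - c m * y ^+ m| <= 2 * M * (y / r) ^+ m.+1.
    have h : (fun n => `|[series c k * y ^+ k]_k (m.+1 + n)%N - c m * y ^+ m|) @ \oo
      --> `|0 - c m * y ^+ m| by exact: cvg_norm shifted.
    rewrite -(cvg_lim _ h)//.
    apply: limr_le; first by apply/cvg_ex; exists `|0 - c m * y ^+ m|.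
    by apply: nearW => n; exact: tail.
  rewrite sub0r normrN normrM normrX (gtr0_norm y0).
  have ym : 0 < y ^+ m by rewrite exprn_gt0.
  rewrite -ler_pdivlMr// => /le_trans; apply.
  rewrite le_eqVlt; apply/orP; left; apply/eqP.
  by rewrite exprMn exprVn [y ^+ m.+1]exprS; field; rewrite !gt_eqF// exprn_gt0.
pose K := 2 * M / r ^+ m.+1.
have K0 : 0 < K by rewrite divr_gt0 ?mulr_gt0// exprn_gt0.
(* The second entry turns |c_m| <= K y into |c_m| <= |c_m|/2. *)
pose y := Num.min (r / 2) (`|c m| / (2 * K)).
have y0 : 0 < y by rewrite lt_min !divr_gt0// mulr_gt0.
have yr : y <= r / 2 by rewrite ge_min lexx.
have yc : y <= `|c m| / (2 * K) by rewrite ge_min lexx orbT.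
have := bound y y0 yr; rewrite -/K => /le_trans/(_ (ler_wpM2l (ltW K0) yc)).
have -> : K * (`|c m| / (2 * K)) = `|c m| / 2 by field; rewrite gt_eqF.
lra.
Qed.

End Series.

(** * Second differences through the mean value theorem *)

Section Differences.
Context {R : realType}.
Implicit Types (f h : R -> R) (x t : R).

Lemma mvt f (f1 : R -> R) x (y : R) : 0 < x -> x <= y ->
  (forall t, 0 < t -> is_derive t (1 : R) f (f1 t)) ->
  exists2 t, x <= t <= y & f y - f x = f1 t * (y - x).
Proof.
move=> x0 xy df.
have df' z : z \in `]x, y[%R -> is_derive z (1 : R) f (f1 z).
  by rewrite in_itv/= => /andP[xz _]; apply: df; exact: lt_trans xz.
have cf : {within `[x, y], continuous f}.
  apply: continuous_in_subspaceT => z; rewrite inE/= in_itv/= => /andP[xz _].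
  apply/differentiable_continuous/derivable1_diffP.
  by have [] := df z (lt_le_trans x0 xz).
have [t] := MVT_segment xy df' cf.
by rewrite in_itv/= => txy ->; exists t.
Qed.

(** The mean value theorem is applied to t -> h(t + 1) - h(t), then to h1. Only a lower bound on the
    intermediate point is kept, since the majorants used for h2 decrease. *)
Lemma second_difference h (h1 h2 : R -> R) x : 0 < x ->
  (forall t, 0 < t -> is_derive t (1 : R) h (h1 t)) ->
  (forall t, 0 < t -> is_derive t (1 : R) h1 (h2 t)) ->
  exists2 t, x <= t & h (x + 2) - 2 * h (x + 1) + h x = h2 t.
Proof.
move=> x0 dh dh1.
have dd t : 0 < t -> is_derive t (1 : R) (fun t => h (t + 1) - h t) (h1 (t + 1) - h1 t).
  move=> t0; apply: isdB; last exact: dh.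
  have t1 : 0 < t + 1 by rewrite addr_gt0.
  apply: isd_ext (isd_comp (f := h) (isdD (isd_id t) (isd_cst 1 t)) (dh _ t1)) _.
  by rewrite addr0 mulr1.
have [|t /andP[xt _]] := mvt x0 _ dd (y := x + 1); first by rewrite lerDl.
have t0 := lt_le_trans x0 xt.
have [|s /andP[ts _] hs] := mvt t0 _ dh1 (y := t + 1); first by rewrite lerDl.
have -> : x + 1 + 1 = x + 2 by ring.
have -> : x + 1 - x = 1 by ring.
rewrite hs => e; exists s; first exact: le_trans ts.
have -> : h2 s = h2 s * (t + 1 - t) * 1 by ring.
by rewrite -e; ring.
Qed.

(** Telescoping comparison: (m+2)^(-3/2) <= 2 ((m+1)^(-1/2) - (m+2)^(-1/2)). The factor 9 is that of
    [tpow2_le]. *)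
Lemma three_halves_series : cvgn (series (fun m => 9 * expR (- (3 / 2) * ln (m.+1%:R : R)))).
Proof.
pose f t : R := expR (- (1 / 2) * ln t).
pose u m : R := expR (- (3 / 2) * ln (m.+1%:R : R)).
have df t : 0 < t -> is_derive t (1 : R) f (- (1 / 2) * expR (- (3 / 2) * ln t)).
  move=> t0; apply: isd_ext (isd_expR (isdZ (- (1 / 2)) (isd_ln (f := fun t => t) t0 (isd_id t)))) _.
  have -> : t^-1 = expR (- ln t) by rewrite expRN lnK.
  by rewrite mulr1 mulrCA -expRD; congr (_ * expR _); field.
have step m : u m.+1 <= 2 * (f m.+1%:R - f m.+2%:R).
  have [||t /andP[mt tm]] := @mvt f _ m.+1%:R m.+2%:R _ _ df; [by []|by rewrite ler_nat|].
  have -> : m.+2%:R - m.+1%:R = 1 :> R by rewrite -natrB// subSnn.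
  rewrite mulr1 => e.
  have -> : 2 * (f m.+1%:R - f m.+2%:R) = expR (- (3 / 2) * ln t) :> R.
    by rewrite -(opprB (f m.+2%:R)) e; field.
  have t0 : 0 < t by apply: lt_le_trans mt.
  have : ln t <= ln m.+2%:R by rewrite ler_ln ?posrE.
  by rewrite /u ler_expR; lra.
have bound n : series u n.+1 <= u 0 + 2 * (f 1 - f n.+1%:R).
  elim: n => [|n IH]; first by rewrite /series/= big_nat1 subrr mulr0 addr0.
  have -> : series u n.+2 = series u n.+1 + u n.+1 by rewrite /series/= big_nat_recr.
  by have := step n; lra.
have -> : series (fun m => 9 * expR (- (3 / 2) * ln (m.+1%:R : R))) = fun n => 9 * series u n.
  by apply/funext => n; rewrite /series/= mulr_sumr.
apply: is_cvgM; first exact: is_cvg_cst.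
apply: nondecreasing_is_cvgn.
  by apply: nondecreasing_series => m _ _; exact: expR_ge0.
exists (u 0 + 2 * f 1) => _ [[|n] _ <-].
  by rewrite /series/= big_geq// addr_ge0 ?mulr_ge0 ?expR_ge0.
by have := bound n; have := expR_ge0 (- (1 / 2) * ln (n.+1%:R : R)); rewrite /f; lra.
Qed.

End Differences.

(** * The second summation by parts *)

Section Truncations.
Context {R : realType} (q : nat) (w : nat -> R).
Implicit Types g A : R ^nat.

Definition wtrunc g N : R :=
  \sum_(1 <= j < N.+1) w j * g j + (wmean q w - wsum w N) * g N.

(** Indices start at 1, so that functions of ln t are only compared on t >= 1. *)
Definition diff2 g m : R := g m.+3 - 2 * g m.+2 + g m.+1.

Lemma wtruncD g1 g2 a b N : wtrunc (fun j => a * g1 j + b * g2 j) N =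
  a * wtrunc g1 N + b * wtrunc g2 N.
Proof.
rewrite /wtrunc !mulrDr !mulr_sumr addrACA -big_split/=; congr (_ + _); last ring.
by apply: eq_bigr => j _; ring.
Qed.

Hypothesis q0 : (0 < q)%N.
Hypothesis w_period : forall n, w (n + q)%N = w n.
Hypothesis w_sum0 : wsum w q = 0.

Let Psi n := wmean q w - wsum w n.

Lemma wtruncS g N : wtrunc g N.+1 = wtrunc g N + Psi N * (g N.+1 - g N).
Proof. by rewrite /wtrunc /Psi big_nat_recr//= wsumS; ring. Qed.

Lemma Psi_period n : Psi (n + q)%N = Psi n.
Proof.
congr (_ - _); rewrite -(wsum_mod w_period w_sum0 (n + q)) modnDr.
exact: (wsum_mod w_period w_sum0).
Qed.

(** This is [wmeanE] with the range 0..q-1 replaced by 1..q, which is legitimate because [wsum]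
    vanishes at both 0 and q. *)
Lemma Psi_sum0 : wsum Psi q = 0.
Proof.
rewrite /wsum /Psi sumrB sumr_const_nat subSS subn0 -mulr_natl (wmeanE w_sum0).
rewrite mulVKf ?pnatr_eq0 -?lt0n// big_add1/=.
have -> : \sum_(0 <= n < q) wsum w n.+1 = \sum_(0 <= n < q) wsum w n; last by rewrite subrr.
have := big_nat_recr q 0 (wsum w) (idx := 0) (op := +%R) (leq0n _).
rewrite big_nat_recl//= w_sum0 wsum0 addr0 add0r.
by [].
Qed.

(** Each step of [wtrunc] adds Psi(N) times an increment of g. Summing Psi in turn moves a second
    difference onto g, and the factors [wsum Psi] stay bounded because Psi is periodic with sum
    zero. *)
Lemma wtrunc_abel g N : wtrunc g N.+2 = wmean q w * g 1 +
   wsum Psi N.+1 * (g N.+2 - g N.+1) - \sum_(0 <= m < N) wsum Psi m.+1 * diff2 g m.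
Proof.
elim: N => [|N IH].
  have w1 (u : R ^nat) : wsum u 1 = u 1 by rewrite /wsum big_nat1.
  by rewrite big_geq// wtruncS /wtrunc big_nat1 !w1 /Psi w1; ring.
rewrite wtruncS IH [in RHS]big_nat_recr//= (wsumS Psi N.+1) /diff2; ring.
Qed.

Lemma wtrunc_cvg g A : (forall m, `|diff2 g m| <= A m) -> cvgn (series A) ->
  (fun n => g n.+1 - g n) @ \oo --> 0 ->
  wtrunc g @ \oo --> wmean q w * g 1 - limn (series (fun m => wsum Psi m.+1 * diff2 g m)).
Proof.
move=> gA cA dg.
have [B PB] := wsum_bounded q0 Psi_period Psi_sum0.
have B0 : 0 <= B := le_trans (normr_ge0 _) (PB 0).
rewrite -(cvg_shiftn 2).
have -> : (fun n => wtrunc g (n + 2)) = fun N => wmean q w * g 1 +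
   wsum Psi N.+1 * (g N.+2 - g N.+1) - series (fun m => wsum Psi m.+1 * diff2 g m) N.
  by apply/funext => N; rewrite addn2 wtrunc_abel.
apply: cvgB; last first.
  apply: (@is_cvg_majorant _ (fun m => B * A m)).
    by move=> m; rewrite normrM ler_pM.
  have -> : series (fun m => B * A m) = fun n => B * series A n.
    by apply/funext => n; rewrite /series/= mulr_sumr.
  by apply: is_cvgM => //; exact: is_cvg_cst.
rewrite -[X in _ --> X]addr0; apply: cvgD; first exact: cvg_cst.
apply/cvgrPdist_lt => e e0.
have e1 : 0 < e / (B + 1) by rewrite divr_gt0// ltr_pwDr.
have := dg; rewrite -cvg_shiftS => /cvgrPdist_lt/(_ _ e1).
apply: filterS => n; rewrite !sub0r !normrN normrM => h.
apply: (@le_lt_trans _ _ (B * `|g n.+2 - g n.+1|)); first by rewrite ler_wpM2r.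
move: h; rewrite ltr_pdivlMr ?ltr_pwDr// mulrC; apply: le_lt_trans.
by rewrite ler_wpM2r// lerDl.
Qed.

End Truncations.

(** * Uniform bounds for the Taylor truncations of a power *)

Section Family.
Context {R : realType}.
Implicit Types (x y t z : R) (K n m : nat).

Definition texp K z : R := \sum_(0 <= k < K) z ^+ k / k`!%:R.

Lemma texpS K z : texp K.+1 z = texp K z + z ^+ K / K`!%:R.
Proof. by rewrite /texp big_nat_recr. Qed.

Lemma texp_cvg z : texp ^~ z @ \oo --> expR z.
Proof.
have -> : texp ^~ z = series (exp_coeff z).
  by apply/funext => K; rewrite /series/= /texp; apply: eq_bigr => k _.
rewrite /expR; exact: is_cvg_series_exp_coeff.
Qed.

Lemma texp_le K z : `|texp K z| <= expR `|z|.
Proof.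
apply: (@le_trans _ _ (texp K `|z|)).
  rewrite /texp (le_trans (ler_norm_sum _ _ _))// ler_sum// => k _.
  by rewrite normrM normrX normfV normr_nat.
rewrite -(cvg_lim _ (texp_cvg (z := `|z|)))//.
apply: (nondecreasing_cvgn_le (u_ := texp ^~ `|z|)).
  apply/nondecreasing_seqP => n; rewrite texpS lerDl.
  by rewrite divr_ge0// exprn_ge0.
by apply/cvg_ex; exists (expR `|z|); exact: texp_cvg.
Qed.

(** Since [texp 0] is 0, the convention for [K.-1] is right at K = 0 as well. *)
Lemma is_derive_texp K z : is_derive z (1 : R) (texp K) (texp K.-1 z).
Proof.
elim: K => [|K IH].
  have -> : texp 0 = fun=> 0 by apply/funext => u; rewrite /texp big_geq.
  exact: isd_cst.
have -> : texp K.+1 = fun u => texp K u + u ^+ K / K`!%:R.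
  by apply/funext => u; rewrite texpS.
have d : is_derive z (1 : R) (fun u => texp K u + u ^+ K / K`!%:R) _ :=
  isdD IH (isdM (isdX K (isd_id z)) (isd_cst K`!%:R^-1 z)).
apply: isd_ext d _.
rewrite mulr0 add0r mulr1; case: K {IH} => [|K] /=.
  by rewrite mul0r mulr0 addr0.
rewrite texpS; congr (_ + _); rewrite factS natrM invfM.
have f1 : (K.+1%:R : R) != 0 by rewrite pnatr_eq0.
by rewrite mulrACA mulVf// mul1r mulrC.
Qed.

(* The truncation of t^-(x+y) = t^-x exp(-y ln t) at degree K in y. *)
Definition tpow x y K t : R := expR (- (x * ln t)) * texp K (- (y * ln t)).

Lemma is_derive_tpow x y K t : 0 < t ->
  is_derive t (1 : R) (tpow x y K)
    (t^-1 * (- x * tpow x y K t - y * tpow x y K.-1 t)).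
Proof.
move=> t0; have dl c : is_derive t (1 : R) (fun u => - (c * ln u)) (- (c * t^-1)).
  have d := isdZ (- c) (isd_ln (f := fun u => u) t0 (isd_id t)).
  have -> : (fun u => - (c * ln u)) = (fun u => - c * ln u).
    by apply/funext => u; rewrite mulNr.
  by apply: isd_ext d _; rewrite mulr1 mulNr.
have d2 := isd_comp (f := texp K) (dl y) (is_derive_texp K _).
apply: isd_ext (isdM (isd_expR (dl x)) d2) _.
rewrite /tpow; ring.
Qed.

(** [tpow1] and [tpow2] are the first two derivatives of [tpow] in t, written through shorter
    truncations so that one bound serves them all. *)
Definition tpow1 x y K t := t^-1 * (- x * tpow x y K t - y * tpow x y K.-1 t).
Definition tpow2 x y K t := t^-1 * t^-1 * ((x + x ^+ 2) * tpow x y K t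
  + (y + 2 * x * y) * tpow x y K.-1 t + y ^+ 2 * tpow x y K.-2 t).

Lemma is_derive_tpow1 x y K t : 0 < t ->
  is_derive t (1 : R) (tpow1 x y K) (tpow2 x y K t).
Proof.
move=> t0; have tn0 : t != 0 by rewrite gt_eqF.
have d1 := isdB (isdZ (- x) (is_derive_tpow x y K t0)) (isdZ y (is_derive_tpow x y K.-1 t0)).
apply: isd_ext (isdM (isdV (f := fun u => u) tn0 (isd_id t)) d1) _.
by rewrite /tpow2; field.
Qed.

(** Here t^-x <= 1, and the truncated exponential is at most exp(|y| ln t) <= t^(1/2). With |y| <=
    1/2 second derivatives are still O(t^(-3/2)), and uniformity in K permits the later interchange
    of limits. *)
Lemma tpow_le x y K t : 0 <= x -> `|y| <= 1 / 2 -> 1 <= t ->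
  `|tpow x y K t| <= expR (1 / 2 * ln t).
Proof.
move=> x0 y2 t1; have l0 := ln_ge0 t1.
rewrite /tpow normrM ger0_norm ?expR_ge0//.
rewrite -[leRHS]mul1r; apply: ler_pM; rewrite ?expR_ge0//.
  by rewrite -expR0 ler_expR oppr_le0 mulr_ge0.
apply: (le_trans (texp_le _ _)); rewrite ler_expR normrN normrM (ger0_norm l0).
by rewrite ler_wpM2r.
Qed.

Lemma tpow1_le x y K t : 0 <= x <= 2 -> `|y| <= 1 / 2 -> 1 <= t ->
  `|tpow1 x y K t| <= 3 * expR (- (1 / 2) * ln t).
Proof.
move=> /andP[x0 x2] y2 t1; have t0 : 0 < t := lt_le_trans ltr01 t1.
have ti : 0 <= t^-1 by rewrite invr_ge0 ltW.
have -> : - (1 / 2) * ln t = - ln t + 1 / 2 * ln t by field.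
rewrite expRD expRN lnK// mulrCA /tpow1 normrM (ger0_norm ti).
apply: ler_wpM2l => //.
set e := expR _.
have h K' : `|tpow x y K' t| <= e by exact: tpow_le.
have e0 : 0 <= e by exact: expR_ge0.
rewrite (le_trans (ler_normB _ _))// (normrM (- x)) (normrM y) normrN (ger0_norm x0).
have := ler_pM x0 (normr_ge0 _) x2 (h K).
have := ler_pM (normr_ge0 y) (normr_ge0 _) y2 (h K.-1).
lra.
Qed.

(** 9 = 6 + 5/2 + 1/2, the bounds for x + x^2, y + 2xy and y^2. *)
Lemma tpow2_le x y K t : 0 <= x <= 2 -> `|y| <= 1 / 2 -> 1 <= t ->
  `|tpow2 x y K t| <= 9 * expR (- (3 / 2) * ln t).
Proof.
move=> /andP[x0 x2] y2 t1; have t0 : 0 < t := lt_le_trans ltr01 t1.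
have ti : 0 <= t^-1 by rewrite invr_ge0 ltW.
have -> : - (3 / 2) * ln t = - ln t - ln t + 1 / 2 * ln t by field.
rewrite !expRD !expRN lnK// mulrCA /tpow2 normrM (ger0_norm (mulr_ge0 ti ti)).
apply: ler_wpM2l; first exact: mulr_ge0.
set e := expR _.
have h K' : `|tpow x y K' t| <= e by exact: tpow_le.
have e0 : 0 <= e by exact: expR_ge0.
rewrite (le_trans (ler_normD _ _))// (le_trans (lerD (ler_normD _ _) (lexx _)))//.
rewrite (normrM (x + x ^+ 2)) (normrM (y + 2 * x * y)) (normrM (y ^+ 2)).
have c1 : `|x + x ^+ 2| <= 6.
  rewrite ger0_norm ?addr_ge0 ?exprn_ge0//.
  by rewrite expr2; have := ler_pM x0 x0 x2 x2; lra.
have c2 : `|y + 2 * x * y| <= 5 / 2.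
  have -> : y + 2 * x * y = (1 + 2 * x) * y by ring.
  rewrite normrM ger0_norm; last by lra.
  by have := ler_pM (_ : 0 <= 1 + 2 * x) (normr_ge0 y) (_ : 1 + 2 * x <= 5) y2; lra.
have c3 : `|y ^+ 2| <= 1 / 2.
  rewrite normrX expr2; have := ler_pM (normr_ge0 y) (normr_ge0 y) y2 y2; lra.
have := ler_pM (normr_ge0 _) (normr_ge0 _) c1 (h K).
have := ler_pM (normr_ge0 _) (normr_ge0 _) c2 (h K.-1).
have := ler_pM (normr_ge0 _) (normr_ge0 _) c3 (h K.-2).
lra.
Qed.

Definition tpown x y K n := tpow x y K n%:R.

Lemma tpown_diff2_le x y K m : 0 <= x <= 2 -> `|y| <= 1 / 2 ->
  `|diff2 (tpown x y K) m| <= 9 * expR (- (3 / 2) * ln m.+1%:R).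
Proof.
move=> x02 y2; have m0 : (0 : R) < m.+1%:R by [].
have [t mt] := second_difference m0 (fun t => @is_derive_tpow x y K t)
  (fun t => @is_derive_tpow1 x y K t).
have -> : m.+1%:R + 2 = m.+3%:R :> R by rewrite -natrD addn2.
have -> : m.+1%:R + 1 = m.+2%:R :> R by rewrite natr1.
rewrite /diff2 /tpown => ->.
have t1 : 1 <= t by rewrite (le_trans _ mt)// ler1n.
apply: (le_trans (tpow2_le K x02 y2 t1)); rewrite ler_pM2l// ler_expR.
have : ln m.+1%:R <= ln t by rewrite ler_ln ?posrE// (lt_le_trans m0).
lra.
Qed.

Lemma tpown_diff1_le x y K m : 0 <= x <= 2 -> `|y| <= 1 / 2 ->
  `|tpown x y K m.+2 - tpown x y K m.+1| <= 3 * expR (- (1 / 2) * ln m.+1%:R).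
Proof.
move=> x02 y2; have m0 : (0 : R) < m.+1%:R by [].
have [|t /andP[mt _]] := mvt m0 _ (fun t => @is_derive_tpow x y K t) (y := m.+2%:R).
  by rewrite ler_nat.
have -> : m.+2%:R - m.+1%:R = 1 :> R by rewrite -natrB// subSnn.
rewrite mulr1 /tpown => ->.
have t1 : 1 <= t by rewrite (le_trans _ mt)// ler1n.
apply: (le_trans (tpow1_le K x02 y2 t1)); rewrite ler_pM2l// ler_expR.
have : ln m.+1%:R <= ln t by rewrite ler_ln ?posrE// (lt_le_trans m0).
lra.
Qed.

End Family.

(** * The limit of the truncations as an analytic function of s *)

Section Continuation.
Context {R : realType} (q : nat) (w : nat -> R).
Hypothesis q0 : (0 < q)%N.
Hypothesis w_period : forall n, w (n + q)%N = w n.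
Hypothesis w_sum0 : wsum w q = 0.
Implicit Types (x y : R) (k K n m : nat).

Let Psi n := wmean q w - wsum w n.

(* n-th value of the k-th Taylor coefficient of s |-> n^-s at x. *)
Definition tcoef x k n : R := expR (- (x * ln n%:R)) * ((- ln n%:R) ^+ k / k`!%:R).

Lemma tpownS x y K n : tpown x y K.+1 n = 1 * tpown x y K n + y ^+ K * tcoef x K n.
Proof.
rewrite /tpown /tpow texpS mulrDr mul1r; congr (_ + _).
by rewrite -(mulrN y) exprMn /tcoef; ring.
Qed.

Lemma exp_half_ln_cvg0 : (fun m => 3 * expR (- (1 / 2) * ln (m.+1%:R : R))) @ \oo --> (0 : R).
Proof.
apply/cvgrPdist_lt => e e0; near=> m.
rewrite sub0r normrN ger0_norm ?mulr_ge0 ?expR_ge0//.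
have e3 : 0 < e / 3 by rewrite divr_gt0.
rewrite mulrC -ltr_pdivlMr// -[ltRHS]lnK// ltr_expR.
suff : - 2 * ln (e / 3) < ln m.+1%:R by lra.
rewrite -[ltLHS]expRK ltr_ln ?posrE ?expR_gt0//.
apply: (@lt_trans _ _ m%:R); last by rewrite ltr_nat.
by near: m; exact: nbhs_infty_gtr.
Unshelve. all: by end_near. Qed.

Lemma diff1_cvg0 (g : R ^nat) :
  (forall m, `|g m.+2 - g m.+1| <= 3 * expR (- (1 / 2) * ln m.+1%:R)) ->
  (fun n => g n.+1 - g n) @ \oo --> (0 : R).
Proof.
move=> gle; rewrite -cvg_shiftS; apply/cvgrPdist_lt => e e0.
have /cvgrPdist_lt/(_ _ e0) := exp_half_ln_cvg0; apply: filterS => m.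
rewrite !sub0r !normrN; apply: le_lt_trans.
by rewrite (le_trans (gle m))// ler_norm.
Qed.

Lemma tpown_trunc_cvg x y K : 0 <= x <= 2 -> `|y| <= 1 / 2 ->
  wtrunc q w (tpown x y K) @ \oo --> wmean q w * tpown x y K 1 -
    limn (series (fun m => wsum Psi m.+1 * diff2 (tpown x y K) m)).
Proof.
move=> x02 y2; apply: (wtrunc_cvg q0 w_period w_sum0 (fun m => tpown_diff2_le K m x02 y2)).
  exact: three_halves_series.
by apply: diff1_cvg0 => m; exact: tpown_diff1_le.
Qed.

Definition wT x k : R := limn (wtrunc q w (tcoef x k)).

(** A single Taylor term is the difference of two consecutive truncations; at y = 1/2 the factor 2^k
    recovers its coefficient. *)
Lemma tcoef_trunc_cvg x k : 0 <= x <= 2 -> wtrunc q w (tcoef x k) @ \oo --> wT x k.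
Proof.
move=> x02; suff : cvgn (wtrunc q w (tcoef x k)) by [].
have y2 : `|1 / 2 : R| <= 1 / 2 by rewrite ger0_norm.
have -> : tcoef x k = fun n => 2 ^+ k * tpown x (1 / 2) k.+1 n + - 2 ^+ k * tpown x (1 / 2) k n.
  apply/funext => n; rewrite tpownS.
  have e : 2 ^+ k * (1 / 2) ^+ k = 1 :> R by rewrite -exprMn mul1r mulfV ?expr1n.
  transitivity (2 ^+ k * (1 / 2) ^+ k * tcoef x k n); first by rewrite e mul1r.
  move: ((1 / 2) ^+ k) => v; ring.
have -> : wtrunc q w (fun n => 2 ^+ k * tpown x (1 / 2) k.+1 n + - 2 ^+ k * tpown x (1 / 2) k n)
  = fun N => 2 ^+ k * wtrunc q w (tpown x (1 / 2) k.+1) N + - 2 ^+ k * wtrunc q w (tpown x (1 / 2) k) N.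
  by apply/funext => N; rewrite wtruncD.
by apply: is_cvgD; apply: is_cvgM; try exact: is_cvg_cst;
   apply/cvg_ex; eexists; exact: tpown_trunc_cvg.
Qed.

Lemma wT_sum x y K : 0 <= x <= 2 -> 
  wtrunc q w (tpown x y K) @ \oo --> \sum_(0 <= k < K) wT x k * y ^+ k.
Proof.
move=> x02; elim: K => [|K IH].
  rewrite big_geq//; have -> : wtrunc q w (tpown x y 0) = fun=> 0; last exact: cvg_cst.
  have t0 j : tpown x y 0 j = 0 by rewrite /tpown /tpow /texp big_geq// mulr0.
  apply/funext => N; rewrite /wtrunc t0 mulr0 addr0 big1// => j _.
  by rewrite t0 mulr0.
rewrite big_nat_recr//=.
have -> : tpown x y K.+1 = fun n => 1 * tpown x y K n + y ^+ K * tcoef x K n.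
  by apply/funext => n; exact: tpownS.
have -> : wtrunc q w (fun n => 1 * tpown x y K n + y ^+ K * tcoef x K n) =
   fun N => wtrunc q w (tpown x y K) N + y ^+ K * wtrunc q w (tcoef x K) N.
  by apply/funext => N; rewrite wtruncD mul1r.
apply: cvgD => //; rewrite mulrC; apply: cvgM; first exact: cvg_cst.
exact: tcoef_trunc_cvg.
Qed.

Definition wpow x n : R := expR (- (x * ln n%:R)).
Definition wF x : R := limn (wtrunc q w (wpow x)).

Lemma tpown_cvg x y n : tpown x y ^~ n @ \oo --> wpow (x + y) n.
Proof.
rewrite /wpow mulrDl opprD expRD; apply: cvgM; first exact: cvg_cst.
exact: texp_cvg.
Qed.

(** Two limits are interchanged, in the number N of summands and the number K of Taylor terms. For
    each K the limit in N is a series of second differences with a majorant independent of K, so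
    [tannery] applies. The bounds for [wpow] follow from those for [tpown] as K tends to
    infinity. *)
Lemma wF_power_series x y : 0 <= x <= 2 -> `|y| <= 1 / 2 ->
  [series wT x k * y ^+ k]_k @ \oo --> wF (x + y).
Proof.
move=> x02 y2.
have [B PB] := wsum_bounded q0 (Psi_period w_period w_sum0) (Psi_sum0 q0 w_sum0).
pose A m : R := 9 * expR (- (3 / 2) * ln (m.+1%:R : R)).
have B0 : 0 <= B := le_trans (normr_ge0 _) (PB 0).
have cA : cvgn (series A) by exact: three_halves_series.
have cBA : cvgn (series (fun m => B * A m)).
  have -> : series (fun m => B * A m) = fun n => B * series A n.
    by apply/funext => n; rewrite /series/= mulr_sumr.
  by apply: is_cvgM => //; exact: is_cvg_cst.
have lim_le (u : R ^nat) (l c : R) : u @ \oo --> l -> (forall n, `|u n| <= c) -> `|l| <= c.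
  move=> ul uc; have h : (fun n => `|u n|) @ \oo --> `|l| by exact: cvg_norm.
  rewrite -(cvg_lim _ h)//; apply: limr_le; first by apply/cvg_ex; exists `|l|.
  exact: nearW.
have cd2 m : (fun K => diff2 (tpown x y K) m) @ \oo --> diff2 (wpow (x + y)) m.
  apply: cvgD; last exact: tpown_cvg.
  by apply: cvgB; [exact: tpown_cvg|apply: cvgM; [exact: cvg_cst|exact: tpown_cvg]].
have cd1 m : (fun K => tpown x y K m.+2 - tpown x y K m.+1) @ \oo -->
    wpow (x + y) m.+2 - wpow (x + y) m.+1.
  by apply: cvgB; exact: tpown_cvg.
have wpow_cvg : wtrunc q w (wpow (x + y)) @ \oo --> wmean q w * wpow (x + y) 1 -
    limn (series (fun m => wsum Psi m.+1 * diff2 (wpow (x + y)) m)).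
  apply: (wtrunc_cvg q0 w_period w_sum0 (A := A)) => //.
    by move=> m; apply: lim_le (cd2 m) _ => K; exact: tpown_diff2_le.
  by apply: diff1_cvg0 => m; apply: lim_le (cd1 m) _ => K; exact: tpown_diff1_le.
rewrite /wF (cvg_lim _ wpow_cvg)//.
have -> : [series wT x k * y ^+ k]_k = fun K => wmean q w * tpown x y K 1 -
    limn (series (fun m => wsum Psi m.+1 * diff2 (tpown x y K) m)).
  apply/funext => K; rewrite -(cvg_lim _ (tpown_trunc_cvg (K := K) x02 y2))//.
  by rewrite (cvg_lim _ (wT_sum (y := y) (K := K) x02)).
apply: cvgB; first by apply: cvgM; [exact: cvg_cst|exact: tpown_cvg].
apply: (tannery (A := fun m => B * A m)) => //.
  move=> K m; rewrite normrM; apply: ler_pM => //; exact: tpown_diff2_le.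
by move=> m; apply: cvgM; [exact: cvg_cst|exact: cd2].
Qed.

(* The boundary term of [wtrunc] vanishes where the Dirichlet series converges. *)
Lemma wF_dirichlet x (l : R) : 0 < x ->
  [series w k.+1 * wpow x k.+1]_k @ \oo --> l -> wF x = l.
Proof.
move=> x0 wl; rewrite /wF; apply: cvg_lim => //.
have [S0 SB] := wsum_bounded q0 w_period w_sum0.
have -> : wtrunc q w (wpow x) = fun N => [series w k.+1 * wpow x k.+1]_k N + Psi N * wpow x N.
  by apply/funext => N; rewrite /wtrunc /series/= big_add1.
rewrite -[X in _ --> X]addr0; apply: cvgD => //.
pose B := `|wmean q w| + S0 + 1.
have B0 : 0 < B by rewrite ltr_pwDr// addr_ge0// (le_trans (normr_ge0 _) (SB 0)).
have PB n : `|Psi n| <= B.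
  by rewrite (le_trans (ler_normB _ _))// /B; have := SB n; lra.
apply/cvgrPdist_lt => e e0; near=> N.
rewrite sub0r normrN normrM (ger0_norm (expR_ge0 _)).
apply: (@le_lt_trans _ _ (B * wpow x N)); first by rewrite ler_wpM2r ?expR_ge0.
have eB : 0 < e / B by rewrite divr_gt0.
rewrite mulrC -ltr_pdivlMr// /wpow -[ltRHS]lnK// ltr_expR ltrNl [x * _]mulrC -ltr_pdivrMr//.
rewrite -[ltLHS]expRK ltr_ln ?posrE ?expR_gt0//.
  by near: N; exact: nbhs_infty_gtr.
rewrite ltr0n. near: N; exact: nbhs_infty_gt.
Unshelve. all: by end_near. Qed.

End Continuation.

(** * The identity theorem along the real axis *)

Section Identity.
Context {R : realType} (q : nat) (w : nat -> R).
Hypothesis q0 : (0 < q)%N.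
Hypothesis w_period : forall n, w (n + q)%N = w n.
Hypothesis w_sum0 : wsum w q = 0.
Variable l : R -> R.
Implicit Types (x y e rho : R).

Definition has_expansion (x : R) (a : R ^nat) (rho : R) := 0 < rho /\
  forall y : R, `|y| < rho -> [series a k * y ^+ k]_k @ \oo --> l (x + y).

(** From agreement to the right of x alone a left neighbourhood is gained: [wF] has its own
    expansion at x, valid for |y| <= 1/2, and one-sided uniqueness identifies the coefficients. *)
Lemma expansion_unique x a rho e : 0 <= x <= 2 -> has_expansion x a rho -> 0 < e ->
  (forall y, x < y < x + e -> l y = wF q w y) ->
  (forall k, a k = wT q w x k) /\
  exists2 d : R, 0 < d & forall y, `|y| < d -> l (x + y) = wF q w (x + y).
Proof.
move=> x02 [rho0 al] e0 lF.
have half0 : 0 < 1 / 2 :> R by [].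
pose d := Num.min rho (Num.min e (1 / 2)).
have d0 : 0 < d by rewrite !lt_min rho0 e0.
have dP (y : R) : `|y| < d -> [/\ `|y| < rho, `|y| < e & `|y| <= 1 / 2].
  by rewrite !lt_min => /and3P[-> -> /ltW].
have aE k : a k = wT q w x k.
  apply/eqP; rewrite -subr_eq0; apply/eqP.
  apply: (power_series_eq0 (c := fun k => a k - wT q w x k) d0) => y /andP[y0 yd].
  have [|y1 y2 y3] := dP y; first by rewrite gtr0_norm.
  have -> : [series (a k - wT q w x k) * y ^+ k]_k =
     fun n => [series a k * y ^+ k]_k n - [series wT q w x k * y ^+ k]_k n.
    apply/funext => n; rewrite /series/= -sumrB; apply: eq_bigr => i _.
    by rewrite mulrBl.
  rewrite -[X in _ --> X](subrr (l (x + y))); apply: cvgB; first exact: al.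
  rewrite lF; first exact: wF_power_series.
  by rewrite ltrDl y0 ltrD2l; rewrite gtr0_norm in y2.
split=> //; exists d => // y /dP[y1 y2 y3].
have h1 := al y y1; have h2 := wF_power_series q0 w_period w_sum0 x02 y3.
have e12 : [series a k * y ^+ k]_k = [series wT q w x k * y ^+ k]_k.
  by apply/funext => n; rewrite /series/=; apply: eq_bigr => i _; rewrite aE.
by rewrite e12 in h1; exact: (cvg_unique (@norm_hausdorff _ _) h1 h2).
Qed.

Hypothesis l_expansion : forall x, exists a rho, has_expansion x a rho.
Hypothesis l_dirichlet : forall x, 1 < x -> l x = wF q w x.

(** Let m be the infimum of the points beyond which l and [wF] agree. They agree to the right of m,
    hence around m, which contradicts minimality unless m = 0. The set is confined to [0, 2], where
    expansions of [wF] are available. *)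
Lemma continuation y : 0 < y -> l y = wF q w y.
Proof.
pose A : set R := [set x | 0 <= x <= 2 /\ forall y, x < y -> l y = wF q w y].
have A1 : A 1 by split; [lra|exact: l_dirichlet].
have lbA : has_lbound A by exists 0 => x [/andP[]].
have hA : has_inf A by split => //; exists 1.
set m := inf A.
have m0 : 0 <= m by apply: lb_le_inf; [exists 1|move=> x [/andP[]]].
have m1 : m <= 1 by exact: ge_inf.
have mP z : m < z -> l z = wF q w z.
  move=> mz; have [|x [_ xP] xz] := inf_adherent (_ : 0 < z - m) hA.
    by rewrite subr_gt0.
  by apply: xP; rewrite addrC subrK in xz.
have [a [rho ar]] := l_expansion m.
have m02 : 0 <= m <= 2 by lra.
have mP1 z : m < z < m + 1 -> l z = wF q w z by move=> /andP[mz _]; exact: mP.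
have [_ [d d0 dP]] := expansion_unique m02 ar ltr01 mP1.
have m_eq0 : m = 0.
  apply/eqP; rewrite eq_le m0 andbT leNgt; apply/negP => m_gt0.
  (* Moving by d/2 stays inside the interval of agreement; the maximum keeps x in [0, 2]. *)
  pose x := Num.max 0 (m - d / 2).
  have xm : x < m by rewrite gt_max m_gt0 /=; lra.
  have : A x.
    split; first by rewrite le_max lexx/= ge_max; lra.
    move=> z xz; have [mz|zm] := ltP m z; first exact: mP.
    have dz : m - d / 2 < z by apply: le_lt_trans xz; rewrite le_max lexx orbT.
    by rewrite -(subrK m z) addrC; apply: dP; rewrite ltr_norml; lra.
  by move=> /(ge_inf lbA); rewrite leNgt xm.
by move=> y0; apply: mP; rewrite m_eq0.
Qed.

(** At x = 0 agreement to the right still determines the coefficients, which gives access to the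
    derivatives at s = 0. *)
Lemma expansion_coef x a rho : 0 <= x <= 2 -> has_expansion x a rho ->
  forall k, a k = wT q w x k.
Proof.
move=> x02 ax; suff xP y : x < y < x + 1 -> l y = wF q w y.
  by have [] := expansion_unique x02 ax ltr01 xP.
by move=> /andP[xy _]; apply: continuation; apply: le_lt_trans xy; case/andP: x02.
Qed.

End Identity.

(** * Derivatives of L as limits of truncations *)

Section DirichletL.
Context {R : realType} (q : nat) (chi : nat -> R[i]) (L : R[i] -> R[i]).
Hypothesis q0 : (0 < q)%N.
Hypothesis chi_period : forall n, chi (n + q)%N = chi n.
Hypothesis chi_sum0 : \sum_(1 <= a < q.+1) chi a = 0.
Hypothesis L_chi : is_dirichlet_L chi L.

(* [p] is a real coordinate of R[i]: Re or Im. *)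
Variable p : R[i] -> R.
Hypothesis pD : forall a b, p (a + b) = p a + p b.
Hypothesis pM : forall a (t : R), p (a * t%:C) = p a * t.
Hypothesis p_cvg : forall (u : nat -> R[i]) l, u @ \oo --> l -> (p \o u) @ \oo --> p l.

Let w n := p (chi n).

Lemma coordinate0 : p 0 = 0.
Proof. by have := pM 0 0; rewrite mul0r mulr0. Qed.

Lemma coordinate_sum (I : Type) (r : seq I) (P : pred I) (F : I -> R[i]) :
  p (\sum_(i <- r | P i) F i) = \sum_(i <- r | P i) p (F i).
Proof. exact: (big_morph p pD coordinate0). Qed.

Lemma cexp_real (t : R) : cexp t%:C = (expR t)%:C.
Proof. by rewrite /cexp/= cos0 sin0 mulr0 addr0 mulr1. Qed.

Lemma w_sum0 : wsum w q = 0.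
Proof. by rewrite /wsum -coordinate_sum chi_sum0 coordinate0. Qed.

Let w_period n : w (n + q)%N = w n. Proof. by rewrite /w chi_period. Qed.

Let l (x : R) := p (L x%:C).

Lemma L_expansion (x : R) a rho M : power_series_on L x%:C a rho M ->
  has_expansion l x (p \o a) rho.
Proof.
move=> [rho0 _ La]; split=> // y yrho.
have -> : [series (p \o a) k * y ^+ k]_k = p \o [series a k * y%:C ^+ k]_k.
  apply/funext => n; rewrite /= /series/= coordinate_sum; apply: eq_bigr => k _.
  by rewrite -real_complexX pM.
rewrite /l real_complexD; apply: p_cvg.
by apply: La; rewrite normc_real ltcR.
Qed.

(** L^(r)(x)/r! is a Taylor coefficient of L, hence has coordinate [wT]; the factor (-1)^r r! turns
    [tcoef] into n^-x ln^r n. *)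
Lemma L_derivative_trunc (x : R) (r : nat) : 0 <= x <= 2 ->
  wtrunc q w (fun n => expR (- (x * ln n%:R)) * ln n%:R ^+ r) @ \oo -->
  p ((-1) ^+ r * (L^`(r))%classic x%:C).
Proof.
move=> x02; case: L_chi => Lan Ldir.
have [a aL] := Lan x%:C.
rewrite (power_series_derive1n r aL).
have [rho [M aM]] := power_series_onE aL.
have l_exp (y : R) : exists b rho', has_expansion l y b rho'.
  have [b /power_series_onE[rho' [M' bM]]] := Lan y%:C.
  by exists (p \o b), rho'; exact: L_expansion bM.
have l_dir y : 1 < y -> l y = wF q w y.
  move=> y1; apply/esym; apply: (wF_dirichlet q0 w_period w_sum0 (lt_trans ltr01 y1)).
  have -> : [series w k.+1 * wpow y k.+1]_k =
      p \o [series chi k.+1 * cexp (- y%:C * (ln k.+1%:R)%:C)]_k; last exact: p_cvg (Ldir y%:C y1).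
  apply/funext => n; rewrite /= /series/= coordinate_sum; apply: eq_bigr => k _.
  by rewrite mulNr -real_complexM -real_complexN cexp_real pM.
have := expansion_coef q0 w_period w_sum0 l_exp l_dir x02 (L_expansion aM) r.
rewrite /= => ar.
have -> : p ((-1) ^+ r * (r`!%:R * a r)) = (-1) ^+ r * r`!%:R * wT q w x r.
  rewrite -ar [RHS]mulrC -pM; congr p.
  by rewrite real_complexM real_complexX real_complexN real_complex_nat; ring.
have h := tcoef_trunc_cvg q0 w_period w_sum0 (k := r) x02.
(* The summand 0 * 0 supplies the two-term shape expected by [wtruncD]. *)
have -> : (fun n => expR (- (x * ln n%:R)) * ln n%:R ^+ r) =
    (fun n => (-1) ^+ r * r`!%:R * tcoef x r n + 0 * 0).
  apply/funext => n; rewrite /tcoef (exprNn (ln n%:R)) mulr0 addr0.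
  have f0 : (r`!%:R : R) != 0 by rewrite pnatr_eq0 -lt0n fact_gt0.
  have s1 : (-1) ^+ r * (-1) ^+ r = 1 :> R by rewrite -exprMn mulrNN mulr1 expr1n.
  transitivity ((-1) ^+ r * (-1) ^+ r * (expR (- (x * ln n%:R)) * ln n%:R ^+ r)).
    by rewrite s1 mul1r.
  move: ((-1) ^+ r) (r`!%:R : R) f0 (ln _ ^+ r) => u v v0 z; field.
  exact: v0.
have -> : wtrunc q w (fun n => (-1) ^+ r * r`!%:R * tcoef x r n + 0 * 0) =
   fun N => (-1) ^+ r * r`!%:R * wtrunc q w (tcoef x r) N.
  by apply/funext => N; rewrite (wtruncD _ _ _ (fun=> 0)) mul0r addr0.
by apply: cvgM => //; exact: cvg_cst.
Qed.

End DirichletL.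

(** * Powers of the logarithm *)

Section LogPowers.
Context {R : realType} (q : nat).
Hypothesis q0 : (0 < q)%N.
Implicit Types (u v c M B : R) (D : R -> R) (k p : nat).

Let qR : (0 : R) < q%:R. Proof. by rewrite ltr0n. Qed.

Definition lnpow k p u : R := ln (q%:R * u) ^+ k / u ^+ p.

(** No derivative is taken: with v = u e^d and a = ln(q u), (1 + d/a)^k <= e^(k d/a) <= e^(p d), the
    last step by k <= p a. *)
Lemma lnpow_noninc k p u v : 0 < u -> u <= v -> 0 < ln (q%:R * u) ->
  k%:R <= p%:R * ln (q%:R * u) -> lnpow k p v <= lnpow k p u.
Proof.
move=> u0 uv a0 ka; have v0 := lt_le_trans u0 uv.
set a := ln (q%:R * u) in a0 ka *; pose d := ln v - ln u.
have d0 : 0 <= d by rewrite subr_ge0 ler_ln ?posrE.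
have -> : lnpow k p v = (a + d) ^+ k / v ^+ p.
  by rewrite /lnpow /a /d !lnM ?posrE//; congr (_ ^+ _ / _); ring.
have vE : v = u * expR d by rewrite /d expRB !lnK ?posrE// mulrCA mulfV ?gt_eqF// mulr1.
have pos1 : 0 <= a^-1 * d by rewrite mulr_ge0// invr_ge0 ltW.
have -> : a + d = a * (1 + a^-1 * d) by field; rewrite gt_eqF.
have key : (1 + a^-1 * d) ^+ k <= expR d ^+ p.
  apply: (@le_trans _ _ (expR (a^-1 * d) ^+ k)).
    by rewrite lerXn2r ?nnegrE ?expR_ge0 ?addr_ge0// expR_ge1Dx.
  rewrite -!expRM_natl ler_expR mulrA; apply: ler_wpM2r => //.
  by rewrite ler_pdivrMr.
rewrite /lnpow -/a vE !exprMn invfM mulrACA.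
apply: ler_piMr; first by rewrite divr_ge0// exprn_ge0// ltW.
by rewrite ler_pdivrMr ?exprn_gt0 ?expR_gt0// mul1r.
Qed.

Lemma lnpow_ge0 k p u : 0 < u -> 0 <= ln (q%:R * u) -> 0 <= lnpow k p u.
Proof. by move=> u0 a0; rewrite divr_ge0 ?exprn_ge0// ltW. Qed.

(** For y = e^s/q one has ln(q y) = s, and s^(k+1)/(k+1)! <= e^s bounds q s^k/e^s by q (k+1)!/s. The
    three summands of s secure y >= c, y >= 1 (which reduces p to 1) and a value at most e. *)
Lemma lnpow_small k p c e : 0 < c -> (0 < p)%N -> 0 < e ->
  exists2 y : R, c <= y & lnpow k p y <= e.
Proof.
move=> c0 p0 e0; pose A := q%:R * k.+1`!%:R / e.
have A0 : 0 < A by rewrite divr_gt0// mulr_gt0// ltr0n fact_gt0.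
have lq : 0 <= ln (q%:R : R) by rewrite ln_ge0// ler1n.
pose s := `|ln (q%:R * c)| + ln (q%:R : R) + A.
have s0 : 0 < s by rewrite ltr_wpDl// addr_ge0.
have s1 : ln (q%:R * c) <= s.
  by rewrite (le_trans (ler_norm _))// /s -addrA lerDl addr_ge0// ltW.
have s2 : ln (q%:R : R) <= s by rewrite /s addrAC lerDr addr_ge0// ltW.
have s3 : A <= s by rewrite /s lerDr addr_ge0.
have qy : q%:R * (expR s / q%:R) = expR s by field; rewrite gt_eqF.
have cy : c <= expR s / q%:R.
  rewrite ler_pdivlMr// mulrC -[leLHS]lnK ?posrE ?mulr_gt0//.
  by rewrite ler_expR.
have y1 : 1 <= expR s / q%:R.
  by rewrite ler_pdivlMr// mul1r -[leLHS]lnK ?posrE// ler_expR.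
exists (expR s / q%:R) => //; rewrite /lnpow qy expRK.
have y0 : 0 < expR s / q%:R by exact: lt_le_trans y1.
have fact_exp : s ^+ k.+1 / k.+1`!%:R <= expR s.
  by apply: le_trans (expR_ge1Dxn k (ltW s0)); rewrite lerDr.
apply: (@le_trans _ _ (s ^+ k / (expR s / q%:R))).
  apply: ler_wpM2l; first by rewrite exprn_ge0// ltW.
  rewrite lef_pV2 ?posrE ?exprn_gt0//.
  by rewrite -[leLHS]expr1; apply: ler_weXn2l.
rewrite ler_pdivrMr// mulrCA.
have f0 : 0 < (k.+1`!%:R : R) by rewrite ltr0n fact_gt0.
have h1 : s ^+ k * A <= s ^+ k * s by rewrite ler_wpM2l// exprn_ge0// ltW.
have h2 : s ^+ k * A <= expR s * k.+1`!%:R.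
  by rewrite (le_trans h1)// -exprSr -ler_pdivrMr.
have : s ^+ k * A * (e / (q%:R * k.+1`!%:R)) <= expR s * k.+1`!%:R * (e / (q%:R * k.+1`!%:R)).
  by rewrite ler_wpM2r// divr_ge0 ?mulr_ge0// ltW.
have -> : s ^+ k * A * (e / (q%:R * k.+1`!%:R)) = s ^+ k.
  by rewrite /A; field; rewrite !gt_eqF.
have -> // : expR s * k.+1`!%:R * (e / (q%:R * k.+1`!%:R)) = expR s * (e / q%:R).
by field; rewrite !gt_eqF.
Qed.

Lemma isd_lnpow k p u : 0 < u -> exists d, is_derive u (1 : R) (lnpow k p) d.
Proof.
move=> u0; have un0 : u ^+ p != 0 by rewrite gt_eqF// exprn_gt0.
have qu0 : 0 < q%:R * u by rewrite mulr_gt0.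
eexists; exact: isdM (isdX k (isd_ln (f := fun u => q%:R * u) qu0 (isdZ q%:R (isd_id u))))
   (isdV (f := fun u => u ^+ p) un0 (isdX p (isd_id u))).
Qed.

Lemma lnpow_continuous k p u : 0 < u -> {for u, continuous (lnpow k p)}.
Proof.
move=> u0; apply/differentiable_continuous/derivable1_diffP.
by have [d []] := isd_lnpow k p u0.
Qed.

Lemma improper_lnpow D c c0 k p M B : 0 < c -> c <= c0 -> (0 < p)%N ->
  (forall y, bmeas D c y) -> (forall u, c <= u -> `|D u| <= M) ->
  (forall x v, c <= x -> x <= v -> `|int_upto D x v| <= B) ->
  0 < ln (q%:R * c0) -> k%:R <= p%:R * ln (q%:R * c0) ->
  improper_cvg (fun u => D u * lnpow k p u) c /\
  `|improper_int (fun u => D u * lnpow k p u) c - int_upto (fun u => D u * lnpow k p u) c c0|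
    <= B * lnpow k p c0.
Proof.
move=> c_gt0 cc0 p0 bD DM DB ln0 kp; have c00 := lt_le_trans c_gt0 cc0.
have ln_mono u : c0 <= u -> ln (q%:R * c0) <= ln (q%:R * u).
  move=> cu; rewrite ler_ln ?posrE ?mulr_gt0// ?(lt_le_trans c00)//.
  by rewrite ler_wpM2l// ltW.
apply: (improper_dirichlet cc0 bD _ DM DB).
- move=> y; apply: (bmeas_pos (k := lnpow k p)) c_gt0 => u u0.
  exact: lnpow_continuous.
- move=> u v cu uv; apply: lnpow_noninc => //; first exact: lt_le_trans cu.
    exact: lt_le_trans (ln_mono _ cu).
  by rewrite (le_trans kp)// ler_wpM2l// ln_mono.
- move=> u cu; apply: lnpow_ge0; first exact: lt_le_trans cu.
  exact: le_trans (ltW ln0) (ln_mono _ cu).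
- by move=> e e0; exact: lnpow_small.
Qed.

Lemma improper_lnpow_cvg D c k p M B : 0 < c -> (0 < p)%N ->
  (forall y, bmeas D c y) -> (forall u, c <= u -> `|D u| <= M) ->
  (forall x v, c <= x -> x <= v -> `|int_upto D x v| <= B) ->
  improper_cvg (fun u => D u * lnpow k p u) c.
Proof.
(* At c1 the logarithm is at least k + 1, hence positive even for k = 0, and [lnpow] decreases from
   there on. *)
move=> c0 p0 bD DM DB; pose c1 := Num.max c (expR k.+1%:R / q%:R).
have cc1 : c <= c1 by rewrite le_max lexx.
have lnc1 : k.+1%:R <= ln (q%:R * c1).
  have qc1 : 0 < q%:R * c1 by rewrite mulr_gt0// (lt_le_trans c0).
  rewrite -[leLHS]expRK ler_ln ?posrE ?expR_gt0//.
  by rewrite mulrC -ler_pdivrMr// le_max lexx orbT.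
have l0 : 0 < ln (q%:R * c1) by apply: lt_le_trans lnc1.
have kp : k%:R <= p%:R * ln (q%:R * c1).
  apply: (@le_trans _ _ (1 * ln (q%:R * c1))).
    by rewrite mul1r (le_trans _ lnc1)// ler_nat.
  by apply: ler_wpM2r; [exact: ltW|rewrite ler1n].
by have [] := improper_lnpow c0 cc1 p0 bD DM DB l0 kp.
Qed.

Lemma improper_lnpow_le D c k p M B : 0 < c -> (0 < p)%N ->
  (forall y, bmeas D c y) -> (forall u, c <= u -> `|D u| <= M) ->
  (forall x v, c <= x -> x <= v -> `|int_upto D x v| <= B) ->
  0 < ln (q%:R * c) -> k%:R <= p%:R * ln (q%:R * c) ->
  `|improper_int (fun u => D u * lnpow k p u) c| <= B * lnpow k p c.
Proof.
move=> c0 p0 bD DM DB ln0 kp.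
have [_] := improper_lnpow c0 (lexx c) p0 bD DM DB ln0 kp.
by rewrite /int_upto set_itv1 Rintegral_set1 subr0.
Qed.

End LogPowers.

(** * Integrals of a single shifted sawtooth *)

Section SawtoothIntegrals.
Context {R : realType}.
Implicit Types (b x v : R).

Lemma sawQ_bound x : `|sawQ x| <= 8^-1.
Proof.
have := floor_itv x; rewrite intrD => /andP[h1 h2].
rewrite /sawQ; set t := x - _; have t0 : 0 <= t by rewrite /t; lra.
have t1 : t <= 1 by rewrite /t; lra.
have e : (t - 2^-1) ^+ 2 = t ^+ 2 - t + 4^-1 by field.
have := sqr_ge0 (t - 2^-1); rewrite e => sq.
have tt : t ^+ 2 <= t by rewrite expr2 ler_piMr.
by rewrite ler_norml; apply/andP; split; lra.
Qed.

Lemma int_psi_bound b x v : x <= v -> `|int_upto (fun u => psi (u - b)) x v| <= 1.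
Proof.
move=> xv; rewrite int_psi// (le_trans (ler_normB _ _))//.
by have := sawQ_bound (v - b); have := sawQ_bound (x - b); lra.
Qed.

Lemma psi_lnpow_cvg (q k p : nat) b c : (0 < q)%N -> 0 < c -> (0 < p)%N ->
  improper_cvg (fun u => psi (u - b) * lnpow q k p u) c.
Proof.
move=> q0 c0 p0; apply: (@improper_lnpow_cvg _ _ q0 _ c k p 2^-1 1) => //.
- by move=> y; exact: bmeas_psi.
- by move=> u _; exact: psi_bound.
- by move=> x v _; exact: int_psi_bound.
Qed.

End SawtoothIntegrals.

(** * The formulas and their remainders *)

Section Formula.
Context {R : realType} (q : nat) (chi : nat -> R[i]) (L : R[i] -> R[i]).
Hypothesis q3 : (3 <= q)%N.
Hypothesis prim : primitive_character q chi.
Hypothesis L_chi : is_dirichlet_L chi L.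

Let q0 : (0 < q)%N. Proof. by lia. Qed.
Let q1 : (1 < q)%N. Proof. by lia. Qed.
Let qR : (0 : R) < q%:R. Proof. by rewrite ltr0n. Qed.
Let chiD : dirichlet_character q chi. Proof. by case: prim. Qed.

Lemma chi_period n : chi (n + q)%N = chi n. Proof. by case: chiD. Qed.

Lemma chi_sum_period : \sum_(1 <= a < q.+1) chi a = 0.
Proof.
have := chi_sum0 q1 prim; rewrite -(big_mkord xpredT) big_ltn// => s0.
have cq : chi q = chi 0 := chi_period 0.
by rewrite big_nat_recr//= cq addrC.
Qed.

(** Common shape of the derivatives of the weights: two powers of the logarithm over u^2 for s = 1,
    one over u for s = 0, with a2 = 0. *)
Definition kern (a1 : R) k1 (a2 : R) k2 m u := a1 * lnpow q k1 m u + a2 * lnpow q k2 m u.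

Lemma kern_cvg (D : R -> R) c a1 k1 a2 k2 m : 0 < c -> (forall y, bmeas D c y) ->
  (forall k, improper_cvg (fun u => D u * lnpow q k m u) c) ->
  improper_cvg (fun u => D u * kern a1 k1 a2 k2 m u) c /\
  improper_int (fun u => D u * kern a1 k1 a2 k2 m u) c =
    a1 * improper_int (fun u => D u * lnpow q k1 m u) c +
    a2 * improper_int (fun u => D u * lnpow q k2 m u) c.
Proof.
move=> c0 bD cD; have bl k y : bmeas (fun u => D u * lnpow q k m u) c y.
  apply: bmeasM (bD y) (bmeas_pos _ _ c0) => u u0; exact: lnpow_continuous.
have -> : (fun u => D u * kern a1 k1 a2 k2 m u) =
    (fun u => a1 * (D u * lnpow q k1 m u) + a2 * (D u * lnpow q k2 m u)).
  by apply/funext => u; rewrite /kern; ring.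
exact: improper_lincomb.
Qed.

Lemma psi_kern_cvg b c a1 k1 a2 k2 m : 0 < c -> (0 < m)%N ->
  improper_cvg (fun u => psi (u - b) * kern a1 k1 a2 k2 m u) c /\
  improper_int (fun u => psi (u - b) * kern a1 k1 a2 k2 m u) c =
    a1 * improper_int (fun u => psi (u - b) * lnpow q k1 m u) c +
    a2 * improper_int (fun u => psi (u - b) * lnpow q k2 m u) c.
Proof.
move=> c0 m0; apply: kern_cvg => // [y|k]; first exact: bmeas_psi.
exact: psi_lnpow_cvg.
Qed.

Lemma kern_continuous a1 k1 a2 k2 m (u : R) : 0 < u -> {for u, continuous (kern a1 k1 a2 k2 m)}.
Proof.
move=> u0; apply: cvgD; apply: cvgM; [exact: cvg_cst| |exact: cvg_cst|];
  exact: lnpow_continuous.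
Qed.

Section Coordinate.
Variable p : R[i] -> R.
Hypothesis pD : forall a b, p (a + b) = p a + p b.
Hypothesis pM : forall a (t : R), p (a * t%:C) = p a * t.
Hypothesis p_cvg : forall (u : nat -> R[i]) l, u @ \oo --> l -> (p \o u) @ \oo --> p l.
Hypothesis p_le : forall z (c : R), `|z| <= c%:C -> `|p z| <= c.

Let w n := p (chi n).
Let w_period n : w (n + q)%N = w n. Proof. by rewrite /w chi_period. Qed.
Let ws0 : wsum w q = 0. Proof. exact: (w_sum0 chi_sum_period pD pM). Qed.

Definition pv_bound : R := 8 * (Num.sqrt q%:R * ln q%:R).

Lemma wsum_pv n : `|wsum w n| <= pv_bound.
Proof.
rewrite /wsum -(coordinate_sum pD pM); apply: p_le.
exact: polya_vinogradov.
Qed.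

Section WithKernel.
Variables (x : R) (r : nat) (G : R -> R) (a1 a2 : R) (k1 k2 m : nat).
Hypothesis x02 : 0 <= x <= 2.
Hypothesis m0 : (0 < m)%N.
Hypothesis G_nat : forall j : nat, G (j%:R / q%:R) = expR (- (x * ln j%:R)) * ln j%:R ^+ r.
Hypothesis dG : forall u : R, 0 < u -> is_derive u (1 : R) G (kern a1 k1 a2 k2 m u).

Lemma wpsi_kern (c : R) : 0 < c ->
  improper_cvg (fun u => wpsi q w u * kern a1 k1 a2 k2 m u) c /\
  improper_int (fun u => wpsi q w u * kern a1 k1 a2 k2 m u) c =
  \sum_(1 <= a < q.+1) w a * improper_int (fun u => psi (u - a%:R / q%:R) * kern a1 k1 a2 k2 m u) c.
Proof.
move=> c0; have -> : (fun u => wpsi q w u * kern a1 k1 a2 k2 m u) =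
    (fun u => \sum_(1 <= a < q.+1) w a * (psi (u - a%:R / q%:R) * kern a1 k1 a2 k2 m u)).
  by apply/funext => u; rewrite /wpsi mulr_suml; apply: eq_bigr => a _; rewrite mulrA.
apply: (@improper_sum R nat _ _ (fun (a : nat) u => psi (u - a%:R / q%:R) * kern a1 k1 a2 k2 m u)).
  move=> a z; apply: bmeasM (bmeas_psi _ _ _) (bmeas_pos _ _ c0) => u u0.
  exact: kern_continuous.
by move=> a; have [] := psi_kern_cvg (a%:R / q%:R) a1 k1 a2 k2 c0 m0.
Qed.

(** The same truncations have one limit computed by Abel summation from X and another by
    continuation from L; the formula is their equality. *)
Lemma coord_formula (X : R) : 0 < X ->
  p ((-1) ^+ r * (L^`(r))%classic x%:C) =
  \sum_(1 <= j < (Num.truncn X).+1) w j * G (j%:R / q%:R)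
   + wpsi q w (X / q%:R) * G (X / q%:R)
   + improper_int (fun u => wpsi q w u * kern a1 k1 a2 k2 m u) (X / q%:R).
Proof.
move=> X0; have c0 : 0 < X / q%:R by rewrite divr_gt0.
have [cw _] := wpsi_kern c0.
have h1 := wpartial_cvg q0 w_period ws0 dG (fun u => @kern_continuous a1 k1 a2 k2 m u) X0 cw.
have h2 := L_derivative_trunc q0 chi_period chi_sum_period L_chi pD pM p_cvg (r := r) x02.
have e : wpartial q w G = wtrunc q w (fun n => expR (- (x * ln n%:R)) * ln n%:R ^+ r).
  by apply/funext => N; rewrite /wpartial /wtrunc G_nat;
    congr (_ + _); apply: eq_bigr => j _; rewrite G_nat.
by rewrite e in h1; exact: (cvg_unique (@norm_hausdorff _ _) h2 h1).
Qed.

(** The Polya-Vinogradov bound enters twice with the same factor 2: for the sawtooth sum in the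
    boundary term, and for its integrals in Dirichlet's test, used for each power of the logarithm
    separately. The conditions on k1 and k2 make these powers decrease. *)
Lemma coord_remainder (c : R) : 0 < c -> 0 < ln (q%:R * c) ->
  k1%:R <= m%:R * ln (q%:R * c) -> k2%:R <= m%:R * ln (q%:R * c) ->
  `|wpsi q w c * G c + improper_int (fun u => wpsi q w u * kern a1 k1 a2 k2 m u) c|
  <= 2 * pv_bound * (`|G c| + `|a1| * lnpow q k1 m c + `|a2| * lnpow q k2 m c).
Proof.
move=> c0 lnc hk1 hk2.
have DM (u : R) : c <= u -> `|wpsi q w u| <= 2 * pv_bound.
  move=> cu; apply: (wpsi_bound q0 w_period ws0 wsum_pv).
  by rewrite ltW// (lt_le_trans c0).
have DB (y v : R) : c <= y -> y <= v -> `|int_upto (wpsi q w) y v| <= 2 * pv_bound.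
  move=> cy yv; apply: (int_wpsi_bound q0 w_period ws0 wsum_pv) yv.
  by rewrite ltW// (lt_le_trans c0).
have bw y : bmeas (wpsi q w) c y by exact: bmeas_wpsi.
have [_ ->] : _ /\ _ := kern_cvg a1 k1 a2 k2 c0 bw
  (fun k => improper_lnpow_cvg q0 (k := k) c0 m0 bw DM DB).
have i1 := improper_lnpow_le q0 c0 m0 bw DM DB lnc hk1.
have i2 := improper_lnpow_le q0 c0 m0 bw DM DB lnc hk2.
rewrite !mulrDr -addrA (le_trans (ler_normD _ _))// lerD//.
  by rewrite normrM ler_wpM2r// DM.
rewrite (le_trans (ler_normD _ _))// lerD// normrM mulrCA ler_wpM2l//.
Qed.

End WithKernel.
End Coordinate.

End Formula.

(** * Recombination of real and imaginary parts *)

Section ComplexFormula.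
Context {R : realType} (q : nat) (chi : nat -> R[i]) (L : R[i] -> R[i]).
Hypothesis q3 : (3 <= q)%N.
Hypothesis prim : primitive_character q chi.
Hypothesis L_chi : is_dirichlet_L chi L.
Implicit Types (a b z : R[i]) (t c X : R).

Let qR : (0 : R) < q%:R. Proof. by rewrite ltr0n; lia. Qed.

Lemma ReD a b : Re (a + b) = Re a + Re b. Proof. by case: a; case: b. Qed.
Lemma ImD a b : Im (a + b) = Im a + Im b. Proof. by case: a; case: b. Qed.
Lemma ReM a t : Re (a * t%:C) = Re a * t.
Proof. by case: a => u v /=; rewrite mulr0 subr0. Qed.
Lemma ImM a t : Im (a * t%:C) = Im a * t.
Proof. by case: a => u v /=; rewrite mulr0 add0r. Qed.
Lemma eq_ReIm a b : Re a = Re b -> Im a = Im b -> a = b.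
Proof. by case: a => ? ?; case: b => ? ? /= -> ->. Qed.

Variables (x : R) (r : nat) (G : R -> R) (a1 a2 : R) (k1 k2 m : nat).
Hypothesis x02 : 0 <= x <= 2.
Hypothesis m0 : (0 < m)%N.
Hypothesis G_nat : forall j : nat, G (j%:R / q%:R) = expR (- (x * ln j%:R)) * ln j%:R ^+ r.
Hypothesis dG : forall u : R, 0 < u -> is_derive u (1 : R) G (kern q a1 k1 a2 k2 m u).

Lemma derivative_formula X : 0 < X ->
  (-1) ^+ r * (L^`(r))%classic x%:C =
  \sum_(1 <= j < (Num.truncn X).+1) chi j * (G (j%:R / q%:R))%:C
  + \sum_(1 <= a < q.+1) chi a * (psi ((X - a%:R) / q%:R) * G (X / q%:R)
     + improper_int (fun u => psi (u - a%:R / q%:R) * kern q a1 k1 a2 k2 m u) (X / q%:R))%:C.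
Proof.
move=> X0; have c0 : 0 < X / q%:R by rewrite divr_gt0.
have coord p (pD : forall a b, p (a + b) = p a + p b)
    (pM : forall a (t : R), p (a * t%:C) = p a * t)
    (p_cvg : forall (u : nat -> R[i]) l, u @ \oo --> l -> (p \o u) @ \oo --> p l)
    (p_le : forall z (c : R), `|z| <= c%:C -> `|p z| <= c) :
  p ((-1) ^+ r * (L^`(r))%classic x%:C) =
  p (\sum_(1 <= j < (Num.truncn X).+1) chi j * (G (j%:R / q%:R))%:C
  + \sum_(1 <= a < q.+1) chi a * (psi ((X - a%:R) / q%:R) * G (X / q%:R)
     + improper_int (fun u => psi (u - a%:R / q%:R) * kern q a1 k1 a2 k2 m u) (X / q%:R))%:C).
  rewrite (coord_formula q3 prim L_chi pD pM p_cvg x02 m0 G_nat dG X0).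
  rewrite (wpsi_kern chi q3 p a1 a2 k1 k2 m0 c0).2 /wpsi mulr_suml -addrA -big_split/=.
  rewrite pD !(coordinate_sum pD pM); congr (_ + _); apply: eq_bigr => j _; rewrite pM//.
  by rewrite [RHS]mulrDr [in RHS]mulrA mulrBl.
by apply: eq_ReIm; apply: coord;
  [exact: ReD|exact: ReM|exact: cvg_Re|exact: normc_Re_le
  |exact: ImD|exact: ImM|exact: cvg_Im|exact: normc_Im_le].
Qed.

(** The formula is taken at X = q c, and 4 = 2 + 2 comes from adding the bounds for the two
    coordinates. *)
Lemma derivative_remainder c : 0 < c -> 0 < ln (q%:R * c) ->
  k1%:R <= m%:R * ln (q%:R * c) -> k2%:R <= m%:R * ln (q%:R * c) ->
  `|(L^`(r))%classic x%:C
    - (-1) ^+ r * \sum_(1 <= j < (Num.truncn (q%:R * c)).+1) chi j * (G (j%:R / q%:R))%:C|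
  <= (4 * pv_bound q * (`|G c| + `|a1| * lnpow q k1 m c + `|a2| * lnpow q k2 m c))%:C.
Proof.
move=> c0 lnc hk1 hk2; have X0 : 0 < q%:R * c by rewrite mulr_gt0.
have Xq : q%:R * c / q%:R = c by rewrite mulrC mulKf// gt_eqF.
set S := \sum_(1 <= j < _) _; set B := _ + _ + _.
have s1 : (-1) ^+ r * (-1) ^+ r = 1 :> R[i] by rewrite -exprMn mulrNN mulr1 expr1n.
have -> : (L^`(r))%classic x%:C - (-1) ^+ r * S =
    (-1) ^+ r * ((-1) ^+ r * (L^`(r))%classic x%:C - S).
  by rewrite mulrBr mulrA s1 mul1r.
rewrite normrM normrX normrN1 expr1n mul1r.
have coord p (pD : forall a b, p (a + b) = p a + p b)
    (pM : forall a (t : R), p (a * t%:C) = p a * t)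
    (p_cvg : forall (u : nat -> R[i]) l, u @ \oo --> l -> (p \o u) @ \oo --> p l)
    (p_le : forall z (c : R), `|z| <= c%:C -> `|p z| <= c) :
  `|p ((-1) ^+ r * (L^`(r))%classic x%:C - S)| <= 2 * pv_bound q * B.
  have -> : p ((-1) ^+ r * (L^`(r))%classic x%:C - S) =
     p ((-1) ^+ r * (L^`(r))%classic x%:C) - p S.
    rewrite pD; congr (_ + _); apply/eqP; rewrite -addr_eq0 -pD addNr.
    by rewrite (coordinate0 pM).
  rewrite (coord_formula q3 prim L_chi pD pM p_cvg x02 m0 G_nat dG X0) Xq.
  have -> : p S = \sum_(1 <= j < (Num.truncn (q%:R * c)).+1) p (chi j) * G (j%:R / q%:R).
    by rewrite /S (coordinate_sum pD pM); apply: eq_bigr => j _; rewrite pM.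
  rewrite -[X in `|X - _|]addrA addrAC subrr add0r.
  exact: (coord_remainder q3 prim pD pM p_le G a1 a2 m0 c0 lnc hk1 hk2).
apply: (le_trans (normc_le_ReIm _)); rewrite lecR.
have -> : 4 * pv_bound q * B = 2 * pv_bound q * B + 2 * pv_bound q * B by ring.
by apply: lerD; apply: coord;
  [exact: ReD|exact: ReM|exact: cvg_Re|exact: normc_Re_le
  |exact: ImD|exact: ImM|exact: cvg_Im|exact: normc_Im_le].
Qed.

End ComplexFormula.

(** * The weights for s = 1 and s = 0 *)

Section Kernels.
Context {R : realType} (q r : nat).
Hypothesis q0 : (0 < q)%N.
Hypothesis r0 : (0 < r)%N.

Let qR : (0 : R) < q%:R. Proof. by rewrite ltr0n. Qed.
Let qn0 : (q%:R : R) != 0. Proof. by rewrite gt_eqF. Qed.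

Lemma ln_scaled_nat (j : nat) : ln (q%:R * (j%:R / q%:R)) = ln (j%:R : R).
Proof. by rewrite mulrC divfK. Qed.

(* Antiderivatives of the kernels of I (s = 1) and II (s = 0). *)
Definition primitive1 (u : R) := q%:R^-1 * lnpow q r 1 u.
Definition primitive0 (u : R) := lnpow q r 0 u.

Lemma ln_derive (u : R) : 0 < u -> is_derive u (1 : R) (fun u => ln (q%:R * u)) u^-1.
Proof.
move=> u0; have qu0 : 0 < q%:R * u by rewrite mulr_gt0.
apply: isd_ext (isd_ln (f := fun u => q%:R * u) qu0 (isdZ q%:R (isd_id u))) _.
by field; rewrite qn0 gt_eqF.
Qed.

Lemma primitive1_nat (j : nat) : primitive1 (j%:R / q%:R) = expR (- (1 * ln j%:R)) * ln j%:R ^+ r.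
Proof.
(* At j = 0 both sides vanish, because [ln 0] is 0 by convention and r >= 1. *)
rewrite /primitive1 /lnpow ln_scaled_nat mul1r; case: j => [|j].
  by rewrite ln0// expr0n gtn_eqF// mul0r !mulr0.
rewrite expRN lnK ?posrE// expr1 invfM invrK mulrCA mulrA mulrAC -mulrA.
by rewrite mulfK// mulrC.
Qed.

Lemma primitive0_nat (j : nat) : primitive0 (j%:R / q%:R) = expR (- (0 * ln j%:R)) * ln j%:R ^+ r.
Proof. by rewrite /primitive0 /lnpow ln_scaled_nat mul0r oppr0 expR0 mul1r expr0 divr1. Qed.

Lemma is_derive_primitive1 (u : R) : 0 < u ->
  is_derive u (1 : R) primitive1 (kern q (r%:R / q%:R) r.-1 (- q%:R^-1) r 2 u).
Proof.
move=> u0; have un0 : u != 0 by rewrite gt_eqF.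
have un1 : u ^+ 1 != 0 by rewrite expr1.
apply: isd_ext (isdZ q%:R^-1 (isdM (isdX r (ln_derive u0))
   (isdV (f := fun u => u ^+ 1) un1 (isdX 1 (isd_id u))))) _.
rewrite /kern /lnpow /= !expr1 expr0.
by field; rewrite qn0 un0.
Qed.

Lemma is_derive_primitive0 (u : R) : 0 < u ->
  is_derive u (1 : R) primitive0 (kern q r%:R r.-1 0 0 1 u).
Proof.
move=> u0; have -> : primitive0 = fun u => ln (q%:R * u) ^+ r.
  by apply/funext => v; rewrite /primitive0 /lnpow expr0 divr1.
apply: isd_ext (isdX r (ln_derive u0)) _.
by rewrite /kern /lnpow expr1 mul0r addr0 mulrA.
Qed.

Lemma psi_kern1 b :
  (fun u : R => psi (u - b) / u ^+ 2 * ln (q%:R * u) ^+ r.-1 * (r%:R - ln (q%:R * u))) =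
  (fun u => psi (u - b) * kern q r%:R r.-1 (-1) r 2 u).
Proof.
apply/funext => u; rewrite /kern /lnpow; case: r r0 => // n _ /=.
by rewrite (exprS _ n); ring.
Qed.

Lemma psi_kern0 b :
  (fun u : R => psi (u - b) / u * ln (q%:R * u) ^+ r.-1) =
  (fun u => psi (u - b) * lnpow q r.-1 1 u).
Proof. by apply/funext => u; rewrite /lnpow expr1; ring. Qed.

End Kernels.

(** * Explicit estimates *)

Section Bounds.
Context {R : realType}.

Lemma ln_nat_sum_le (chi : nat -> R[i]) (r : nat) (X : R) :
  (forall n, `|chi n| <= 1) -> 1 <= X ->
  `|\sum_(1 <= n < (Num.truncn X).+1) chi n * (ln n%:R ^+ r / n%:R)%:C|
    <= (ln X ^+ r * (1 + ln X))%:C.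
Proof.
move=> chi1 X1; have X0 : 0 <= X by exact: le_trans X1.
have /andP[NX _] := truncn_itv X0; set N := Num.truncn X in NX *.
have lX : 0 <= ln X by exact: ln_ge0.
rewrite (le_trans (ler_norm_sum _ _ _))//.
apply: (@le_trans _ _ (\sum_(1 <= n < N.+1) (ln X ^+ r * n%:R^-1)%:C)).
  apply: ler_sum_nat => n /andP[n1 nN]; rewrite normrM -[leRHS]mul1r.
  have n0 : (0 : R) < n%:R by rewrite ltr0n.
  have nX : n%:R <= X by rewrite (le_trans _ NX)// ler_nat.
  apply: ler_pM => //; rewrite normc_real lecR ger0_norm; last first.
    by rewrite divr_ge0// exprn_ge0// ln_ge0// ler1n.
  apply: ler_wpM2r; first by rewrite invr_ge0 ltW.
  by rewrite lerXn2r ?nnegrE ?ln_ge0 ?ler1n// ler_ln ?posrE// (lt_le_trans n0).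
rewrite -real_complex_sum -mulr_sumr lecR; apply: ler_wpM2l; first by rewrite exprn_ge0.
case: N NX => [|N] NX; first by rewrite big_geq// addr_ge0.
rewrite big_add1/= (le_trans (harmonic_le _))// lerD2l ler_ln ?posrE//.
exact: lt_le_trans X1.
Qed.

Lemma log_scaled (t : R) (q : nat) : (3 <= q)%N ->
  [/\ 0 < expR t, ln (q%:R * expR t) = ln q%:R + t, (expR t)^-1 = expR (- t)
    & 1 <= ln (q%:R : R)].
Proof.
move=> q3; have q0 : (0 : R) < q%:R by rewrite ltr0n; lia.
split; [exact: expR_gt0| |by rewrite expRN|by apply: ln_ge1; rewrite ler_nat].
by rewrite lnM ?posrE ?expR_gt0// expRK.
Qed.

(** With l = ln q + r/2 the three terms are at most (1 + 2 + 1) l^r/(q c), because r <= 2 l and c >=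
    1. Then 128 = 4 * 8 * 4, and sqrt q/q = 1/sqrt q. *)
Lemma remainder1_le (q r : nat) (c : R) : (3 <= q)%N -> (0 < r)%N ->
  c = expR (r%:R / 2) ->
  4 * pv_bound q * (`|primitive1 q r c| + `|r%:R / q%:R| * lnpow q r.-1 2 c
     + `|- q%:R^-1| * lnpow q r 2 c)
  <= 128 * ((Num.sqrt q%:R)^-1 * expR (- (r%:R / 2)) * ln q%:R
              * (ln q%:R + r%:R / 2) ^+ r).
Proof.
move=> q3 r0 cdef; have [] := log_scaled (r%:R / 2) q3; rewrite -cdef => c0 lnc cE lnq1.
have q0 : (0 : R) < q%:R by rewrite ltr0n; lia.
have r20 : 0 <= r%:R / 2 :> R by rewrite divr_ge0.
have s0 : 0 < Num.sqrt q%:R :> R by rewrite sqrtr_gt0.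
have qs : q%:R = Num.sqrt q%:R * Num.sqrt q%:R :> R by rewrite -expr2 sqr_sqrtr// ltW.
rewrite /primitive1 /lnpow lnc -cE expr1; set l := ln q%:R + r%:R / 2.
have l0 : 0 <= l by rewrite /l; lra.
have ci0 : 0 <= c^-1 by rewrite invr_ge0 ltW.
have ci1 : c^-1 <= 1 by rewrite cE -[leRHS]expR0 ler_expR oppr_le0.
have lr0 : 0 <= l ^+ r / c by rewrite mulr_ge0// exprn_ge0.
have c2 k : l ^+ k / c ^+ 2 <= l ^+ k / c.
  rewrite expr2 invfM mulrA -[leRHS]mulr1; apply: ler_wpM2l => //.
  by rewrite mulr_ge0// exprn_ge0.
have rl : r%:R * (l ^+ r.-1 / c) <= 2 * (l ^+ r / c).
  rewrite -[in leRHS](prednK r0) exprS !mulrA; apply: ler_wpM2r => //.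
  by apply: ler_wpM2r; rewrite ?exprn_ge0// /l; lra.
have sum_le : `|q%:R^-1 * (l ^+ r / c)| + `|r%:R / q%:R| * (l ^+ r.-1 / c ^+ 2)
     + `|- q%:R^-1| * (l ^+ r / c ^+ 2) <= q%:R^-1 * (4 * (l ^+ r / c)).
  have qi0 : 0 <= q%:R^-1 :> R by rewrite invr_ge0 ltW.
  have -> : `|r%:R / q%:R| = q%:R^-1 * r%:R :> R by rewrite ger0_norm ?mulr_ge0// mulrC.
  have -> : `|q%:R^-1 * (l ^+ r / c)| = q%:R^-1 * (l ^+ r / c).
    by rewrite ger0_norm// mulr_ge0.
  rewrite normrN (ger0_norm qi0) -mulrA -!mulrDr.
  apply: ler_wpM2l => //.
  have := ler_wpM2l (ler0n R r) (c2 r.-1); have := c2 r; lra.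
have pv0 : 0 <= 4 * pv_bound q :> R.
  by rewrite /pv_bound !mulr_ge0 ?sqrtr_ge0//; lra.
apply: (le_trans (ler_wpM2l pv0 sum_le)); rewrite /pv_bound.
rewrite le_eqVlt; apply/orP; left; apply/eqP.
rewrite [q%:R^-1](_ : _ = (Num.sqrt q%:R)^-1 * (Num.sqrt q%:R)^-1); last by rewrite {1}qs invfM.
by field; rewrite !gt_eqF.
Qed.

(** With l = ln q + r, so that ln(q c) = l - 1, both terms are at most l^r, because r <= l and c >=
    1; hence 64 = 4 * 8 * 2. *)
Lemma remainder0_le (q r : nat) (c : R) : (3 <= q)%N -> (0 < r)%N ->
  c = expR (r%:R - 1) ->
  4 * pv_bound q * (`|primitive0 q r c| + `|r%:R : R| * lnpow q r.-1 1 c + `|0 : R| * lnpow q 0 1 c)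
  <= 64 * (Num.sqrt q%:R * ln q%:R * (ln q%:R + r%:R) ^+ r).
Proof.
move=> q3 r0 cdef; have [] := log_scaled (r%:R - 1) q3; rewrite -cdef => c0 lnc cE lnq1.
have r1 : 1 <= r%:R :> R by rewrite ler1n.
rewrite normr0 mul0r addr0 /primitive0 /lnpow lnc expr0 divr1 expr1.
set l' := ln q%:R + (r%:R - 1); set l := ln q%:R + r%:R.
have l'0 : 0 <= l' by rewrite /l'; lra.
have l'l : l' <= l by rewrite /l' /l; lra.
have pw k : l' ^+ k <= l ^+ k by rewrite lerXn2r ?nnegrE// (le_trans l'0).
have ci1 : c^-1 <= 1 by rewrite cE -[leRHS]expR0 ler_expR; lra.
have ci0 : 0 <= c^-1 by rewrite invr_ge0 ltW.
have second : `|r%:R| * (l' ^+ r.-1 / c) <= l ^+ r.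
  rewrite ger0_norm// -[in leRHS](prednK r0) exprS; apply: ler_pM => //.
  - by rewrite mulr_ge0// exprn_ge0.
  - by rewrite /l; lra.
  - by rewrite -[leRHS]mulr1; apply: ler_pM; rewrite ?exprn_ge0.
rewrite ger0_norm ?exprn_ge0//.
have pv0 : 0 <= 4 * pv_bound q :> R.
  by rewrite /pv_bound !mulr_ge0 ?sqrtr_ge0//; lra.
apply: (le_trans (ler_wpM2l pv0 (lerD (pw r) second))); rewrite /pv_bound.
rewrite le_eqVlt; apply/orP; left; apply/eqP; ring.
Qed.

End Bounds.

(** * The formulas and estimates at s = 1 and s = 0 *)

Theorem theorem3 (R : realType) :
  [/\ (* I (a) *)
      forall (q : nat) (chi : nat -> R[i]) (L : R[i] -> R[i]) (r : nat) (X : R),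
        (3 <= q)%N -> primitive_character q chi -> is_dirichlet_L chi L ->
        (1 <= r)%N -> 0 < X ->
        let f (a : nat) (u : R) : R :=
          psi (u - a%:R / q%:R) / u ^+ 2 * ln (q%:R * u) ^+ r.-1
            * (r%:R - ln (q%:R * u)) in
        (forall a : nat, (1 <= a <= q)%N -> improper_cvg (f a) (X / q%:R)) /\
        (-1) ^+ r * (L^`(r))%classic 1 =
          \sum_(1 <= n < (Num.truncn X).+1) chi n * (ln n%:R ^+ r / n%:R)%:C
          + \sum_(1 <= a < q.+1) chi a *
              (psi ((X - a%:R) / q%:R) * (ln X ^+ r / X)
               + q%:R^-1 * improper_int (f a) (X / q%:R))%:C,
      (* I (b) *)
      exists C1 C2 : R,
      forall (q : nat) (chi : nat -> R[i]) (L : R[i] -> R[i]) (r : nat),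
        (3 <= q)%N -> primitive_character q chi -> is_dirichlet_L chi L ->
        (1 <= r)%N ->
        `| (L^`(r))%classic 1
           - (-1) ^+ r *
             \sum_(1 <= n < (Num.truncn (q%:R * expR (r%:R / 2) : R)).+1)
               chi n * (ln n%:R ^+ r / n%:R)%:C |
          <= (C1 * ((Num.sqrt q%:R)^-1 * expR (- (r%:R / 2)) * ln q%:R
                    * (ln q%:R + r%:R / 2) ^+ r))%:C
        /\ `| (L^`(r))%classic 1 | <= (C2 * (ln q%:R + r%:R / 2) ^+ r.+1)%:C,
      (* II (a) *)
      forall (q : nat) (chi : nat -> R[i]) (L : R[i] -> R[i]) (r : nat) (X : R),
        (3 <= q)%N -> primitive_character q chi -> is_dirichlet_L chi L ->
        (1 <= r)%N -> 0 < X ->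
        let f (a : nat) (u : R) : R :=
          psi (u - a%:R / q%:R) / u * ln (q%:R * u) ^+ r.-1 in
        (forall a : nat, (1 <= a <= q)%N -> improper_cvg (f a) (X / q%:R)) /\
        (-1) ^+ r * (L^`(r))%classic 0 =
          \sum_(1 <= n < (Num.truncn X).+1) chi n * (ln n%:R ^+ r)%:C
          + (ln X ^+ r)%:C *
              \sum_(1 <= a < q.+1) chi a *
                ((X - a%:R) / q%:R - (Num.floor ((X - a%:R) / q%:R))%:~R
                 - 2^-1)%:C
          + r%:R * \sum_(1 <= a < q.+1) chi a *
              (improper_int (f a) (X / q%:R))%:C
    & (* II (b) *)
      exists C : R,
      forall (q : nat) (chi : nat -> R[i]) (L : R[i] -> R[i]) (r : nat),
        (3 <= q)%N -> primitive_character q chi -> is_dirichlet_L chi L ->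
        (1 <= r)%N ->
        `| (L^`(r))%classic 0
           - (-1) ^+ r *
             \sum_(1 <= n < (Num.truncn (q%:R * expR (r%:R - 1) : R)).+1)
               chi n * (ln n%:R ^+ r)%:C |
          <= (C * (Num.sqrt q%:R * ln q%:R * (ln q%:R + r%:R) ^+ r))%:C].
Proof.
have x1 : 0 <= (1 : R) <= 2 by rewrite ler01 ler1n.
have x0 : 0 <= (0 : R) <= 2 by rewrite lexx ler0n.
have G1n (q r j : nat) : (0 < q)%N -> (0 < r)%N -> primitive1 q r (j%:R / q%:R) = ln j%:R ^+ r / j%:R :> R.
  move=> q0 r0; rewrite primitive1_nat// mul1r; case: j => [|j].
    by rewrite ln0// expr0n gtn_eqF// mul0r mulr0.
  by rewrite expRN lnK ?posrE// mulrC.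
have G0n (q r j : nat) : (0 < q)%N -> primitive0 q r (j%:R / q%:R) = ln j%:R ^+ r :> R.
  by move=> q0; rewrite primitive0_nat// mul0r oppr0 expR0 mul1r.
split.
- move=> q chi L r X q3 prim L_chi r0 X0 f; have q0 : (0 < q)%N by lia.
  have qn0 : (q%:R : R) != 0 by rewrite pnatr_eq0 -lt0n.
  have c0 : 0 < X / q%:R by rewrite divr_gt0// ltr0n.
  have qX : q%:R * (X / q%:R) = X by rewrite mulrC divfK.
  have fE a : f a = fun u => psi (u - a%:R / q%:R) * kern q r%:R r.-1 (-1) r 2 u.
    exact: psi_kern1.
  have kc (b : R) a1 k1 a2 k2 := psi_kern_cvg q3 b a1 k1 a2 k2 c0 (isT : (0 < 2)%N).
  split=> [a _|]; first by rewrite fE; have [] := kc (a%:R / q%:R) r%:R r.-1 (-1) r.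
  have := derivative_formula q3 prim L_chi x1 (isT : (0 < 2)%N) (primitive1_nat q0 r0)
    (@is_derive_primitive1 R q r q0) X0.
  rewrite [1%:C](_ : _ = 1)// => ->; congr (_ + _).
    by apply: eq_bigr => j _; rewrite G1n.
  apply: eq_bigr => a _; congr (_ * _%:C); congr (_ * _ + _).
    by rewrite /primitive1 /lnpow qX expr1; field; rewrite qn0 gt_eqF.
  (* The derivative of [primitive1] contains the factor 1/q that stands before the integral in the
     statement. *)
  by rewrite fE (kc _ _ _ _ _).2 (kc _ _ _ _ _).2; ring.
(* With l = ln q + r/2 >= 1 the finite sum is at most l^r (1 + l) <= 2 l^(r+1), and 130 = 128 +
   2. *)
- exists 128, 130 => q chi L r q3 prim L_chi r0.
  have q0 : (0 < q)%N by lia.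
  have qR : (0 : R) < q%:R by rewrite ltr0n.
  have [c0 lnc cE lnq1] := log_scaled (r%:R / 2 : R) q3.
  have r20 : 0 <= r%:R / 2 :> R by rewrite divr_ge0.
  have ln0 : 0 < ln (q%:R * expR (r%:R / 2)) :> R by rewrite lnc; lra.
  (* Decrease over u^2 requires ln(q c) >= r/2, which c = e^(r/2) provides with ln q to spare. *)
  have h1 : r.-1%:R <= 2 * ln (q%:R * expR (r%:R / 2)) :> R.
    rewrite lnc; have : r.-1%:R <= r%:R :> R by rewrite ler_nat leq_pred.
    lra.
  have h2 : r%:R <= 2 * ln (q%:R * expR (r%:R / 2)) :> R by rewrite lnc; lra.
  have rem := derivative_remainder q3 prim L_chi x1 (isT : (0 < 2)%N) (primitive1_nat q0 r0)
    (@is_derive_primitive1 R q r q0) c0 ln0 h1 h2.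
  rewrite [1%:C](_ : _ = 1)// in rem.
  have sumE : \sum_(1 <= j < (Num.truncn (q%:R * expR (r%:R / 2) : R)).+1) chi j * (primitive1 q r (j%:R / q%:R) : R)%:C
     = \sum_(1 <= n < (Num.truncn (q%:R * expR (r%:R / 2) : R)).+1)
               chi n * (ln n%:R ^+ r / n%:R)%:C.
    by apply: eq_bigr => j _; rewrite G1n.
  rewrite sumE in rem.
  have rem_le := remainder1_le q3 r0 (erefl (expR (r%:R / 2) : R)).
  rewrite -lecR in rem_le; have {rem_le} bound := le_trans rem rem_le.
  split; first exact: bound.
  set l := ln q%:R + r%:R / 2 in bound *.
  have l1 : 1 <= l by rewrite /l; lra.
  have X1 : 1 <= q%:R * expR (r%:R / 2) :> R.
    by rewrite -[leLHS]mulr1 ler_pM// ?ler1n// -[leLHS]expR0 ler_expR.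
  have := ln_nat_sum_le r (norm_dchar_le1 q0 (proj1 prim)) X1.
  rewrite lnc -/l; set S := \sum_(1 <= n < _) _ in bound * => Sle.
  rewrite -[(L^`(r))%classic 1](subrK ((-1) ^+ r * S)).
  rewrite (le_trans (ler_normD _ _))// (le_trans (lerD bound (_ : _ <= (l ^+ r * (1 + l))%:C)))//.
    by rewrite normrM normrX normrN1 expr1n mul1r.
  rewrite -real_complexD lecR.
  have lr0 : 0 <= l ^+ r by rewrite exprn_ge0//; lra.
  have lr1 : l ^+ r <= l ^+ r.+1 by rewrite exprS ler_peMl.
  have main : (Num.sqrt q%:R)^-1 * expR (- (r%:R / 2)) * ln q%:R * l ^+ r <= l ^+ r.+1.
    have si : (Num.sqrt q%:R)^-1 <= 1 :> R.
      rewrite invf_le1 ?sqrtr_gt0// -[leLHS](sqrtr1 R); apply: ler_wsqrtr.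
      by rewrite ler1n.
    have ei : expR (- (r%:R / 2)) <= 1 :> R by rewrite -[leRHS]expR0 ler_expR oppr_le0.
    have lq : ln q%:R <= l by rewrite /l lerDl.
    have si0 : 0 <= (Num.sqrt q%:R)^-1 :> R by rewrite invr_ge0 sqrtr_ge0.
    have lq0 : 0 <= ln q%:R :> R by exact: le_trans lnq1.
    have := ler_pM si0 (expR_ge0 _) si ei; rewrite mulr1 => se.
    rewrite exprS; apply: ler_wpM2r => //; rewrite -[leRHS]mul1r.
    by apply: ler_pM => //; rewrite mulr_ge0// expR_ge0.
  have -> : l ^+ r * (1 + l) = l ^+ r + l ^+ r.+1 by rewrite exprS; ring.
  lra.
- move=> q chi L r X q3 prim L_chi r0 X0 f; have q0 : (0 < q)%N by lia.
  have qn0 : (q%:R : R) != 0 by rewrite pnatr_eq0 -lt0n.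
  have c0 : 0 < X / q%:R by rewrite divr_gt0// ltr0n.
  have qX : q%:R * (X / q%:R) = X by rewrite mulrC divfK.
  have fE a : f a = fun u => psi (u - a%:R / q%:R) * lnpow q r.-1 1 u.
    exact: psi_kern0.
  have cf a : improper_cvg (f a) (X / q%:R).
    by rewrite fE; apply: psi_lnpow_cvg.
  split=> [a _|]; first exact: cf.
  have := derivative_formula q3 prim L_chi x0 (isT : (0 < 1)%N) (primitive0_nat r q0)
    (@is_derive_primitive0 R q r q0) X0.
  rewrite [0%:C](_ : _ = 0)// => ->; rewrite -addrA; congr (_ + _).
    by apply: eq_bigr => j _; rewrite G0n.
  rewrite !mulr_sumr -big_split/=; apply: eq_bigr => a _.
  rewrite (psi_kern_cvg q3 _ _ _ _ _ c0 (isT : (0 < 1)%N)).2 mul0r addr0 -fE.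
  have -> : primitive0 q r (X / q%:R) = ln X ^+ r.
    by rewrite /primitive0 /lnpow qX expr0 divr1.
  by rewrite real_complexD !real_complexM real_complex_nat /psi; ring.
exists 64 => q chi L r q3 prim L_chi r0.
have q0 : (0 < q)%N by lia.
have [c0 lnc cE lnq1] := log_scaled (r%:R - 1 : R) q3.
have r1 : 1 <= r%:R :> R by rewrite ler1n.
have ln0 : 0 < ln (q%:R * expR (r%:R - 1)) :> R by rewrite lnc; lra.
have h1 : r.-1%:R <= 1 * ln (q%:R * expR (r%:R - 1)) :> R.
  by rewrite lnc -subn1 natrB//; lra.
have h2 : 0 <= 1 * ln (q%:R * expR (r%:R - 1)) :> R by rewrite mul1r ltW.
have := derivative_remainder q3 prim L_chi x0 (isT : (0 < 1)%N) (primitive0_nat r q0)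
    (@is_derive_primitive0 R q r q0) c0 ln0 h1 h2.
rewrite [0%:C](_ : _ = 0)//; under eq_bigr do rewrite G0n//.
by move=> /le_trans; apply; rewrite lecR; exact: remainder0_le.
Qed.
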